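(* Let $K$ be a field. Let $Q$ be the adjacency quiver of a triangulation of a closed surface with exactly one puncture, and view it as a triangulation quiver $(Q,f)$. Then: (a) For any power series $R(x)\in xK[[x]]$, the potential $W_R$ on $Q$ defined by $$W_R=-R(\omega)+\sum_\alpha\alpha\cdot f(\alpha)\cdot f^2(\alpha)$$ (where the sum runs over representatives $\alpha$ of the $f$-cycles) is non-degenerate. (b) Let $R_0(x)=0$ and $R_m(x)=x^m$ for $m\geq1$. Then $$\{W_{R_0}\}\cup\{W_{R_m}:m\geq1\text{ is not divisible by }\operatorname{char}K\}$$ is an infinite set of non-degenerate potentials on $Q$ whose Jacobian algebras are pairwise non-isomorphic.
   Context: Paths are written left to right; $\widehat{KQ}$ is the complete path algebra. A closed surface with exactly one puncture is a compact connected oriented surface without boundary (not a sphere, which is excluded when it has one puncture) with one marked point. An arc is a curve from the marked point to itself, otherwise without self-intersections and avoiding the marked point, not cutting out an unpunctured monogon or digon, up to isotopy; a triangulation $\tau$ is a maximal collection of pairwise non-crossing arcs, which cuts the surface into ideal triangles. The adjacency quiver $Q$ of $\tau$ (Fomin–Shapiro–Thurston), which for such surfaces equals the quiver of the triangulation quiver of $\tau$, has the arcs of $\tau$ as vertices, and for each triangle with sides $i,j,k$ in clockwise order three arrows $i\to j$, $j\to k$, $k\to i$; the permutation $f$ of $Q_1$ cyclically permutes the three arrows of each triangle ($f(\alpha)$ is the arrow of the same triangle starting where $\alpha$ ends). Each vertex has exactly two outgoing arrows; $\bar\alpha$ is the other arrow starting at the same vertex as $\alpha$, and $g(\alpha)=\overline{f(\alpha)}$.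 Here $g$ is a single cycle on $Q_1$; $\omega$ denotes the cycle $\alpha g(\alpha)g^2(\alpha)\cdots g^{|Q_1|-1}(\alpha)$ for any arrow $\alpha$ (all these cycles are rotationally equivalent). A potential is a possibly infinite linear combination of cycles of $Q$ considered up to rotation. The Jacobian algebra is $\mathcal{P}(Q,W)=\widehat{KQ}/\overline{(\partial_\alpha W:\alpha\in Q_1)}$, where $\partial_\alpha(\alpha_1\cdots\alpha_n)=\sum_{\alpha_i=\alpha}\alpha_{i+1}\cdots\alpha_n\alpha_1\cdots\alpha_{i-1}$. A quiver with potential $(Q,W)$ is non-degenerate if, for any sequence of mutations of quivers with potentials in the sense of Derksen–Weyman–Zelevinsky, the underlying quiver does not contain any 2-cycles. This mutation at a vertex $k$ (with no 2-cycle through it): write $W$ with no cycle starting at $k$; for all arrows $a$ ending and $b$ starting at $k$ add an arrow $[ab]$, replace each arrow $a$, $b$ incident to $k$ by opposite arrows $a^*$, $b^*$, take the potential $[W]+\sum[ab]b^*a^*$ where $[W]$ replaces each $ab$ through $k$ by $[ab]$, and pass to the reduced part (defined up to right equivalence). *)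

(* Defs.v *)
From HB Require Import structures.
From mathcomp Require Import all_boot all_algebra ring_quotient.
From mathcomp Require Import boolp classical_sets cardinality.

Set Implicit Arguments.
Unset Strict Implicit.
Unset Printing Implicit Defensive.

Import GRing.Theory.

Local Open Scope ring_scope.

Record quiver (V : finType) := Quiver {
  arrow : finType;
  src : arrow -> V;
  tgt : arrow -> V
}.

Section Paths.
Context {V : finType}.
Implicit Type Q : quiver V.

Fixpoint is_walk Q (v : V) (s : seq (arrow Q)) : bool :=
  if s is a :: s' then (src a == v) && is_walk (tgt a) s' else true.

Definition walk_end Q (v : V) (s : seq (arrow Q)) : V :=
  last v (map (@tgt V Q) s).

Definition is_cycle Q (c : seq (arrow Q)) : bool :=
  (c != [::]) && cycle (fun a b => tgt a == src b) c.

(* Contains every cycle [:: a; b] with a != b, and, for a loop a, the cycle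
   [:: a; a]; the quivers occurring in mutation theory have no loops. *)
Definition has_2cycle Q : Prop := exists a b : arrow Q, is_cycle [:: a; b].

Definition has_2cycle_at Q (k : V) : Prop :=
  exists a b : arrow Q, src a = k /\ is_cycle [:: a; b].

(* A path is a starting vertex and a list of consecutive arrows, read from left
   to right; the vertex makes the paths of length 0 distinct. *)
Record qpath Q := QPath {
  qpath_val : V * seq (arrow Q);
  qpath_walk : is_walk qpath_val.1 qpath_val.2
}.

HB.instance Definition _ Q := [isSub for @qpath_val Q].
HB.instance Definition _ Q := [Choice of qpath Q by <:].

Definition qstart Q (p : qpath Q) : V := (val p).1.
Definition qword Q (p : qpath Q) : seq (arrow Q) := (val p).2.

Lemma is_walk_cat Q v (s t : seq (arrow Q)) :
  is_walk v (s ++ t) = is_walk v s && is_walk (walk_end v s) t.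
Proof.
by elim: s v => [|a s IH] v //=; rewrite IH andbA.
Qed.

Lemma qtake_subproof Q (p : qpath Q) i : is_walk (qstart p) (take i (qword p)).
Proof.
by have := valP p; rewrite -{1}(cat_take_drop i (val p).2) is_walk_cat => /andP[].
Qed.

Lemma qdrop_subproof Q (p : qpath Q) i :
  is_walk (walk_end (qstart p) (take i (qword p))) (drop i (qword p)).
Proof.
by have := valP p; rewrite -{1}(cat_take_drop i (val p).2) is_walk_cat => /andP[].
Qed.

Definition qtake Q i (p : qpath Q) : qpath Q :=
  @QPath Q (_, _) (qtake_subproof p i).
Definition qdrop Q i (p : qpath Q) : qpath Q :=
  @QPath Q (_, _) (qdrop_subproof p i).

End Paths.

(* The complete path algebra: all (infinite) K-linear combinations of paths,
   with concatenation of paths as product. *)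
Definition cpa (V : finType) (K : fieldType) (Q : quiver V) := qpath Q -> K.

Section CompletePathAlgebra.
Context {V : finType} {K : fieldType} {Q : quiver V}.
Local Notation A := (cpa K Q).
Implicit Types (x y z : A) (p : qpath Q).

HB.instance Definition _ := gen_eqMixin A.
HB.instance Definition _ := gen_choiceMixin A.

Definition cpa_zero : A := fun=> 0.
Definition cpa_opp x : A := fun p => - x p.
Definition cpa_add x y : A := fun p => x p + y p.
Definition cpa_one : A := fun p => (nilp (qword p))%:R.
Definition cpa_mul x y : A :=
  fun p => \sum_(i < (size (qword p)).+1) x (qtake i p) * y (qdrop i p).
Definition cpa_scale (c : K) x : A := fun p => c * x p.

Lemma cpa_addA : associative cpa_add.
Proof. by move=> x y z; apply: funext => p; apply: addrA. Qed.
Lemma cpa_addC : commutative cpa_add.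
Proof. by move=> x y; apply: funext => p; apply: addrC. Qed.
Lemma cpa_add0 : left_id cpa_zero cpa_add.
Proof. by move=> x; apply: funext => p; apply: add0r. Qed.
Lemma cpa_addN : left_inverse cpa_zero cpa_opp cpa_add.
Proof. by move=> x; apply: funext => p; apply: addNr. Qed.

HB.instance Definition _ := GRing.isZmodule.Build A
  cpa_addA cpa_addC cpa_add0 cpa_addN.

Lemma qtake_take i j p : (j <= i)%N -> qtake j (qtake i p) = qtake j p.
Proof.
by move=> le_ji; apply: val_inj; rewrite /= /qstart /qword /= take_takel.
Qed.

Lemma qdrop_take i j p : (j <= i)%N ->
  qdrop j (qtake i p) = qtake (i - j) (qdrop j p).
Proof.
move=> le_ji; apply: val_inj; rewrite /= /qstart /qword /= take_takel //.
by rewrite take_drop subnK.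
Qed.

Lemma qdrop_drop i j p : qdrop i (qdrop j p) = qdrop (j + i) p.
Proof.
apply: val_inj; rewrite /= /qstart /qword /= drop_drop addnC; congr pair.
by rewrite /walk_end -last_cat -map_cat takeD.
Qed.

Lemma cpa_mulA : associative cpa_mul.
Proof.
move=> x y z; apply: funext => p; rewrite /cpa_mul.
have sz_drop j : size (qword (qdrop j p)) = (size (qword p) - j)%N.
  exact: size_drop.
set n := size (qword p).
pose F i j := x (qtake j p) * y (qtake (i - j) (qdrop j p)) * z (qdrop i p).
transitivity (\sum_(0 <= j < n.+1) \sum_(j <= i < n.+1) F i j).
  rewrite big_mkord; apply: eq_bigr => j _; rewrite sz_drop.
  have le_jn : (j <= n)%N by rewrite -ltnS.
  have -> : \sum_(j <= i < n.+1) F i j = \sum_(k < (n - j).+1) F (k + j)%N j.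
    by rewrite -{1}[val j]add0n big_addn big_mkord subSn.
  rewrite big_distrr /=; apply: eq_bigr => k _.
  by rewrite /F addnK qdrop_drop [(val j + _)%N]addnC mulrA.
transitivity (\sum_(0 <= i < n.+1) \sum_(0 <= j < i.+1) F i j).
  under eq_bigr => j _ do rewrite (big_nat_widenl _ 0) //=.
  rewrite (exchange_big_dep_nat xpredT) //=; apply: eq_big_nat => i /andP[_ lt_in].
  by rewrite [RHS](big_nat_widen _ _ _ _ _ lt_in).
rewrite big_mkord; apply: eq_bigr => i _.
have le_in : (i <= n)%N by rewrite -ltnS.
have -> : size (qword (qtake i p)) = i by exact: size_takel.
rewrite big_distrl big_mkord; apply: eq_bigr => j _.
have le_ji : (j <= i)%N by rewrite -ltnS.
by rewrite /F qtake_take // qdrop_take.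
Qed.

Lemma cpa_mul1 : left_id cpa_one cpa_mul.
Proof.
move=> x; apply: funext => p; rewrite /cpa_mul big_ord_recl big1.
  rewrite /cpa_one /= /qword /= take0 mul1r addr0; congr x.
  case: p => -[v s] w; apply: val_inj; rewrite /= take0.
  by rewrite [qword _]/= drop0.
by move=> i _; rewrite /cpa_one /qword /= /nilp size_takel ?mul0r //.
Qed.

Lemma cpa_mulr1 : right_id cpa_one cpa_mul.
Proof.
move=> x; apply: funext => p; rewrite /cpa_mul big_ord_recr big1 /=.
  rewrite /cpa_one /qword /= drop_size mulr1 add0r; congr x.
  by case: p => -[v s] w; apply: val_inj; rewrite /= [qword _]/= take_size.
move=> i _; rewrite /cpa_one /qword /= /nilp size_drop subn_eq0.
by rewrite leqNgt ltn_ord mulr0.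
Qed.

Lemma cpa_mulDl : left_distributive cpa_mul +%R.
Proof.
move=> x y z; apply: funext => p.
rewrite -[RHS]/(cpa_mul x z p + cpa_mul y z p) -big_split.
by apply: eq_bigr => i _; apply: mulrDl.
Qed.

Lemma cpa_mulDr : right_distributive cpa_mul +%R.
Proof.
move=> x y z; apply: funext => p.
rewrite -[RHS]/(cpa_mul x y p + cpa_mul x z p) -big_split.
by apply: eq_bigr => i _; apply: mulrDr.
Qed.

HB.instance Definition _ := GRing.Zmodule_isPzRing.Build A
  cpa_mulA cpa_mul1 cpa_mulr1 cpa_mulDl cpa_mulDr.

Lemma cpa_scaleA (a b : K) x : cpa_scale a (cpa_scale b x) = cpa_scale (a * b) x.
Proof. by apply: funext => p; apply: mulrA. Qed.
Lemma cpa_scale1 : left_id 1 cpa_scale.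
Proof. by move=> x; apply: funext => p; apply: mul1r. Qed.
Lemma cpa_scaleDr : right_distributive cpa_scale +%R.
Proof. by move=> a x y; apply: funext => p; apply: mulrDr. Qed.
Lemma cpa_scaleDl x : {morph cpa_scale^~ x : a b / a + b}.
Proof. by move=> a b; apply: funext => p; apply: mulrDl. Qed.

HB.instance Definition _ := GRing.Zmodule_isLmodule.Build K A
  cpa_scaleA cpa_scale1 cpa_scaleDr cpa_scaleDl.

Lemma cpa_scaleAl (a : K) x y : a *: (x * y) = (a *: x) * y.
Proof.
apply: funext => p; rewrite -[LHS]/(a * cpa_mul x y p) big_distrr.
by apply: eq_bigr => i _; apply: mulrA.
Qed.

Lemma cpa_scaleAr (a : K) x y : a *: (x * y) = x * (a *: y).
Proof.
apply: funext => p; rewrite -[LHS]/(a * cpa_mul x y p) big_distrr.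
by apply: eq_bigr => i _; apply: mulrCA.
Qed.

Definition idem (v : V) : A := fun p => (val p == (v, [::]))%:R.

(* The element given by a path of positive length, which is determined by its
   arrows; it is 0 if the arrows of s are not consecutive. *)
Definition word (s : seq (arrow Q)) : A := fun p => (qword p == s)%:R.

(* \sum_n R_n x^n, for x with zero coefficients at the paths of length 0: only
   the powers x^n with n <= size p contribute to the coefficient of p. *)
Definition psubst (R : nat -> K) x : A :=
  fun p => \sum_(n < (size (qword p)).+1) R n * (x ^+ n) p.

(* Closure for the topology given by the powers of the arrow ideal. *)
Definition madic_closure (S : set A) : set A :=
  [set x | forall n, exists2 y, S y &
    forall p, (size (qword p) < n)%N -> x p = y p]%classic.

Definition ideal_generated (S : set A) : set A :=
  [set x | exists2 s : seq (A * A * A), (forall t, t \in s -> S t.1.2) &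
    x = \sum_(t <- s) t.1.1 * t.1.2 * t.2]%classic.

Definition closed_ideal (S : set A) : {pred A} :=
  fun x => `[< madic_closure (ideal_generated S) x >].

Lemma ideal_generated0 S : ideal_generated S 0.
Proof. by exists [::] => //; rewrite big_nil. Qed.

Lemma ideal_generatedD S x y :
  ideal_generated S x -> ideal_generated S y -> ideal_generated S (x + y).
Proof.
move=> [s hs ->] [t ht ->]; exists (s ++ t); last by rewrite big_cat.
by move=> u; rewrite mem_cat => /orP[/hs|/ht].
Qed.

Lemma ideal_generatedMl S z x :
  ideal_generated S x -> ideal_generated S (z * x).
Proof.
move=> [s hs ->]; exists [seq (z * t.1.1, t.1.2, t.2) | t <- s].
  by move=> _ /mapP[t /hs ? ->].
by rewrite big_map mulr_sumr; apply: eq_bigr => t _; rewrite !mulrA.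
Qed.

Lemma ideal_generatedMr S z x :
  ideal_generated S x -> ideal_generated S (x * z).
Proof.
move=> [s hs ->]; exists [seq (t.1.1, t.1.2, t.2 * z) | t <- s].
  by move=> _ /mapP[t /hs ? ->].
by rewrite big_map mulr_suml; apply: eq_bigr => t _; rewrite !mulrA.
Qed.

Lemma closed_idealP S x :
  reflect (madic_closure (ideal_generated S) x) (x \in closed_ideal S).
Proof. exact: asboolP. Qed.

Lemma closed_idealMl S z x : x \in closed_ideal S -> z * x \in closed_ideal S.
Proof.
move=> /closed_idealP Sx; apply/closed_idealP => n; have [y Sy xy] := Sx n.
exists (z * y); first exact: ideal_generatedMl.
move=> p lt_pn; apply: eq_bigr => i _; congr (_ * _); apply: xy.
by apply: leq_ltn_trans lt_pn; rewrite [qword _]/= size_drop leq_subr.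
Qed.

Lemma closed_idealMr S z x : x \in closed_ideal S -> x * z \in closed_ideal S.
Proof.
move=> /closed_idealP Sx; apply/closed_idealP => n; have [y Sy xy] := Sx n.
exists (y * z); first exact: ideal_generatedMr.
move=> p lt_pn; apply: eq_bigr => i _; congr (_ * _); apply: xy.
by apply: leq_ltn_trans lt_pn; rewrite [qword _]/= size_take_min geq_minr.
Qed.

Lemma closed_idealZ S c x : x \in closed_ideal S -> c *: x \in closed_ideal S.
Proof. by move=> Sx; rewrite -[x]mul1r cpa_scaleAl; apply: closed_idealMl. Qed.

Lemma closed_ideal_zmod_closed S : zmod_closed (closed_ideal S).
Proof.
split=> [|x y /closed_idealP Sx Sy].
  by apply/closed_idealP => n; exists 0 => //; apply: ideal_generated0.
have /closed_idealP {}Sy : - y \in closed_ideal S.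
  by rewrite -[y]mul1r -mulNr; apply: closed_idealMl.
apply/closed_idealP => n; have [x' Sx' xx'] := Sx n; have [y' Sy' yy'] := Sy n.
exists (x' + y'); first exact: ideal_generatedD.
by move=> p lt_pn; congr (_ + _); [apply: xx' | apply: yy'].
Qed.

HB.instance Definition _ (S : set A) :=
  GRing.isZmodClosed.Build A (closed_ideal S) (closed_ideal_zmod_closed S).

End CompletePathAlgebra.

Arguments cpa {V} K Q.

Section Quotient.
Context {V : finType} {K : fieldType} {Q : quiver V}.
Variable S : set (cpa K Q).

Definition cpa_quot := Quotient.quot (closed_ideal S).

HB.instance Definition _ := GRing.Zmodule.on cpa_quot.

Local Notation pi := (\pi_cpa_quot)%qT.

Lemma eq_pi x y : (pi x == pi y) = (x - y \in closed_ideal S).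
Proof. by rewrite -Quotient.idealrBE. Qed.

Definition cpa_quot_one : cpa_quot := pi 1.
Definition cpa_quot_mul (x y : cpa_quot) : cpa_quot := pi (repr x * repr y).
Definition cpa_quot_scale (c : K) (x : cpa_quot) : cpa_quot := pi (c *: repr x).

Lemma repr_pi x : repr (pi x) - x \in closed_ideal S.
Proof. by rewrite -eq_pi reprK. Qed.

Lemma pi_mul x y : pi (x * y) = cpa_quot_mul (pi x) (pi y).
Proof.
apply/eqP; rewrite eq_sym eq_pi.
set x' := repr _; set y' := repr _.
have -> : x' * y' - x * y = (x' - x) * y' + x * (y' - y).
  by rewrite mulrBl mulrBr addrA subrK.
by apply: rpredD; [apply: closed_idealMr | apply: closed_idealMl]; apply: repr_pi.
Qed.

Lemma pi_scale c x : pi (c *: x) = cpa_quot_scale c (pi x).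
Proof.
by apply/eqP; rewrite eq_sym eq_pi -scalerBr closed_idealZ ?repr_pi.
Qed.

Lemma pi_add x y : pi (x + y) = pi x + pi y.
Proof. exact: Quotient.pi_add. Qed.

Lemma cpa_quot_ind (P : cpa_quot -> Prop) : (forall x, P (pi x)) -> forall x, P x.
Proof. by move=> Ppi x; rewrite -[x]reprK. Qed.

Lemma cpa_quot_mulA : associative cpa_quot_mul.
Proof.
elim/cpa_quot_ind => x; elim/cpa_quot_ind => y; elim/cpa_quot_ind => z.
by rewrite -!pi_mul mulrA.
Qed.
Lemma cpa_quot_mul1 : left_id cpa_quot_one cpa_quot_mul.
Proof. by elim/cpa_quot_ind => x; rewrite -pi_mul mul1r. Qed.
Lemma cpa_quot_mulr1 : right_id cpa_quot_one cpa_quot_mul.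
Proof. by elim/cpa_quot_ind => x; rewrite -pi_mul mulr1. Qed.
Lemma cpa_quot_mulDl : left_distributive cpa_quot_mul +%R.
Proof.
elim/cpa_quot_ind => x; elim/cpa_quot_ind => y; elim/cpa_quot_ind => z.
by rewrite -pi_add -!pi_mul mulrDl pi_add.
Qed.
Lemma cpa_quot_mulDr : right_distributive cpa_quot_mul +%R.
Proof.
elim/cpa_quot_ind => x; elim/cpa_quot_ind => y; elim/cpa_quot_ind => z.
by rewrite -pi_add -!pi_mul mulrDr pi_add.
Qed.

HB.instance Definition _ := GRing.Zmodule_isPzRing.Build cpa_quot
  cpa_quot_mulA cpa_quot_mul1 cpa_quot_mulr1 cpa_quot_mulDl cpa_quot_mulDr.

Lemma cpa_quot_scaleA a b x :
  cpa_quot_scale a (cpa_quot_scale b x) = cpa_quot_scale (a * b) x.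
Proof. by elim/cpa_quot_ind: x => x; rewrite -!pi_scale scalerA. Qed.
Lemma cpa_quot_scale1 : left_id 1 cpa_quot_scale.
Proof. by elim/cpa_quot_ind => x; rewrite -pi_scale scale1r. Qed.
Lemma cpa_quot_scaleDr : right_distributive cpa_quot_scale +%R.
Proof.
move=> a; elim/cpa_quot_ind => x; elim/cpa_quot_ind => y.
by rewrite -pi_add -!pi_scale scalerDr pi_add.
Qed.
Lemma cpa_quot_scaleDl x : {morph cpa_quot_scale^~ x : a b / a + b}.
Proof.
elim/cpa_quot_ind: x => x a b.
by rewrite -!pi_scale scalerDl pi_add.
Qed.

HB.instance Definition _ := GRing.Zmodule_isLmodule.Build K cpa_quot
  cpa_quot_scaleA cpa_quot_scale1 cpa_quot_scaleDr cpa_quot_scaleDl.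

End Quotient.

(* A potential, i.e. a possibly infinite linear combination of cycles up to
   rotation, is encoded by the function sending each cycle c to the coefficient
   of the rotation class of c. *)
Record potential (V : finType) (K : fieldType) (Q : quiver V) := Potential {
  pcoef :> seq (arrow Q) -> K;
  pcoef_cycle : forall c, ~~ is_cycle c -> pcoef c = 0;
  pcoef_rot : forall c, pcoef (rot 1 c) = pcoef c
}.
Arguments potential {V} K Q.

Definition rotations (T : eqType) (c : seq T) : seq (seq T) :=
  undup [seq rot i c | i <- iota 0 (size c)].

Section Potentials.
Context {V : finType} {K : fieldType} {Q : quiver V}.
Implicit Types (x : cpa K Q) (c : seq (arrow Q)) (W : potential K Q).

Lemma is_cycle_rot1 c : is_cycle (rot 1 c) = is_cycle c.
Proof. by rewrite /is_cycle rot_cycle -!size_eq0 size_rot. Qed.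

Lemma potential_rot W n c : W (rot n c) = W c.
Proof.
elim: n => [|n IH]; first by rewrite rot0.
have [lt_nc|le_cn] := ltnP n (size c); last by rewrite rot_oversize // ltnW.
by rewrite rotS ?pcoef_rot.
Qed.

Section CyclePot.
Variable F : seq (arrow Q) -> K.
Hypothesis F_rot : forall c, is_cycle c -> F (rot 1 c) = F c.

Lemma cycle_pot_cycle c : ~~ is_cycle c -> (if is_cycle c then F c else 0) = 0.
Proof. by move/negPf->. Qed.

Lemma cycle_pot_rot c :
  (if is_cycle (rot 1 c) then F (rot 1 c) else 0) =
  (if is_cycle c then F c else 0).
Proof. by rewrite is_cycle_rot1; case: ifP => // /F_rot. Qed.

Definition cycle_pot : potential K Q := Potential cycle_pot_cycle cycle_pot_rot.

End CyclePot.

Definition word_coef x c : K :=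
  if c is a :: _ then oapp x 0 (insub (src a, c)) else 0.

Lemma rotations_rot (T : eqType) k (c : seq T) :
  (k <= size c)%N -> {subset rotations (rot k c) <= rotations c}.
Proof.
move=> le_kc d; rewrite !mem_undup size_rot => /mapP[i].
rewrite mem_iota => /= lt_ic ->; rewrite rot_add_mod ?(ltnW lt_ic) //.
set j := (X in rot X c); have le_jc : (j <= size c)%N.
  by rewrite /j; case: ifP => // _; rewrite leq_subLR leq_add // ltnW.
have c_gt0 : (0 < size c)%N by apply: leq_ltn_trans lt_ic.
have [lt_jc|le_cj] := ltnP j (size c); first by apply: map_f; rewrite mem_iota.
by rewrite rot_oversize // -[X in X \in _]rot0; apply: map_f; rewrite mem_iota.
Qed.

Lemma rotations_rot1 (T : eqType) (c : seq T) :
  perm_eq (rotations (rot 1 c)) (rotations c).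
Proof.
case: c => [//|u c]; apply: uniq_perm; rewrite ?undup_uniq // => d.
apply/idP/idP; first exact: rotations_rot.
rewrite -{1}[u :: c](rotK 1) /rotr; apply: rotations_rot.
by rewrite leq_subr.
Qed.

Lemma cyc_rot x c : is_cycle c ->
  \sum_(d <- rotations (rot 1 c)) word_coef x d =
  \sum_(d <- rotations c) word_coef x d.
Proof. by move=> _; apply: perm_big; apply: rotations_rot1. Qed.

(* The potential obtained from an element of the complete path algebra by
   forgetting the paths that are not cycles of positive length and identifying
   cycles up to rotation. *)
Definition cyc x : potential K Q := cycle_pot (cyc_rot x).

(* In the cyclic derivative of c_1 ... c_n at a, the coefficient of u is the
   number of i with c_i c_(i+1) ... c_(i-1) = a u. When c is a rotation of a u,
   this is the number of i < n with rot i (a u) = a u. *)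
Definition deriv_pot W (a : arrow Q) : cpa K Q := fun u =>
  let c := a :: qword u in
  if qstart u == tgt a
  then W c *+ count (fun i => rot i c == c) (iota 0 (size c)) else 0.

Definition jacobian W := cpa_quot (range (deriv_pot W)).

End Potentials.

Definition jacobian_iso (V V' : finType) (K : fieldType) (Q : quiver V)
    (Q' : quiver V') (W : potential K Q) (W' : potential K Q') : Prop :=
  exists phi : {rmorphism jacobian W -> jacobian W'},
    bijective phi /\ scalable phi.

Record qp (V : finType) (K : fieldType) := QP {
  qp_quiver :> quiver V;
  qp_pot : potential K qp_quiver
}.
Arguments QP {V K} qp_quiver qp_pot.

Section Mutation.
Context {V : finType} {K : fieldType}.
Implicit Types X Y T : qp V K.

(* An algebra isomorphism fixing the idempotents maps the arrow ideal onto the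
   arrow ideal, which is the Jacobson radical, so it is continuous. *)
Definition right_equivalent X Y : Prop :=
  exists phi : {rmorphism cpa K X -> cpa K Y},
    [/\ bijective phi, scalable phi, forall v, phi (idem v) = idem v &
        exists2 x, cyc x = qp_pot X & cyc (phi x) = qp_pot Y].

Definition qp_reduced X : Prop :=
  forall c, (size c <= 2)%N -> qp_pot X c = 0.

Definition qp_trivial X : Prop :=
  (forall c, size c <> 2%N -> qp_pot X c = 0) /\
  (forall b : arrow X, exists k : arrow X -> K,
     word [:: b] = \sum_a k a *: deriv_pot (qp_pot X) a).

Section Sum.
Variables X Y : qp V K.

Definition sum_quiver : quiver V := {|
  arrow := (arrow X + arrow Y)%type;
  src a := match a with inl b => src b | inr b => src b end;
  tgt a := match a with inl b => tgt b | inr b => tgt b end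
|}.

Definition left_arrow (a : arrow sum_quiver) : option (arrow X) :=
  if a is inl b then Some b else None.
Definition right_arrow (a : arrow sum_quiver) : option (arrow Y) :=
  if a is inr b then Some b else None.

Definition sum_coef (c : seq (arrow sum_quiver)) : K :=
  if all left_arrow c then qp_pot X (pmap left_arrow c)
  else if all right_arrow c then qp_pot Y (pmap right_arrow c) else 0.

Lemma sum_coef_rot c : is_cycle c -> sum_coef (rot 1 c) = sum_coef c.
Proof.
move=> _; rewrite /sum_coef; case: c => // a c; rewrite rot1_cons !all_rcons /=.
case: ifP => [/andP[]|_]; last case: ifP => [/andP[]|_] //.
  case: a => // a _ _.
  by rewrite -cats1 pmap_cat /= cats1 -rot1_cons pcoef_rot.
case: a => // a _ _.
by rewrite -cats1 pmap_cat /= cats1 -rot1_cons pcoef_rot.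
Qed.

Definition qp_sum : qp V K := QP sum_quiver (cycle_pot sum_coef_rot).

End Sum.

Section Premutation.
Variables (k : V) (X : qp V K).

(* The arrows of X not incident to k, the composite arrows [a b], and the
   opposites of the arrows incident to k. *)
Definition kept_arrow := {c : arrow X | (src c != k) && (tgt c != k)}.
Definition comp_arrow :=
  {ab : arrow X * arrow X | (tgt ab.1 == k) && (src ab.2 == k)}.
Definition star_arrow := {c : arrow X | (src c == k) || (tgt c == k)}.

Definition premut_quiver : quiver V := {|
  arrow := (kept_arrow + comp_arrow + star_arrow)%type;
  src x := match x with
           | inl (inl c) => src (val c)
           | inl (inr ab) => src (val ab).1
           | inr c => tgt (val c)
           end;
  tgt x := match x with
           | inl (inl c) => tgt (val c)
           | inl (inr ab) => tgt (val ab).2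
           | inr c => src (val c)
           end
|}.

Lemma comp_star1 (ab : comp_arrow) :
  (src (val ab).1 == k) || (tgt (val ab).1 == k).
Proof. by case/andP: (valP ab) => ->; rewrite orbT. Qed.

Lemma comp_star2 (ab : comp_arrow) :
  (src (val ab).2 == k) || (tgt (val ab).2 == k).
Proof. by case/andP: (valP ab) => _ ->. Qed.

Definition comp_triangle (ab : comp_arrow) : seq (arrow premut_quiver) :=
  [:: inl (inr ab);
      inr (exist _ (val ab).2 (comp_star2 ab) : star_arrow);
      inr (exist _ (val ab).1 (comp_star1 ab) : star_arrow)].

Definition expand (x : arrow premut_quiver) : seq (arrow X) :=
  match x with
  | inl (inl c) => [:: val c]
  | inl (inr ab) => [:: (val ab).1; (val ab).2]
  | inr _ => [::]
  end.

Definition unstarred (x : arrow premut_quiver) : bool :=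
  if x is inl _ then true else false.

(* The first summand is the coefficient of c in [W]: every rotation class of
   cycles of X has a member that does not start at k, and replacing its factors
   a b through k by [a b] is inverse to expand. *)
Definition premut_coef (c : seq (arrow premut_quiver)) : K :=
  (if all unstarred c then qp_pot X (flatten (map expand c)) else 0)
  + cyc (\sum_(ab : comp_arrow) word (comp_triangle ab)) c.

Lemma premut_coef_rot c : is_cycle c -> premut_coef (rot 1 c) = premut_coef c.
Proof.
move=> _; rewrite /premut_coef pcoef_rot; congr (_ + _).
case: c => // x c; rewrite rot1_cons all_rcons /=; case: ifP => // _.
rewrite map_rcons flatten_rcons.
by rewrite -rot_size_cat potential_rot.
Qed.

Definition premutation : qp V K := QP premut_quiver (cycle_pot premut_coef_rot).

End Premutation.

Definition is_reduced_part X Y : Prop :=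
  qp_reduced Y /\
  exists T, qp_trivial T /\ right_equivalent X (qp_sum T Y).

(* Mutation is defined up to right equivalence, hence a relation; a reduced part
   always exists by the splitting theorem of Derksen, Weyman and Zelevinsky. *)
Definition is_mutation (k : V) X Y : Prop :=
  ~ has_2cycle_at X k /\ is_reduced_part (premutation k X) Y.

Inductive mutation_reachable X : qp V K -> Prop :=
| reachable_refl : mutation_reachable X X
| reachable_step k Y Z : mutation_reachable X Y -> is_mutation k Y Z ->
    mutation_reachable X Z.

Definition nondegenerate_qp X : Prop :=
  forall Y, mutation_reachable X Y -> ~ has_2cycle Y.

End Mutation.

(* A triangulation of a closed oriented surface, given by its arcs, its
   triangles and the way the triangles are glued: side t i, for i = 0, 1, 2, are
   the sides of the triangle t in clockwise order, and each arc is a side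
   twice.  The surface is obtained from the triangles by identifying, with
   reversal of orientation, the two occurrences of each arc as a side. *)
Record triangulation := Triangulation {
  arc : finType;
  triangle : finType;
  side : triangle -> 'I_3 -> arc;
  side_twice : forall a, #|[set x : triangle * 'I_3 | side x.1 x.2 == a]| = 2
}.

Definition adjacency_quiver (T : triangulation) : quiver (arc T) := {|
  arrow := (triangle T * 'I_3)%type;
  src x := side x.1 x.2;
  tgt x := side x.1 (ordS x.2)
|}.

Definition tri_f (T : triangulation) (a : arrow (adjacency_quiver T)) :
  arrow (adjacency_quiver T) := (a.1, ordS a.2).

(* The other arrow starting at the same vertex; in an adjacency quiver exactly two
   arrows start at each vertex, by side_twice. *)
Definition bar_arrow (V : finType) (Q : quiver V) (a : arrow Q) : arrow Q :=
  odflt a [pick b | (src b == src a) && (b != a)].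

Definition g_of (V : finType) (Q : quiver V) (f : arrow Q -> arrow Q)
  (a : arrow Q) : arrow Q := bar_arrow (f a).

(* The arrow (t, i) stands for the corner of t between the sides i and i + 1,
   and g maps a corner to the next one around the same marked point: the marked
   points are the g-cycles.  If there is exactly one, then the surface is
   connected and nonempty; as 3 #|triangle T| = 2 #|arc T|, its Euler
   characteristic is 1 - #|arc T| / 3 < 2, so it is not a sphere. *)
Definition punctures (T : triangulation) : nat :=
  fcard (g_of (@tri_f T)) predT.

Section PotentialR.
Context {V : finType} {K : fieldType} {Q : quiver V}.
Variable f : arrow Q -> arrow Q.

Definition omega (a : arrow Q) : cpa K Q :=
  word (traject (g_of f) a #|arrow Q|).

(* froots f contains one representative of each f-cycle. *)
Definition pot_R (R : nat -> K) (a : arrow Q) : potential K Q :=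
  cyc (- psubst R (omega a)
       + \sum_(b | froots f b) word [:: b; f b; f (f b)]).

End PotentialR.

Definition R_ (K : fieldType) (m : nat) : nat -> K :=
  fun n => ((0 < m)%N && (n == m))%:R.

(* Main.v *)
Require Import Defs.
From HB Require Import structures.
From mathcomp Require Import all_boot all_algebra.
From mathcomp Require Import boolp classical_sets cardinality.
From mathcomp Require Import zify.

Set Implicit Arguments.
Unset Strict Implicit.
Unset Printing Implicit Defensive.

Import GRing.Theory.

Local Open Scope ring_scope.

(** The arrows of an adjacency quiver are treated as darts.  The source map of the
    darts, with two darts over each arc, never changes; a triangulation is a map
    [f] of order three without fixed darts, and the surface has one puncture when
    [g d = bar (f d)] is a single cycle ([one_puncture_map]).  A loop or a 2-cycle
    of such a quiver would contradict the order of [f] or make [g x] or [g (g x)]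
    equal to [x], whereas the cycle of [g] has at least three darts.

    Non-degeneracy.  Mutation at an arc [k] should be the flip of [k], which is
    again given by a one-puncture map on the same darts ([flip_one_puncture]),
    and should take the potential of [f] to the potential of the same [R] for the
    flipped map.  So the invariant is that each quiver with potential reached by
    mutations is right equivalent to such a potential; none of these has a 2-cycle,
    and right equivalent quivers have the same arrows.  Two facts make the
    invariant propagate.  Premutation respects right equivalence
    ([premutation_right_equivalent]): an isomorphism [phi] induces one on the
    premutations, given by [phi] inside the brackets and on the reversed arrows by
    the matrices inverse to the ones that describe [phi] on the arrows at [k], so
    that the sum of the new triangles is preserved up to rotation.  And any reduced
    part of the premutation of the potential of [f] is right equivalent to the
    flipped potential ([reduced_premutation_flip]).

    As for the second fact, the quadratic part of the premutation is a sum of two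
    products [c_i e_i].  Eliminating [e_i] sends the potential to the flipped one whatever is
    substituted for [c_i], because each [c_i] occurs in the potential only in
    [c_i (e_i + ...)] and the substitution kills the bracket.  This family of
    substitutions is used in [cancellation].  Given a splitting into a trivial and
    a reduced part [Z], the values of the [c_i] are chosen such that the
    substitution kills one half of the linear forms of the trivial part.  Then it
    kills the trivial potential, and on [Z] it is a homomorphism to the flipped
    quiver that respects the potentials; its linear part is invertible, hence so
    is the homomorphism.  The computation behind the family is that the turn
    around the puncture becomes, after the substitution, the turn around the
    puncture of the flipped triangulation ([detour_traject], [F_omega]).

    Jacobian algebras.  Let [N] be the number of darts.  In the Jacobian algebra
    of the potential of exponent [m] the relation is that the path [f a], [f (f a)]
    equals [m] times the path of length [m * N - 1] along [g] ([deriv_W]).  If [m] is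
    invertible in the field, all paths of length [m * N + 1] vanish
    ([mpow_relations]), but the path of length [m * N] along [g] does not
    ([word_gpath_survives]).  For exponent 0, no path along [g] vanishes.  Arrows
    square to zero, since there are no loops; so a ring isomorphism maps
    arrows into the arrow ideal and paths of length [n] into its [n]-th power, and
    the greatest length of a nonzero path distinguishes the algebras.  The
    exponents that are 1 modulo the characteristic give infinitely many of them. *)

(** * Coefficients and the powers of the arrow ideal *)

Section Coefficients.
Context {V : finType} {K : fieldType} {Q : quiver V}.
Local Notation A := (cpa K Q).
Implicit Types (x y z : A) (v : V) (s t : seq (arrow Q)).

(** Reading an element at a pair of a vertex and a list of arrows, with value 0
    off the paths, avoids the proofs that are part of the type of paths. *)
Definition wcoef x v s : K := oapp x 0 (insub (v, s) : option (qpath Q)).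

Lemma wcoef_path x (p : qpath Q) : x p = wcoef x (qstart p) (qword p).
Proof.
rewrite /wcoef; have -> : (qstart p, qword p) = val p.
  by rewrite /qstart /qword; case: (val p).
by rewrite valK.
Qed.

Lemma wcoef_walk x v s (w : is_walk v s) :
  wcoef x v s = x (@QPath _ _ (v, s) w).
Proof. by rewrite /wcoef insubT. Qed.

Lemma wcoef_nwalk x v s : ~~ is_walk v s -> wcoef x v s = 0.
Proof. by move=> nw; rewrite /wcoef insubN. Qed.

Lemma cpaP x y :
  (forall v s, is_walk v s -> wcoef x v s = wcoef y v s) -> x = y.
Proof. by move=> exy; apply: funext => p; rewrite !wcoef_path exy ?(valP p). Qed.

Lemma wcoef0 v s : wcoef 0 v s = 0.
Proof. by rewrite /wcoef; case: insub. Qed.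

Lemma wcoefD x y v s : wcoef (x + y) v s = wcoef x v s + wcoef y v s.
Proof. by rewrite /wcoef; case: insub => //=; rewrite addr0. Qed.

Lemma wcoefN x v s : wcoef (- x) v s = - wcoef x v s.
Proof. by rewrite /wcoef; case: insub => //=; rewrite oppr0. Qed.

Lemma wcoefB x y v s : wcoef (x - y) v s = wcoef x v s - wcoef y v s.
Proof. by rewrite wcoefD wcoefN. Qed.

Lemma wcoefZ c x v s : wcoef (c *: x) v s = c * wcoef x v s.
Proof. by rewrite /wcoef; case: insub => //=; rewrite mulr0. Qed.

Lemma wcoef_sum I (r : seq I) P (F : I -> A) v s :
  wcoef (\sum_(i <- r | P i) F i) v s = \sum_(i <- r | P i) wcoef (F i) v s.
Proof. by elim/big_rec2: _ => [|i x y _ <-]; rewrite ?wcoef0 ?wcoefD. Qed.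

Lemma wcoef1 v s : wcoef (1 : A) v s = (nilp s)%:R.
Proof.
have [w|nw] := boolP (is_walk v s); first by rewrite (wcoef_walk _ w) -[LHS]/(cpa_one _) /cpa_one /qword; exact: erefl.
by rewrite wcoef_nwalk //; case: s nw.
Qed.

Lemma wcoef_idem i v s : wcoef (idem i : A) v s = ((v == i) && nilp s)%:R.
Proof.
have [w|nw] := boolP (is_walk v s); first by
  rewrite (wcoef_walk _ w) /idem [val _]/= xpair_eqE -(size_eq0 s).
rewrite wcoef_nwalk //; case: s nw => [//|b s] _.
by rewrite andbF.
Qed.

Lemma wcoef_word t v s : wcoef (word t : A) v s = (is_walk v s && (s == t))%:R.
Proof.
have [w|nw] := boolP (is_walk v s); first by rewrite (wcoef_walk _ w) /word /qword; exact: erefl.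
by rewrite wcoef_nwalk.
Qed.

Lemma wcoefM x y v s : wcoef (x * y) v s =
  \sum_(i < (size s).+1)
    wcoef x v (take i s) * wcoef y (walk_end v (take i s)) (drop i s).
Proof.
have [w|nw] := boolP (is_walk v s).
  rewrite (wcoef_walk _ w); apply: eq_bigr => i _.
  by rewrite !wcoef_path.
rewrite wcoef_nwalk // big1 // => i _.
have [w1|nw1] := boolP (is_walk v (take i s)); last by rewrite wcoef_nwalk ?mul0r.
rewrite [X in _ * X]wcoef_nwalk ?mulr0 //.
by move: nw; rewrite -{1}(cat_take_drop i s) is_walk_cat w1.
Qed.

Lemma word_cat s t : word s * word t = word (s ++ t) :> A.
Proof.
apply: cpaP => v r w; rewrite wcoefM wcoef_word w andTb.
have [er|ne] := eqVneq r (s ++ t).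
  rewrite er is_walk_cat in w; have /andP[w1 w2] := w.
  have lt_s : (size s < (size r).+1)%N by rewrite er ltnS size_cat leq_addr.
  rewrite (bigD1 (Ordinal lt_s)) // big1 => [|i ne_i].
    rewrite /= addr0 er take_size_cat // drop_size_cat // !wcoef_word w1 w2.
    by rewrite !eqxx -natrM.
  rewrite wcoef_word; case: eqP => [e|_]; last by rewrite andbF mul0r.
  have := congr1 size e; rewrite size_takel => [ei|]; last by rewrite -ltnS.
  by case/eqP: ne_i; apply: val_inj.
rewrite big1 // => i _; rewrite !wcoef_word.
case: eqP => [e1|_]; last by rewrite andbF mul0r.
case: eqP => [e2|_]; last by rewrite andbF mulr0.
by case/eqP: ne; rewrite -e1 -e2 cat_take_drop.
Qed.

Lemma wcoef_idemM i x v s : wcoef (idem i * x) v s = if v == i then wcoef x v s else 0.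
Proof.
rewrite wcoefM big_ord_recl big1 => [|j _].
  rewrite /= take0 drop0 wcoef_idem andbT addr0.
  by case: eqP => _; rewrite ?mul1r ?mul0r.
rewrite wcoef_idem /nilp size_takel; first by rewrite /= andbF mul0r.
exact: ltn_ord.
Qed.

Lemma wcoef_Midem x i v s :
  wcoef (x * idem i) v s = if walk_end v s == i then wcoef x v s else 0.
Proof.
rewrite wcoefM big_ord_recr big1 => [|j _].
  rewrite /= take_size drop_size wcoef_idem andbT add0r.
  by case: eqP => _; rewrite ?mulr1 ?mulr0.
by rewrite wcoef_idem /nilp size_drop subn_eq0 leqNgt (ltn_ord j) andbF mulr0.
Qed.

Lemma wcoef_arrowM_nil a x v : wcoef (word [:: a] * x) v [::] = 0.
Proof. by rewrite wcoefM big_ord1 /= wcoef_word mul0r. Qed.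

Lemma wcoef_arrowM_cons a x v b s : wcoef (word [:: a] * x) v (b :: s) =
  if (b == a) && (v == src a) then wcoef x (tgt a) s else 0.
Proof.
rewrite wcoefM !big_ord_recl big1 => [|j _].
  rewrite /= take0 drop0 !wcoef_word /= mul0r add0r addr0.
  rewrite eqseq_cons eqxx !andbT /walk_end /=.
  have [->|_] := eqVneq b a; last by rewrite andbF mul0r.
  by rewrite eq_sym; case: eqP => _; rewrite ?mul1r ?mul0r.
rewrite wcoef_word; case: eqP => [e|_]; last by rewrite andbF mul0r.
have := congr1 size e; rewrite size_takel //.
by have := ltn_ord j; rewrite ltnS.
Qed.

Lemma wcoef_Marrow_nil x a v : wcoef (x * word [:: a]) v [::] = 0.
Proof. by rewrite wcoefM big_ord1 /= wcoef_word mulr0. Qed.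

Lemma wcoef_Marrow_rcons x a v s b : wcoef (x * word [:: a]) v (rcons s b) =
  if (b == a) && (walk_end v s == src a) then wcoef x v s else 0.
Proof.
rewrite wcoefM size_rcons !big_ord_recr big1 => [|j _].
  rewrite -!cats1 /= take_size_cat // drop_size_cat //.
  rewrite [drop _.+1 _]drop_oversize ?size_cat ?addn1 // !wcoef_word /=.
  rewrite mulr0 add0r addr0 eqseq_cons eqxx !andbT.
  have [->|_] := eqVneq b a; last by rewrite andbF mulr0.
  by rewrite eq_sym; case: eqP => _; rewrite ?mulr1 ?mulr0.
rewrite [X in _ * X]wcoef_word; case: eqP => [e|_]; last by rewrite andbF mulr0.
have := congr1 size e; rewrite size_drop size_rcons /= => e1.
by have := ltn_ord j; lia.
Qed.

(** The element [y] in the part [a y] of [x], the paths that begin with [a]. *)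
Definition lquot a x : A := fun p =>
  if qstart p == tgt a then wcoef x (src a) (a :: qword p) else 0.

(** The element [y] in the part [y a] of [x], the paths that end with [a]. *)
Definition rquot a x : A := fun p => wcoef x (qstart p) (rcons (qword p) a).

Lemma wcoef_lquot a x v s :
  wcoef (lquot a x) v s = if v == tgt a then wcoef x (src a) (a :: s) else 0.
Proof.
have [w|nw] := boolP (is_walk v s); first by rewrite (wcoef_walk _ w).
rewrite wcoef_nwalk //; case: eqP => // e.
by rewrite wcoef_nwalk //= eqxx -e.
Qed.

Lemma wcoef_rquot a x v s : wcoef (rquot a x) v s = wcoef x v (rcons s a).
Proof.
have [w|nw] := boolP (is_walk v s); first by rewrite (wcoef_walk _ w).
by rewrite !wcoef_nwalk // -cats1 is_walk_cat (negPf nw).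
Qed.

Lemma lquotD a x y : lquot a (x + y) = lquot a x + lquot a y.
Proof.
apply: cpaP => v s _; rewrite !(wcoefD, wcoef_lquot).
by case: ifP => _; rewrite ?addr0.
Qed.

Lemma lquotZ a c x : lquot a (c *: x) = c *: lquot a x.
Proof.
apply: cpaP => v s _; rewrite !(wcoefZ, wcoef_lquot).
by case: ifP => _; rewrite ?mulr0.
Qed.

Lemma lquot_idem a i : lquot a (idem i) = 0.
Proof.
by apply: cpaP => v s _; rewrite wcoef0 wcoef_lquot wcoef_idem andbF if_same.
Qed.

Lemma lquot_arrow a b :
  lquot a (word [:: b]) = if a == b then idem (tgt a) else 0.
Proof.
apply: cpaP => v s w; rewrite wcoef_lquot wcoef_word /= eqxx /= eqseq_cons.
have [->|ne] := eqVneq a b; last by rewrite andbF if_same wcoef0.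
rewrite wcoef_idem; case: eqP w => [->|] //= -> /=.
by rewrite -size_eq0.
Qed.

(** The twisted Leibniz rule of [lquot]: the paths of [x * y] that begin with
    [a] have this [a] either in their part from [y], when the part from [x] is
    trivial, or in their part from [x]. *)
Lemma lquotM a x y :
  lquot a (x * y) = wcoef x (src a) [::] *: lquot a y + lquot a x * y.
Proof.
apply: cpaP => v s w; rewrite wcoefD wcoefZ !wcoef_lquot.
rewrite [X in _ = _ + X]wcoefM.
have [->|ne] := eqVneq v (tgt a).
  rewrite wcoefM big_ord_recl /=; congr (_ + _).
  by apply: eq_bigr => i _; rewrite /= wcoef_lquot eqxx.
rewrite mulr0 add0r big1 // => i _.
by rewrite wcoef_lquot (negPf ne) mul0r.
Qed.

(** Membership in the [n]-th power of the arrow ideal, tested on coefficients: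
    this is the neighbourhood basis of the topology. *)
Definition mpow n x := forall v s, (size s < n)%N -> wcoef x v s = 0.

Lemma mpow0 n : mpow n 0.
Proof. by move=> v s _; rewrite wcoef0. Qed.

Lemma mpowD n x y : mpow n x -> mpow n y -> mpow n (x + y).
Proof. by move=> hx hy v s h; rewrite wcoefD hx // hy // addr0. Qed.

Lemma mpowN n x : mpow n x -> mpow n (- x).
Proof. by move=> hx v s h; rewrite wcoefN hx // oppr0. Qed.

Lemma mpowB n x y : mpow n x -> mpow n y -> mpow n (x - y).
Proof. by move=> hx hy; apply: mpowD => //; apply: mpowN. Qed.

Lemma mpowZ n c x : mpow n x -> mpow n (c *: x).
Proof. by move=> hx v s h; rewrite wcoefZ hx // mulr0. Qed.

Lemma mpow_sum n I (r : seq I) (P : pred I) (F : I -> A) :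
  (forall i, P i -> mpow n (F i)) -> mpow n (\sum_(i <- r | P i) F i).
Proof.
by move=> hF; apply: big_ind => //; [apply: mpow0 | apply: mpowD].
Qed.

Lemma mpowM m n x y : mpow m x -> mpow n y -> mpow (m + n) (x * y).
Proof.
move=> hx hy v s lt_s; rewrite wcoefM big1 // => i _.
have [lt_i|le_i] := ltnP i m.
  by rewrite hx ?mul0r // size_takel // -ltnS.
rewrite hy ?mulr0 // size_drop ltn_subLR; last by rewrite -ltnS.
by apply: leq_trans lt_s _; rewrite leq_add2r.
Qed.

Lemma mpow_le m n x : (m <= n)%N -> mpow n x -> mpow m x.
Proof. by move=> le_mn hx v s h; apply: hx; apply: leq_trans h le_mn. Qed.

Lemma mpowMl m n x y : (m <= n)%N -> mpow n y -> mpow m (x * y).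
Proof. by move=> le h; apply: mpow_le le (mpowM (m := 0) _ h). Qed.

Lemma mpowMr m n x y : (m <= n)%N -> mpow n x -> mpow m (x * y).
Proof.
by move=> le h; apply: mpow_le (mpowM (n := 0) h _) => //; rewrite addn0.
Qed.

Lemma mpow_all x y : (forall n, mpow n (x - y)) -> x = y.
Proof.
move=> h; apply/eqP; rewrite -subr_eq0; apply/eqP; apply: cpaP => v s _.
by rewrite (h (size s).+1) ?wcoef0.
Qed.

Lemma mpow_word s n : (n <= size s)%N -> mpow n (word s).
Proof.
move=> le_n v t /leq_trans/(_ le_n) h; rewrite wcoef_word.
by case: eqP h => [->|]; rewrite ?ltnn ?andbF.
Qed.

Lemma mpow_arrow a : mpow 1 (word [:: a]).
Proof. by move=> v s h; rewrite (mpow_word (n := 1)). Qed.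

Lemma mpow1P x : (forall v, wcoef x v [::] = 0) -> mpow 1 x.
Proof. by move=> h v [|//] _; apply: h. Qed.

Lemma mpow_lquot n a x : mpow n.+1 x -> mpow n (lquot a x).
Proof. by move=> h v s hs; rewrite wcoef_lquot; case: ifP => // _; apply: h. Qed.

End Coefficients.

Section Constants.
Context {V : finType} {K : fieldType}.
Implicit Types Q : quiver V.

(** The target quiver is arbitrary on the same vertices, since the constant parts
    of all the path algebras are identified. *)
Definition cst Q Q' (x : cpa K Q) : cpa K Q' :=
  \sum_v wcoef x v [::] *: idem v.
Arguments cst {Q} Q' x.

Lemma wcoef_cst Q Q' (x : cpa K Q) v s :
  wcoef (cst Q' x) v s = if nilp s then wcoef x v [::] else 0.
Proof.
rewrite wcoef_sum (bigD1 v) // big1 => [|i ne].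
  by rewrite wcoefZ wcoef_idem eqxx /= addr0; case: nilp; rewrite ?mulr1 ?mulr0.
by rewrite wcoefZ wcoef_idem eq_sym (negPf ne) mulr0.
Qed.

Lemma lquot_expansion Q (x : cpa K Q) :
  x = cst Q x + \sum_a word [:: a] * lquot a x.
Proof.
apply: cpaP => v [|b s] w; rewrite wcoefD wcoef_cst wcoef_sum /=.
  by rewrite big1 ?addr0 // => a _; rewrite wcoef_arrowM_nil.
rewrite add0r (bigD1 b) // big1 => [|a ne].
  move: w => /= /andP[/eqP e _].
  by rewrite wcoef_arrowM_cons -e !eqxx wcoef_lquot eqxx /= addr0.
by rewrite wcoef_arrowM_cons eq_sym (negPf ne).
Qed.

Lemma rquot_expansion Q (x : cpa K Q) :
  mpow 1 x -> x = \sum_a rquot a x * word [:: a].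
Proof.
move=> h; apply: cpaP => v s; rewrite wcoef_sum.
case/lastP: s => [|s b] w.
  by rewrite h // big1 // => a _; rewrite wcoef_Marrow_nil.
rewrite (bigD1 b) // big1 => [|a ne].
  move: w; rewrite -cats1 is_walk_cat /= andbT cats1 => /andP[_ /eqP e].
  by rewrite wcoef_Marrow_rcons e !eqxx wcoef_rquot /= addr0.
by rewrite wcoef_Marrow_rcons eq_sym (negPf ne).
Qed.

Lemma cstD Q Q' (x y : cpa K Q) : cst Q' (x + y) = cst Q' x + cst Q' y.
Proof.
by apply: cpaP => v s _; rewrite wcoefD !wcoef_cst wcoefD; case: ifP; rewrite ?addr0.
Qed.

Lemma cstZ Q Q' c (x : cpa K Q) : cst Q' (c *: x) = c *: cst Q' x.
Proof.
by apply: cpaP => v s _; rewrite wcoefZ !wcoef_cst wcoefZ; case: ifP; rewrite ?mulr0.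
Qed.

Lemma cst_mpow1 Q Q' (x : cpa K Q) : mpow 1 x -> cst Q' x = 0.
Proof.
by move=> h; apply: cpaP => v s _; rewrite wcoef_cst wcoef0 h // if_same.
Qed.

Lemma cst_idem Q Q' i : cst Q' (idem i : cpa K Q) = idem i.
Proof.
by apply: cpaP => v s _; rewrite wcoef_cst !wcoef_idem andbT; case: nilp; rewrite ?andbT ?andbF.
Qed.

End Constants.
Arguments cst {V K Q} Q' x.

(** * Algebra homomorphisms are substitutions *)

Section Neumann.
Context {V : finType} {K : fieldType} {Q : quiver V}.
Local Notation A := (cpa K Q).
Variable N : A -> A.
Hypothesis N_sub : {morph N : x y / x - y}.
Hypothesis N_mpow : forall n x, mpow n x -> mpow n.+1 (N x).

Lemma iter_mpow n x : mpow n (iter n N x).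
Proof. by elim: n => [//|n IH]; apply: N_mpow. Qed.

(** The Neumann series: the sum of the iterates of [N] converges because [N]
    raises the order. *)
Lemma one_sub_surj x : exists y, y - N y = x.
Proof.
pose y : A := fun p => \sum_(i < (size (qword p)).+1) iter i N x p.
have y_approx n : mpow n (y - \sum_(i < n) iter i N x).
  move=> v s lt_s; rewrite wcoefB wcoef_sum.
  have [w|nw] := boolP (is_walk v s); last first.
    by rewrite wcoef_nwalk // big1 ?subr0 // => i _; rewrite wcoef_nwalk.
  rewrite (wcoef_walk _ w) /y -(big_mkord xpredT (fun i => iter i N x _)).
  rewrite -(big_mkord xpredT (fun i => wcoef (iter i N x) v s)).
  rewrite [X in _ - X](big_cat_nat (n := (size s).+1)) //= opprD addrA.
  rewrite [X in _ - X]big_nat_cond [X in _ - X]big1 ?subr0 => [|i].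
    apply/eqP; rewrite subr_eq0; apply/eqP; apply: eq_bigr => i _.
    by rewrite (wcoef_walk _ w).
  by rewrite andbT => /andP[lt_si _]; apply: iter_mpow.
exists y; apply: mpow_all => n.
pose S := \sum_(i < n) iter i N x; set z := y - S.
have -> : y - N y - x = z - N z - iter n N x.
  suff ES : S - N S = x - iter n N x.
    by rewrite /z N_sub opprD addrACA -opprD ES opprD opprK addrA addrK.
  have N0 : N 0 = 0 by have := N_sub 0 0; rewrite !subrr.
  have NN u : N (- u) = - N u by rewrite -sub0r N_sub N0 sub0r.
  have ND u v : N (u + v) = N u + N v by rewrite -{1}[v]opprK N_sub NN opprK.
  rewrite /S; elim: (n) => [|m IH]; first by rewrite !big_ord0 N0 !subrr.
  by rewrite big_ord_recr /= ND opprD addrACA IH addrA subrK.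
apply: mpowB; last exact: iter_mpow.
apply: mpowB; first exact: y_approx.
exact: (mpow_le (leqnSn n)) (N_mpow (y_approx n)).
Qed.

Lemma one_sub_inj x : x - N x = 0 -> x = 0.
Proof.
move=> /eqP; rewrite subr_eq0 => /eqP xE; apply: mpow_all => n; rewrite subr0.
by elim: n => [//|n IH]; rewrite xE; apply: N_mpow.
Qed.

End Neumann.

Section Homs.
Context {V : finType} {K : fieldType}.
Implicit Types Q : quiver V.

(** Homomorphisms over the constants; they are continuous by [hom_mpow]. *)
Record alg_hom Q Q' (phi : cpa K Q -> cpa K Q') : Prop := AlgHom {
  homD : {morph phi : x y / x + y};
  homM : {morph phi : x y / x * y};
  homZ : forall c, {morph phi : x / c *: x};
  hom_idem : forall v, phi (idem v) = idem v }.

Lemma cst_sum_idem Q : \sum_v idem v = 1 :> cpa K Q.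
Proof.
apply: cpaP => v s _; rewrite wcoef_sum wcoef1 (bigD1 v) // big1 => [|i ne].
  by rewrite wcoef_idem eqxx /= addr0.
by rewrite wcoef_idem eq_sym (negPf ne).
Qed.

Section HomTheory.
Variables (Q Q' : quiver V) (phi : cpa K Q -> cpa K Q').
Hypothesis hphi : alg_hom phi.

Lemma hom0 : phi 0 = 0.
Proof. by rewrite -(scale0r 0) (homZ hphi) scale0r. Qed.

Lemma homN : {morph phi : x / - x}.
Proof. by move=> x; rewrite -scaleN1r (homZ hphi) scaleN1r. Qed.

Lemma homB : {morph phi : x y / x - y}.
Proof. by move=> x y; rewrite (homD hphi) homN. Qed.

Lemma hom_sum I (r : seq I) P (F : I -> cpa K Q) :
  phi (\sum_(i <- r | P i) F i) = \sum_(i <- r | P i) phi (F i).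
Proof. exact: (big_morph phi (homD hphi) hom0). Qed.

Lemma hom1 : phi 1 = 1.
Proof.
by rewrite -!cst_sum_idem hom_sum; apply: eq_bigr => v _; apply: (hom_idem hphi).
Qed.

Lemma hom_cst (x : cpa K Q) : phi (cst Q x) = cst Q' x.
Proof.
by rewrite hom_sum; apply: eq_bigr => v _; rewrite (homZ hphi) (hom_idem hphi).
Qed.

Lemma hom_expansion x :
  phi x = cst Q' x + \sum_a phi (word [:: a]) * phi (lquot a x).
Proof.
rewrite {1}[x]lquot_expansion (homD hphi) hom_cst hom_sum; congr (_ + _).
by apply: eq_bigr => a _; apply: (homM hphi).
Qed.

Lemma idem_arrow a : idem (src a) * word [:: a] = word [:: a] :> cpa K Q.
Proof.
apply: cpaP => v [|b s] w; rewrite wcoef_idemM wcoef_word ?if_same //.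
have [e|ne] := eqVneq b a; last by rewrite eqseq_cons (negPf ne) andbF if_same.
by move: w => /= /andP[/eqP <- _]; rewrite e eqxx.
Qed.

Lemma arrow_idem a : word [:: a] * idem (tgt a) = word [:: a] :> cpa K Q.
Proof.
apply: cpaP => v s _; rewrite wcoef_Midem wcoef_word.
case: eqP => // ne; case: eqP ne => [->|]; last by rewrite andbF.
by rewrite /walk_end.
Qed.

Lemma wcoef_hom_arrow_corner a v s : is_walk v s -> 
  wcoef (phi (word [:: a])) v s != 0 -> v = src a /\ walk_end v s = tgt a.
Proof.
move=> w; rewrite -idem_arrow -arrow_idem mulrA !(homM hphi) !(hom_idem hphi).
rewrite wcoef_Midem wcoef_idemM; case: (_ =P tgt a) => [->|_]; last by rewrite eqxx.
by case: (_ =P src a) => [->|_]; last by rewrite eqxx.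
Qed.

(** Continuity is automatic.  If the image of an arrow [a] had a nonzero
    constant coefficient [l], then [1 - l^-1 a] would be invertible, while its
    image has constant coefficient 0 at that vertex. *)
Lemma hom_arrow_mpow a : mpow 1 (phi (word [:: a])).
Proof.
apply: mpow1P => v; set l := wcoef _ _ _; have [//|nz] := eqVneq l 0.
have [ev _] := wcoef_hom_arrow_corner (isT : is_walk v [::]) nz.
pose N (y : cpa K Q) := l^-1 *: (word [:: a] * y).
(* [u] is inverse to [1 - l^-1 a]. *)
have [||u eu] := @one_sub_surj _ _ _ N _ _ 1.
- by move=> x y; rewrite /N mulrBr scalerBr.
- by move=> n x h; apply: mpowZ; apply: (mpowM (m := 1) _ h); apply: mpow_arrow.
have := congr1 (fun z => wcoef (phi z) v [::]) eu.
rewrite /N homB (homZ hphi) (homM hphi) hom1 wcoefB wcoefZ wcoefM big_ord1 /= wcoef1.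
rewrite -/l mulrA mulVf // mul1r subrr => /esym/eqP.
by rewrite oner_eq0.
Qed.

Lemma hom_mpow n x : mpow n x -> mpow n (phi x).
Proof.
elim: n x => [//|n IH] x h; rewrite hom_expansion cst_mpow1 ?add0r; last first.
  exact: mpow_le h.
apply: mpow_sum => a _; apply: (mpowM (m := 1)); first exact: hom_arrow_mpow.
by apply: IH; apply: mpow_lquot.
Qed.

End HomTheory.

Section Substitution.
Variables (Q Q' : quiver V).

(** The recursion that determines a homomorphism from its values [x] on arrows:
    split a path at its first arrow. *)
Definition solves (x : arrow Q -> cpa K Q') (phi : cpa K Q -> cpa K Q') :=
  forall y, phi y = cst Q' y + \sum_a x a * phi (lquot a y).

Lemma solves_unique x phi psi : (forall a, mpow 1 (x a)) ->
  solves x phi -> solves x psi -> phi =1 psi.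
Proof.
move=> hx h1 h2 y; apply: mpow_all => n; elim: n y => [//|n IH] y.
rewrite h1 h2 opprD addrACA subrr add0r -sumrB; apply: mpow_sum => a _.
by rewrite -mulrBr; apply: (mpowM (m := 1)).
Qed.

Variable x : arrow Q -> cpa K Q'.
Hypothesis x_mpow : forall a, mpow 1 (x a).

(** The recursion of [solves] stopped after [n] steps, exact up to order [n]. *)
Fixpoint subst_n n (y : cpa K Q) : cpa K Q' :=
  if n is n'.+1 then cst Q' y + \sum_a x a * subst_n n' (lquot a y) else 0.

Definition subst (y : cpa K Q) : cpa K Q' :=
  fun p => subst_n (size (qword p)).+1 y p.

Lemma subst_nD n y z : subst_n n (y + z) = subst_n n y + subst_n n z.
Proof.
elim: n y z => [|n IH] y z /=; first by rewrite addr0.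
rewrite cstD [RHS]addrACA; congr (_ + _); rewrite -big_split; apply: eq_bigr => a _.
by rewrite lquotD IH mulrDr.
Qed.

Lemma subst_nZ n c y : subst_n n (c *: y) = c *: subst_n n y.
Proof.
elim: n y => [|n IH] y /=; first by rewrite scaler0.
rewrite cstZ scalerDr; congr (_ + _); rewrite scaler_sumr; apply: eq_bigr => a _.
by rewrite lquotZ IH -cpa_scaleAr.
Qed.

Lemma subst_n_stable n k y : mpow n (subst_n (n + k) y - subst_n n y).
Proof.
elim: n y => [//|n IH] y /=.
rewrite opprD addrACA subrr add0r -sumrB; apply: mpow_sum => a _.
by rewrite -mulrBr; apply: (mpowM (m := 1)).
Qed.

Lemma subst_approx n y : mpow n (subst y - subst_n n y).
Proof.
move=> v s lt_s; have [w|nw] := boolP (is_walk v s); last by rewrite wcoef_nwalk.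
have E : wcoef (subst y) v s = wcoef (subst_n (size s).+1 y) v s.
  by rewrite !(wcoef_walk _ w).
have := subst_n_stable (n - (size s).+1) y v (ltnSn (size s)).
by rewrite subnKC // !wcoefB E => /(congr1 -%R); rewrite opprB oppr0.
Qed.

Lemma substD y z : subst (y + z) = subst y + subst z.
Proof.
apply: funext => p; rewrite /subst subst_nD; exact: erefl.
Qed.

Lemma substZ c y : subst (c *: y) = c *: subst y.
Proof.
by apply: funext => p; rewrite /subst subst_nZ; exact: erefl.
Qed.

Lemma subst_solves : solves x subst.
Proof.
move=> y; apply: mpow_all => n.
rewrite -[subst y](subrK (subst_n n.+1 y)) -addrA; apply: mpowD.
  exact (mpow_le (leqnSn n) (@subst_approx n.+1 y)).
rewrite /= opprD addrACA subrr add0r -sumrB; apply: mpow_sum => a _.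
rewrite -mulrBr; apply: (mpowMl _ (leqnn n)); rewrite -opprB.
exact (mpowN (@subst_approx n _)).
Qed.

Hypothesis x_src : forall a, idem (src a) * x a = x a.
Hypothesis x_tgt : forall a, x a * idem (tgt a) = x a.

Lemma subst0 : subst 0 = 0.
Proof. by rewrite -(scale0r 0) substZ scale0r. Qed.

Lemma subst_idem i : subst (idem i) = idem i.
Proof.
rewrite subst_solves cst_idem big1 ?addr0 // => a _.
by rewrite lquot_idem subst0 mulr0.
Qed.

Lemma subst_arrow a : subst (word [:: a]) = x a.
Proof.
rewrite subst_solves cst_mpow1 ?add0r; last exact: mpow_arrow.
rewrite (bigD1 a) // big1 => [|b ne].
  by rewrite lquot_arrow eqxx subst_idem x_tgt /= addr0.
by rewrite lquot_arrow (negPf ne) subst0 mulr0.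
Qed.

Lemma cst_idemM (y : cpa K Q) i (w : cpa K Q') :
  idem i * w = w -> cst Q' y * w = wcoef y i [::] *: w.
Proof.
move=> <-; rewrite mulrA; have -> : cst Q' y * idem i = wcoef y i [::] *: idem i.
  apply: cpaP => v s _; rewrite wcoef_Midem wcoefZ wcoef_cst wcoef_idem.
  case: s => [|b s]; rewrite /walk_end /= ?andbF ?andbT ?mulr0 ?if_same //.
  by case: eqP => [->|]; rewrite ?mulr1 ?mulr0.
by rewrite -cpa_scaleAl.
Qed.

Lemma cstM (y z : cpa K Q) : cst Q' (y * z) = cst Q' y * cst Q' z.
Proof.
rewrite [in RHS]/cst mulr_sumr; apply: eq_bigr => v _.
rewrite -cpa_scaleAr; have -> : cst Q' y * idem v = wcoef y v [::] *: idem v.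
  apply: cst_idemM; apply: cpaP => u s _; rewrite wcoef_idemM wcoef_idem.
  by case: eqP.
by rewrite wcoefM big_ord1 /= scalerA mulrC.
Qed.

(** Multiplicativity holds to all orders by induction: the defect on [y * z] is a
    combination of defects on quotients, multiplied by elements of the arrow
    ideal. *)
Lemma subst_alg_hom : alg_hom subst.
Proof.
split=> [|y z||]; [exact: substD | | exact: substZ | exact: subst_idem].
have L (c s1 s2 s3 : cpa K Q') : c + s1 - (c + s2 + s3) = s1 - s2 - s3.
  by rewrite -[c + s2 + s3]addrA opprD addrACA subrr add0r opprD addrA.
apply: mpow_all => n; elim: n y z => [//|n IH] y z.
have -> : subst (y * z) - subst y * subst z =
    \sum_a x a * (subst (lquot a y * z) - subst (lquot a y) * subst z).
  rewrite subst_solves (subst_solves y) mulrDl [X in cst Q' y * X]subst_solves.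
  rewrite mulrDr cstM L mulr_suml mulr_sumr -!sumrB; apply: eq_bigr => a _.
  rewrite lquotM substD substZ mulrDr -cpa_scaleAr [cst Q' y * _]mulrA.
  rewrite (cst_idemM _ (x_src a)) -cpa_scaleAl.
  by rewrite [X in X - _ - _]addrC addrK mulrBr mulrA.
apply: mpow_sum => a _; exact: (mpowM (m := 1)).
Qed.

End Substitution.

Lemma alg_hom_ext Q Q' (phi psi : cpa K Q -> cpa K Q') :
  alg_hom phi -> alg_hom psi ->
  (forall a, phi (word [:: a]) = psi (word [:: a])) -> phi =1 psi.
Proof.
move=> h1 h2 e; apply: (@solves_unique Q Q' (fun a => phi (word [:: a]))).
- by move=> a; apply: hom_arrow_mpow.
- by move=> y; apply: hom_expansion.
by move=> y; rewrite hom_expansion //; congr (_ + _); apply: eq_bigr => a _; rewrite e.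
Qed.

Lemma alg_hom_comp Q1 Q2 Q3 (phi : cpa K Q1 -> cpa K Q2)
  (psi : cpa K Q2 -> cpa K Q3) : alg_hom phi -> alg_hom psi -> alg_hom (psi \o phi).
Proof.
move=> h1 h2; split=> [x y|x y|c x|v] /=.
- by rewrite (homD h1) (homD h2).
- by rewrite (homM h1) (homM h2).
- by rewrite (homZ h1) (homZ h2).
by rewrite (hom_idem h1) (hom_idem h2).
Qed.

Lemma alg_hom_inv Q1 Q2 (phi : cpa K Q1 -> cpa K Q2) psi :
  alg_hom phi -> cancel phi psi -> cancel psi phi -> alg_hom psi.
Proof.
move=> h K1 K2; split=> [x y|x y|c x|v]; apply: (can_inj K1); rewrite ?K2.
- by rewrite (homD h) !K2.
- by rewrite (homM h) !K2.
- by rewrite (homZ h) K2.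
by rewrite (hom_idem h).
Qed.

Definition alg_iso Q Q' (phi : cpa K Q -> cpa K Q') psi :=
  [/\ alg_hom phi, alg_hom psi, cancel phi psi & cancel psi phi].

(** An endomorphism that fixes the arrows to first order differs from the identity
    by a map that raises orders, so the Neumann series inverts it. *)
Lemma unipotent_hom_iso Q (th : cpa K Q -> cpa K Q) : alg_hom th ->
  (forall a, mpow 2 (th (word [:: a]) - word [:: a])) -> exists psi, alg_iso th psi.
Proof.
move=> h ha; pose N y := y - th y.
have N_sub : {morph N : x y / x - y}.
  by move=> x y; rewrite /N homB // opprD addrACA -opprD.
have N_mpow n y : mpow n y -> mpow n.+1 (N y).
  move=> hy; rewrite -[N y]opprK; apply: mpowN; rewrite opprB.
  elim: n y hy => [|n IH] y hy.
    apply: mpow1P => v; rewrite wcoefB (hom_expansion h) wcoefD wcoef_cst /=.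
    rewrite wcoef_sum big1 ?addr0 ?subrr // => a _.
    by rewrite (mpowMr _ (leqnn 1)) //; apply: hom_arrow_mpow.
  rewrite (hom_expansion h) [X in _ - X]lquot_expansion opprD addrACA subrr add0r.
  rewrite -sumrB; apply: mpow_sum => a _.
  have -> : th (word [:: a]) * th (lquot a y) - word [:: a] * lquot a y =
    (th (word [:: a]) - word [:: a]) * th (lquot a y) +
    word [:: a] * (th (lquot a y) - lquot a y).
    by rewrite mulrBl mulrBr addrA subrK.
  have hl : mpow n (lquot a y) by apply: mpow_lquot.
   apply: mpowD.
    by apply: (mpowM (m := 2)) => //; apply: (hom_mpow h).
  by apply: (mpowM (m := 1)); [apply: mpow_arrow | apply: IH].
have thE y : th y = y - N y by rewrite /N subKr.
have surj x : exists y, th y = x.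
  by have [y <-] := one_sub_surj N_sub N_mpow x; exists y; rewrite thE.
have [psi psiK] := choice surj.
have inj : injective th.
  move=> x y e; apply/eqP; rewrite -subr_eq0; apply/eqP.
  by apply: (one_sub_inj N_mpow); rewrite -thE (homB h) e subrr.
have K1 : cancel th psi by move=> y; apply: inj; rewrite psiK.
by exists psi; split=> //; apply: alg_hom_inv h _ _.
Qed.

(** A formal inverse function theorem: a homomorphism is invertible as soon as it
    is invertible to first order. *)
Lemma inverse_function Q Q' (phi : cpa K Q -> cpa K Q') (psi : cpa K Q' -> cpa K Q) :
  alg_hom phi -> alg_hom psi ->
  (forall a, mpow 2 (psi (phi (word [:: a])) - word [:: a])) ->
  (forall b, mpow 2 (phi (psi (word [:: b])) - word [:: b])) ->
  exists psi', alg_iso phi psi'.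
Proof.
move=> h1 h2 e1 e2.
have [al [_ hal _ alK]] := unipotent_hom_iso (alg_hom_comp h2 h1) e2.
have [be [_ _ beK _]] := unipotent_hom_iso (alg_hom_comp h1 h2) e1.
exists (psi \o al); split=> //; first exact: alg_hom_comp.
by move=> x; apply: (can_inj beK); exact: (congr1 psi (alK (phi x))).
Qed.

End Homs.

(** * Potentials as classes of elements of the path algebra *)

Section Rotations.
Context {T : eqType}.
Implicit Types c d : seq T.

Lemma rotations_uniq c : uniq (rotations c).
Proof. exact: undup_uniq. Qed.

Lemma mem_rot_rotations k c : c != [::] -> rot k c \in rotations c.
Proof.
move=> c0; have sc : (0 < size c)%N by rewrite lt0n size_eq0.
rewrite mem_undup; have [lt_k|le_k] := ltnP k (size c).
  by apply: map_f; rewrite mem_iota.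
by rewrite rot_oversize // -{1}[c]rot0; apply: map_f; rewrite mem_iota.
Qed.

Lemma rotationsP c d : d \in rotations c -> exists2 k, (k < size c)%N & d = rot k c.
Proof. by rewrite mem_undup => /mapP[k]; rewrite mem_iota => /= lt_k ->; exists k. Qed.

Lemma rotations_size c d : d \in rotations c -> size d = size c.
Proof. by case/rotationsP=> k _ ->; rewrite size_rot. Qed.

Lemma rotations_sym c d : d \in rotations c -> c \in rotations d.
Proof.
case/rotationsP=> k lt_k ->; rewrite -{1}(rotK k c) /rotr; apply: mem_rot_rotations.
by rewrite -size_eq0 size_rot; case: size lt_k.
Qed.

Lemma rotations_trans c d e :
  d \in rotations c -> e \in rotations d -> e \in rotations c.
Proof.
by case/rotationsP=> k lt_k ->; apply: rotations_rot; apply: ltnW.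
Qed.

Lemma perm_rot_rotations k c : perm_eq (map (rot k) (rotations c)) (rotations c).
Proof.
apply: uniq_perm; rewrite ?rotations_uniq //.
  by rewrite map_inj_uniq ?rotations_uniq //; exact (@rot_inj k T).
have nz d : d \in rotations c -> d != [::].
  by move=> h; rewrite -size_eq0 (rotations_size h); case/rotationsP: h => i; case: size.
move=> d; apply/mapP/idP => [[e he ->]|hd].
  by apply: (rotations_trans he); apply: mem_rot_rotations; apply: nz.
exists (rotr k d); last by rewrite rotrK.
by apply: (rotations_trans hd); apply: mem_rot_rotations; apply: nz.
Qed.

End Rotations.

Arguments cyc : simpl never.
Arguments pcoef : simpl never.

Section Cyclic.
Context {V : finType} {K : fieldType}.
Implicit Types Q : quiver V.

Lemma potentialP Q (W W' : potential K Q) : (forall c, W c = W' c) -> W = W'.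
Proof.
case: W W' => [F h1 h2] [F' h1' h2'] e; have {}e : F = F' by apply: funext.
case: F' / e h1' h2' => h1' h2'.
by congr Potential; apply: Prop_irrelevance.
Qed.

Lemma is_cycle_walk Q (a : arrow Q) c : is_cycle (a :: c) =
  is_walk (src a) (a :: c) && (walk_end (src a) (a :: c) == src a).
Proof.
have pathE b s : path (fun a b : arrow Q => tgt a == src b) b s = is_walk (tgt b) s.
  by elim: s b => [//|d s IH] b /=; rewrite IH eq_sym.
rewrite /is_cycle /= eqxx pathE -cats1 is_walk_cat /= andbT.
by rewrite [walk_end (src a) _]/walk_end /= eq_sym.
Qed.

Lemma word_coefE Q (x : cpa K Q) a c : word_coef x (a :: c) = wcoef x (src a) (a :: c).
Proof. by []. Qed.

Lemma word_coefD Q (x y : cpa K Q) c : word_coef (x + y) c = word_coef x c + word_coef y c.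
Proof. by case: c => [|a c]; rewrite ?word_coefE ?wcoefD //= addr0. Qed.

Lemma word_coefZ Q k (x : cpa K Q) c : word_coef (k *: x) c = k * word_coef x c.
Proof. by case: c => [|a c]; rewrite ?word_coefE ?wcoefZ //= mulr0. Qed.

Lemma cycE Q (x : cpa K Q) c :
  cyc x c = if is_cycle c then \sum_(d <- rotations c) word_coef x d else 0.
Proof. by []. Qed.

Lemma cycD Q (x y : cpa K Q) c : cyc (x + y) c = cyc x c + cyc y c.
Proof.
rewrite !cycE; case: ifP; rewrite ?addr0 // => _.
by rewrite -big_split; apply: eq_bigr => d _; apply: word_coefD.
Qed.

Lemma cycZ Q k (x : cpa K Q) c : cyc (k *: x) c = k * cyc x c.
Proof.
rewrite !cycE; case: ifP; rewrite ?mulr0 // => _.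
by rewrite mulr_sumr; apply: eq_bigr => d _; apply: word_coefZ.
Qed.

Lemma cyc0 Q c : cyc (0 : cpa K Q) c = 0.
Proof. by rewrite -(scale0r 0) cycZ mul0r. Qed.

Lemma cycN Q (x : cpa K Q) c : cyc (- x) c = - cyc x c.
Proof. by rewrite -scaleN1r cycZ mulN1r. Qed.

Lemma cycB Q (x y : cpa K Q) c : cyc (x - y) c = cyc x c - cyc y c.
Proof. by rewrite cycD cycN. Qed.

Lemma cyc_sum Q I (r : seq I) P (F : I -> cpa K Q) c :
  cyc (\sum_(i <- r | P i) F i) c = \sum_(i <- r | P i) cyc (F i) c.
Proof. by elim/big_rec2: _ => [|i x y _ <-]; rewrite ?cyc0 ?cycD. Qed.

Lemma cyc_mpow Q (x : cpa K Q) c n : mpow n x -> (size c < n)%N -> cyc x c = 0.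
Proof.
move=> hx lt_c; rewrite cycE; case: ifP => // _; rewrite big_seq big1 // => d.
by case: d => [//|a d] /rotations_size e; rewrite word_coefE hx // e.
Qed.

Lemma rotations_cycle Q (c d : seq (arrow Q)) :
  d \in rotations c -> is_cycle c -> is_cycle d.
Proof.
case/rotationsP => k _ ->; rewrite /is_cycle rot_cycle.
by rewrite -!size_eq0 size_rot.
Qed.

(** Rotating a cycle by the length of its first factor exchanges the two ways of
    cutting it. *)
Lemma cyc_mulC Q (x y : cpa K Q) : cyc (x * y) = cyc (y * x).
Proof.
apply: potentialP => c; rewrite !cycE; case: ifP => // c_cyc.
pose st (d : seq (arrow Q)) v := if d is a :: _ then src a else v.
case: c c_cyc => // a0 c' c_cyc; set c := a0 :: c' in c_cyc *.
pose T (x y : cpa K Q) (i : 'I_(size c).+1) d :=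
  wcoef x (st d (src a0)) (take i d) *
  wcoef y (walk_end (st d (src a0)) (take i d)) (drop i d).
have TE z t d : d \in rotations c -> word_coef (z * t) d = \sum_i T z t i d.
  case: d => [/rotations_size //|a d] /rotations_size sz.
  by rewrite word_coefE wcoefM sz.
rewrite big_seq [RHS]big_seq.
under eq_bigr => d hd do rewrite (TE _ _ _ hd).
under [RHS]eq_bigr => d hd do rewrite (TE _ _ _ hd).
rewrite -!big_seq exchange_big [RHS]exchange_big /=.
(* Cutting at [i] before the rotation is cutting at the complementary place
   after it. *)
rewrite [RHS](reindex_inj rev_ord_inj) /=; apply: eq_bigr => i _.
rewrite -[RHS](perm_big _ (perm_rot_rotations i c)) big_map.
rewrite big_seq [RHS]big_seq; apply: eq_bigr => d hd.
have sd := rotations_size hd; have := rotations_cycle hd c_cyc.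
case: d sd hd => [|a d] // sd hd; rewrite is_cycle_walk => /andP[w /eqP e].
have le_i : (i <= size c)%N by rewrite -ltnS.
have -> : T y x (rev_ord i) (rot i (a :: d)) =
    wcoef y (st (rot i (a :: d)) (src a0)) (drop i (a :: d)) *
    wcoef x (walk_end (st (rot i (a :: d)) (src a0)) (drop i (a :: d))) (take i (a :: d)).
  have er : nat_of_ord (rev_ord i) = size (drop i (a :: d)) by rewrite size_drop sd.
  by rewrite /T er take_size_cat // drop_size_cat.
rewrite /T mulrC /rot.
set u := take i _; set w' := drop i _.
have uw : u ++ w' = a :: d by apply: cat_take_drop.
rewrite [st (a :: d) _]/=.
have es : st (w' ++ u) (src a0) = walk_end (src a) u.
  move: uw; case: (w') => [|b t] uw.
    by rewrite cats0 in uw; rewrite uw e.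
  by move: w; rewrite -uw is_walk_cat => /andP[_ /= /andP[/eqP -> _]].
rewrite es; congr (_ * wcoef _ _ _).
by rewrite -[in LHS]e -uw /walk_end map_cat last_cat.
Qed.

Section TruncatedExpansion.
Variables (Q : quiver V).

Lemma truncated_expansion n (x : cpa K Q) : mpow n.+1
  (x - (cst Q x + \sum_(j < n) \sum_(w : j.+1.-tuple (arrow Q))
          word_coef x w *: word w)).
Proof.
move=> v s lt_s; rewrite wcoefB wcoefD wcoef_cst wcoef_sum.
have [w|nw] := boolP (is_walk v s); last first.
  rewrite (wcoef_nwalk x nw) big1 => [|j _]; last by rewrite wcoef_nwalk.
  by case: s nw {lt_s} => // a s _; rewrite addr0 subrr.
case: s w lt_s => [|a s] w lt_s /=.
  rewrite big1 ?addr0 ?subrr // => j _; rewrite wcoef_sum big1 // => t _.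
  by rewrite wcoefZ wcoef_word; case: (tval t) (size_tuple t) => //= *; rewrite mulr0.
have lt_sn : (size s < n)%N by [].
rewrite add0r (bigD1 (Ordinal lt_sn)) //= [X in _ - (_ + X)]big1 => [|j ne_j];
  last first.
  rewrite wcoef_sum big1 // => t _; rewrite wcoefZ wcoef_word.
  case: eqP => [e|_]; last by rewrite andbF mulr0.
  case/eqP: ne_j; apply: val_inj => /=; apply/eqP.
  by rewrite -eqSS -(size_tuple t) -e.
rewrite /= addr0 wcoef_sum (bigD1 (in_tuple (a :: s))) // big1 => [|t ne_t].
  rewrite /= addr0 wcoefZ wcoef_word w eqxx mulr1.
  by move: w => /= /andP[/eqP <- _]; rewrite subrr.
rewrite wcoefZ wcoef_word; case: eqP => [e|_]; last by rewrite andbF mulr0.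
by case/eqP: ne_t; apply: val_inj.
Qed.

End TruncatedExpansion.

Lemma word_corner Q (a : arrow Q) s :
  word (a :: s) = idem (src a) * word (a :: s) * idem (walk_end (src a) (a :: s))
  :> cpa K Q.
Proof.
apply: cpaP => v t w; rewrite wcoef_Midem wcoef_idemM wcoef_word.
have [e|_] := eqVneq t (a :: s); last by rewrite andbF !if_same.
by move: w; rewrite e => /= /andP[/eqP -> _]; rewrite !eqxx.
Qed.

Lemma word_nonwalk Q (a : arrow Q) s :
  ~~ is_walk (src a) (a :: s) -> word (a :: s) = 0 :> cpa K Q.
Proof.
move=> nw; apply: cpaP => v t w; rewrite wcoef0 wcoef_word.
have [e|_] := eqVneq t (a :: s); last by rewrite andbF.
case/negP: nw; move: w; rewrite e => /=.
by rewrite eqxx => /andP[].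
Qed.

Lemma cyc_hom_noncycle Q Q' (phi : cpa K Q -> cpa K Q') (s : seq (arrow Q)) :
  alg_hom phi -> s != [::] -> ~~ is_cycle s ->
  forall c, cyc (phi (word s)) c = 0.
Proof.
move=> h; case: s => // a s _ nc c.
have [w|nw] := boolP (is_walk (src a) (a :: s)); last first.
  by rewrite word_nonwalk // (hom0 h) cyc0.
rewrite is_cycle_walk w /= in nc.
rewrite word_corner (homM h) cyc_mulC -(homM h) !mulrA.
suff -> : idem (walk_end (src a) (a :: s)) * idem (src a) = 0 :> cpa K Q.
  by rewrite !mul0r (hom0 h) cyc0.
apply: cpaP => v t _; rewrite wcoef_idemM wcoef_idem wcoef0.
by case: eqP => [->|] //; rewrite (negPf nc).
Qed.

Lemma cyc_hom_rot Q Q' (phi : cpa K Q -> cpa K Q') (s : seq (arrow Q)) k :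
  alg_hom phi -> cyc (phi (word (rot k s))) = cyc (phi (word s)).
Proof.
move=> h; rewrite /rot -word_cat (homM h) cyc_mulC -(homM h) word_cat.
by rewrite cat_take_drop.
Qed.

Lemma sum_rotations (T : finType) n (r : n.-tuple T) (G : seq T -> K) :
  \sum_(d <- rotations r) G d = \sum_(w : n.-tuple T | val w \in rotations r) G w.
Proof.
have P : perm_eq (rotations r) [seq val w | w <- enum [pred w : n.-tuple T | val w \in rotations r]].
  apply: uniq_perm; first exact: rotations_uniq.
    by rewrite map_inj_uniq ?enum_uniq //; apply: val_inj.
  move=> d; apply/idP/mapP => [hd|[w]]; last by rewrite mem_enum inE => h ->.
  have sd : size d == n by rewrite (rotations_size hd) size_tuple.
  by exists (Tuple sd); rewrite // mem_enum inE.
by rewrite (perm_big _ P) big_map big_enum.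
Qed.

(** The kernel of [cyc] consists of the limits of combinations of non-cycles and
    of differences of rotated cycles, and homomorphisms respect both. *)
Lemma hom_cyc0 Q Q' (phi : cpa K Q -> cpa K Q') (x : cpa K Q) : alg_hom phi ->
  (forall c, cyc x c = 0) -> forall c, cyc (phi x) c = 0.
Proof.
move=> h x0 c; set n := size c.
pose S := cst Q x + \sum_(j < n) \sum_(w : j.+1.-tuple (arrow Q)) word_coef x w *: word w.
rewrite -[x](subrK S) (homD h) cycD (cyc_mpow (n := n.+1)) // ?add0r; last first.
  by apply: (hom_mpow h); apply: truncated_expansion.
rewrite /S (homD h) (hom_cst h) cycD.
have -> : cyc (cst Q' x) c = 0.
  rewrite cycE; case: ifP => // _; rewrite big1 // => -[|a d] _ //.
  by rewrite word_coefE wcoef_cst.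
rewrite add0r (hom_sum h) cyc_sum big1 // => j _.
rewrite (hom_sum h) cyc_sum; set m := j.+1.
(* The sum is grouped by rotation classes; the coefficients of each class add
   up to the coefficient of [cyc x], which is 0. *)
pose rep (w : m.-tuple (arrow Q)) := choose [pred t : m.-tuple _ | val t \in rotations w] w.
have repP w : val (rep w) \in rotations w.
  have : [pred t : m.-tuple _ | val t \in rotations w] (rep w); last by [].
  by apply: chooseP; rewrite /= -{1}[tval w]rot0; apply: mem_rot_rotations; rewrite -size_eq0 size_tuple.
have repE (w w' : m.-tuple (arrow Q)) : val w' \in rotations w -> rep w' = rep w.
  move=> hw; rewrite /rep; have E : [pred t : m.-tuple _ | val t \in rotations w'] =1 [pred t : m.-tuple _ | val t \in rotations w].
    move=> t /=; apply/idP/idP; first exact: rotations_trans.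
    by apply: rotations_trans; apply: rotations_sym.
  rewrite (eq_choose E); apply: choose_id => /=.
    exact: hw.
  by rewrite -{1}[tval w]rot0; apply: mem_rot_rotations; rewrite -size_eq0 size_tuple.
rewrite (partition_big rep xpredT) //= big1 // => r _.
transitivity (\sum_(w : m.-tuple (arrow Q) | rep w == r) word_coef x w * cyc (phi (word r)) c).
  apply: eq_bigr => w /eqP <-; rewrite (homZ h) cycZ.
  by have /rotationsP[k _ ->] := repP w; rewrite cyc_hom_rot.
rewrite -mulr_suml; have [r_cyc|nc] := boolP (is_cycle r); last first.
  by rewrite cyc_hom_noncycle ?mulr0 // -size_eq0 size_tuple.
have [w0 /eqP rw0|none] := pickP (fun w => rep w == r); last first.
  by rewrite big_pred0 // mul0r.
rewrite (eq_bigl (fun w : m.-tuple _ => val w \in rotations r)); last first.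
  move=> w; apply/eqP/idP => [<-|hw]; first exact/rotations_sym/repP.
  rewrite (repE _ _ hw) -rw0; apply: repE; exact: repP.
rewrite -(sum_rotations r (word_coef x)).
by have := x0 r; rewrite cycE r_cyc => ->; rewrite mul0r.
Qed.

Lemma hom_cyc Q Q' (phi : cpa K Q -> cpa K Q') (x y : cpa K Q) : alg_hom phi ->
  cyc x = cyc y -> cyc (phi x) = cyc (phi y).
Proof.
move=> h e; apply: potentialP => c; apply/eqP; rewrite -subr_eq0 -cycB -(homB h).
by apply/eqP; apply: hom_cyc0 => // d; rewrite cycB e subrr.
Qed.

(** Lifts can be normalised by prescribing a shape that some rotation of each
    cycle has, such as not starting at a given vertex. *)
Lemma potential_lift Q (W : potential K Q) (good : pred (seq (arrow Q))) :
  (forall c, is_cycle c -> exists2 d, d \in rotations c & good d) ->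
  exists2 x : cpa K Q, cyc x = W &
    forall v s, wcoef x v s != 0 -> is_cycle s /\ good s.
Proof.
move=> hgood; pose P c := [pred d : seq (arrow Q) | (d \in rotations c) && good d].
pose rep c := choose (P c) (head c (filter (P c) (rotations c))).
have headP c : is_cycle c -> P c (head c (filter (P c) (rotations c))).
  move=> /hgood[d d1 d2]; have : d \in filter (P c) (rotations c).
    by rewrite mem_filter /= d1 d2.
  case E : (filter _ _) => [//|e r] _ /=.
  have : e \in filter (P c) (rotations c) by rewrite E mem_head.
  by rewrite mem_filter => /andP[].
have repP c : is_cycle c -> P c (rep c) by move=> h; apply: chooseP; apply: headP.
have repE c d : is_cycle c -> d \in rotations c -> rep d = rep c.
  move=> hc hd; have E : P d =1 P c.
    move=> e /=; congr (_ && _); apply/idP/idP; first exact: rotations_trans.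
    by apply: rotations_trans; apply: rotations_sym.
  rewrite /rep (eq_choose E); apply: choose_id; last exact: headP.
  by rewrite -E; apply: headP; apply: rotations_cycle hd hc.
pose x : cpa K Q := fun p => let s := qword p in
  if is_cycle s && (s == rep s) then W s else 0.
have xE v s : wcoef x v s =
    if [&& is_walk v s, is_cycle s & s == rep s] then W s else 0.
  have [w|nw] := boolP (is_walk v s); first by rewrite (wcoef_walk _ w).
  by rewrite wcoef_nwalk.
exists x => [|v s]; last first.
  rewrite xE; case: and3P => [[_ sc /eqP ->] _|]; last by rewrite eqxx.
  by split; [apply: (rotations_cycle _ sc)|]; case/andP: (repP _ sc).
apply: potentialP => c; rewrite cycE; case: ifP => [cc|/negbT/pcoef_cycle -> //].
have /andP[r1 r2] := repP c cc.
rewrite (bigD1_seq (rep c)) ?rotations_uniq //= big_seq_cond big1 => [|d /andP[hd ne]].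
  have rr : rep (rep c) = rep c by apply: repE.
  have := rotations_cycle r1 cc; case: (rep c) r1 rr => [|b d] // r1 rr rc.
  rewrite addr0 word_coefE xE rr eqxx rc.
  move: rc; rewrite is_cycle_walk => /andP[-> _] /=.
  by case/rotationsP: r1 => k _ ->; rewrite potential_rot.
case: d hd ne => [|a d] // hd ne.
by rewrite word_coefE xE (repE c) // (negPf ne) !andbF.
Qed.

End Cyclic.
Arguments word_coef : simpl never.

(** * Right equivalences and corners of the path algebra *)

Section RightEquivalence.
Context {V : finType} {K : fieldType}.
Implicit Types (Q : quiver V) (X Y Z : qp V K).

Lemma lift_potential Q (W : potential K Q) : exists x : cpa K Q, cyc x = W.
Proof.
have [|x <- _] := @potential_lift _ _ _ W predT; last by exists x.
move=> c cc; exists c => //; rewrite -{1}[c]rot0; apply: mem_rot_rotations.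
by case/andP: cc.
Qed.

(** As [hom_cyc] shows, a homomorphism acts on potentials; so the witness in the
    definition can be replaced by all lifts of the potential. *)
Lemma right_equivalentP X Y : right_equivalent X Y <->
  exists (phi : cpa K X -> cpa K Y) (psi : cpa K Y -> cpa K X),
    alg_iso phi psi /\ forall x, cyc x = qp_pot X -> cyc (phi x) = qp_pot Y.
Proof.
split=> [[phi [[psi K1 K2] hZ hI [x ex ey]]]|[phi [psi [[h1 h2 K1 K2] hW]]]].
  have h : alg_hom phi.
    by split=> //; [apply: rmorphD | apply: rmorphM].
  exists phi, psi; split.
    by split=> //; apply: alg_hom_inv h K1 K2.
  by move=> x' ex'; rewrite -ey; apply: hom_cyc => //; rewrite ex' ex.
pose M1 := GRing.isZmodMorphism.Build _ _ phi (homB h1).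
pose M2 := GRing.isMonoidMorphism.Build _ _ phi (hom1 h1, homM h1).
pose F : {rmorphism cpa K X -> cpa K Y} := HB.pack phi M1 M2.
exists F; split.
- by exists psi.
- exact: (homZ h1).
- exact: (hom_idem h1).
by have [x ex] := lift_potential (qp_pot X); exists x => //; apply: hW.
Qed.

Lemma right_equivalent_sym X Y : right_equivalent X Y -> right_equivalent Y X.
Proof.
move=> /right_equivalentP[phi [psi [[h1 h2 K1 K2] hW]]].
apply/right_equivalentP; exists psi, phi; split=> // y ey.
have [x ex] := lift_potential (qp_pot X).
by rewrite -ex -[x]K1; apply: hom_cyc => //; rewrite ey hW.
Qed.

Lemma right_equivalent_trans Y X Z :
  right_equivalent X Y -> right_equivalent Y Z -> right_equivalent X Z.
Proof.
move=> /right_equivalentP[phi [psi [[h1 h2 K1 K2] hW]]].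
move=> /right_equivalentP[phi' [psi' [[h1' h2' K1' K2'] hW']]].
apply/right_equivalentP; exists (phi' \o phi), (psi \o psi'); split.
  split; [exact: alg_hom_comp | exact: alg_hom_comp | |].
    by move=> x /=; rewrite K1' K1.
  by move=> x /=; rewrite K2 K2'.
by move=> x ex /=; apply: hW'; apply: hW.
Qed.

Lemma right_equivalent_refl X : right_equivalent X X.
Proof.
by apply/right_equivalentP; exists id, id.
Qed.

End RightEquivalence.

Section Corners.
Context {V : finType} {K : fieldType}.
Implicit Types Q : quiver V.

(** Linear combinations of paths from [i] to [j]. *)
Definition corner Q i j (x : cpa K Q) := idem i * x = x /\ x * idem j = x.

Lemma cornerP Q i j (x : cpa K Q) : corner i j x <->
  forall v s, is_walk v s -> wcoef x v s != 0 -> v = i /\ walk_end v s = j.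
Proof.
split=> [[e1 e2] v s _|h].
  rewrite -e2 wcoef_Midem -e1 wcoef_idemM; case: (_ =P j); last by rewrite eqxx.
  by move=> ->; case: (_ =P i) => [->|]; last by rewrite eqxx.
split; apply: cpaP => v s w; have := h v s w.
  rewrite wcoef_idemM; have [->|nz] := eqVneq (wcoef x v s) 0; first by rewrite if_same.
  by case/(_ isT) => -> _; rewrite eqxx.
rewrite wcoef_Midem; have [->|nz] := eqVneq (wcoef x v s) 0; first by rewrite if_same.
by case/(_ isT) => _ ->; rewrite eqxx.
Qed.

Lemma corner0 Q i j : corner i j (0 : cpa K Q).
Proof. by split; rewrite ?mulr0 ?mul0r. Qed.

Lemma cornerD Q i j (x y : cpa K Q) : corner i j x -> corner i j y -> corner i j (x + y).
Proof. by move=> [x1 x2] [y1 y2]; split; rewrite ?mulrDr ?mulrDl ?x1 ?y1 ?x2 ?y2. Qed.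

Lemma cornerN Q i j (x : cpa K Q) : corner i j x -> corner i j (- x).
Proof. by move=> [x1 x2]; split; rewrite ?mulrN ?mulNr ?x1 ?x2. Qed.

Lemma cornerZ Q i j c (x : cpa K Q) : corner i j x -> corner i j (c *: x).
Proof. by move=> [x1 x2]; split; rewrite -?cpa_scaleAr -?cpa_scaleAl ?x1 ?x2. Qed.

Lemma corner_sum Q i j I (r : seq I) (P : pred I) (F : I -> cpa K Q) :
  (forall k, P k -> corner i j (F k)) -> corner i j (\sum_(k <- r | P k) F k).
Proof.
move=> h; elim/big_rec: _ => [|k x hk hx]; first exact: corner0.
by apply: cornerD => //; apply: h.
Qed.

Lemma cornerM Q i j k l (x y : cpa K Q) :
  corner i j x -> corner k l y -> corner i l (x * y).
Proof. by move=> [x1 x2] [y1 y2]; split; rewrite ?mulrA ?x1 // -mulrA y2. Qed.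

Lemma corner_arrow Q (a : arrow Q) : corner (src a) (tgt a) (word [:: a] : cpa K Q).
Proof. by split; [apply: idem_arrow | apply: arrow_idem]. Qed.

Lemma corner_hom Q Q' (phi : cpa K Q -> cpa K Q') i j x :
  alg_hom phi -> corner i j x -> corner i j (phi x).
Proof.
by move=> h [x1 x2]; split; rewrite -(hom_idem h) -(homM h) ?x1 ?x2.
Qed.

Lemma corner_lquot Q (a : arrow Q) i j x :
  corner i j x -> corner (tgt a) j (lquot a x).
Proof.
move=> /cornerP h; apply/cornerP => v s w; rewrite wcoef_lquot.
case: (v =P tgt a) => [->|]; last by rewrite eqxx.
have [ws|nw] := boolP (is_walk (src a) (a :: s)); last by rewrite wcoef_nwalk ?eqxx.
by case/(h _ _ ws) => _ <-.
Qed.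

Lemma corner_rquot Q (a : arrow Q) i j x :
  corner i j x -> corner i (src a) (rquot a x).
Proof.
move=> /cornerP h; apply/cornerP => v s w; rewrite wcoef_rquot.
have [ws|nw] := boolP (is_walk v (rcons s a)); last by rewrite wcoef_nwalk ?eqxx.
case/(h _ _ ws) => e _; move: ws.
by rewrite -cats1 is_walk_cat /= andbT => /andP[_ /eqP ->].
Qed.

Lemma hom_of_arrows Q Q' (x : arrow Q -> cpa K Q') :
  (forall a, mpow 1 (x a)) -> (forall a, corner (src a) (tgt a) (x a)) ->
  exists2 phi, alg_hom phi & forall a, phi (word [:: a]) = x a.
Proof.
move=> h1 h2; exists (subst x).
  by apply: subst_alg_hom => // a; case: (h2 a).
by move=> a; apply: subst_arrow => // b; case: (h2 b).
Qed.

End Corners.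

(** * The bracket map of a premutation *)

Section LinearContinuous.
Context {V : finType} {K : fieldType}.
Implicit Types Q : quiver V.

(** The bracket map of a premutation is multiplicative only on products cut away
    from the mutated vertex, but it is linear and continuous, which is enough for
    comparing two maps on paths. *)
Record lin_cont Q Q' (F : cpa K Q -> cpa K Q') : Prop := LinCont {
  lcD : {morph F : x y / x + y};
  lcZ : forall c, {morph F : x / c *: x};
  lcC : forall n, exists m, forall x, mpow m x -> mpow n (F x) }.

Lemma lin_cont_hom Q Q' (F : cpa K Q -> cpa K Q') : alg_hom F -> lin_cont F.
Proof.
move=> h; split; [exact: homD | exact: homZ | ].
by move=> n; exists n; apply: hom_mpow.
Qed.

Lemma lin_cont_comp Q1 Q2 Q3 (F : cpa K Q1 -> cpa K Q2) (G : cpa K Q2 -> cpa K Q3) :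
  lin_cont F -> lin_cont G -> lin_cont (G \o F).
Proof.
move=> hF hG; split=> [x y|c x|n] /=.
- by rewrite (lcD hF) (lcD hG).
- by rewrite (lcZ hF) (lcZ hG).
have [m hm] := lcC hG n; have [l hl] := lcC hF m.
by exists l => x hx /=; apply: hm; apply: hl.
Qed.

Lemma lc0 Q Q' (F : cpa K Q -> cpa K Q') : lin_cont F -> F 0 = 0.
Proof. by move=> hF; rewrite -(scale0r 0) (lcZ hF) scale0r. Qed.

Lemma lc_sum Q Q' (F : cpa K Q -> cpa K Q') I (r : seq I) P (G : I -> cpa K Q) :
  lin_cont F -> F (\sum_(i <- r | P i) G i) = \sum_(i <- r | P i) F (G i).
Proof. by move=> hF; apply: (big_morph F (lcD hF) (lc0 hF)). Qed.

Lemma lcB Q Q' (F : cpa K Q -> cpa K Q') : lin_cont F -> {morph F : x y / x - y}.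
Proof. by move=> hF x y; rewrite (lcD hF) -scaleN1r (lcZ hF) scaleN1r. Qed.

Lemma lin_cont_ext Q Q' (F G : cpa K Q -> cpa K Q') x :
  lin_cont F -> lin_cont G ->
  (forall v, wcoef x v [::] != 0 -> F (idem v) = G (idem v)) ->
  (forall a s, wcoef x (src a) (a :: s) != 0 -> F (word (a :: s)) = G (word (a :: s))) ->
  F x = G x.
Proof.
move=> hF hG hv hs; apply: mpow_all => n.
have [m1 h1] := lcC hF n; have [m2 h2] := lcC hG n.
pose m := maxn m1 m2.
pose S := cst Q x + \sum_(j < m) \sum_(w : j.+1.-tuple (arrow Q)) word_coef x w *: word w.
have hS : mpow m (x - S).
  by apply: mpow_le (leqnSn m) _; apply: truncated_expansion.
have eS : F S = G S.
  rewrite /S (lcD hF) (lcD hG); congr (_ + _); rewrite /cst !lc_sum //.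
    apply: eq_bigr => v _; rewrite (lcZ hF) (lcZ hG).
    by have [->|nz] := eqVneq (wcoef x v [::]) 0; rewrite ?scale0r ?hv.
  apply: eq_bigr => j _; rewrite !lc_sum //; apply: eq_bigr => -[[//|a s] sz] _ /=.
  rewrite (lcZ hF) (lcZ hG).
  have [->|nz] := eqVneq (word_coef x (a :: s)) 0; first by rewrite !scale0r.
  by rewrite hs.
have -> : F x - G x = F (x - S) - G (x - S).
  by rewrite (lcB hF x S) (lcB hG x S) eS opprD addrACA -opprD subrr oppr0 addr0.
apply: mpowB; [apply: h1 | apply: h2]; apply: mpow_le hS.
  exact: leq_maxl.
exact: leq_maxr.
Qed.

End LinearContinuous.

Section Bracket.
Context {V : finType} {K : fieldType}.
Variables (k : V) (X : qp V K).
Local Notation Qm := (premut_quiver k X).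
Implicit Types (w : seq (arrow Qm)) (s : seq (arrow X)) (x y : cpa K X).

(** Writing out the composite arrows: the inverse of the bracket on paths that
    neither start nor end at [k]. *)
Definition expands w : seq (arrow X) := flatten (map (@expand _ _ k X) w).
Local Notation free := (all (@unstarred _ _ k X)).

Lemma expands_cat w w' : expands (w ++ w') = expands w ++ expands w'.
Proof. by rewrite /expands map_cat flatten_cat. Qed.

Lemma walk_end_cons (Q : quiver V) v (a : arrow Q) (t : seq (arrow Q)) : walk_end v (a :: t) = walk_end (tgt a) t.
Proof. by []. Qed.

Lemma is_walk_expands v w : free w -> is_walk v (expands w) = is_walk v w.
Proof.
elim: w v => [//|c w IH] v /= /andP[hc hw].
case: c hc => [[c|ab]|//] _; rewrite /expands /= -/(expands w) IH //.
by case/andP: (valP ab) => /eqP -> /eqP ->; rewrite eqxx.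
Qed.

Lemma walk_end_expands v w : free w -> walk_end v (expands w) = walk_end v w.
Proof.
elim: w v => [//|c w IH] v /= /andP[hc hw].
by case: c hc => [[c|ab]|//] _; rewrite /expands /= -/(expands w) !walk_end_cons IH.
Qed.

Lemma size_expands w : (size (expands w) <= 2 * size w)%N.
Proof.
elim: w => [//|c w IH]; rewrite /expands /= -/(expands w) size_cat mulnS.
by apply: leq_add => //; case: c => [[c|ab]|c].
Qed.

Lemma expands_nil w : free w -> (expands w == [::]) = (w == [::]).
Proof. by case: w => [//|[[c|ab]|c] w]. Qed.

Lemma expands_inj w w' : free w -> free w' -> expands w = expands w' -> w = w'.
Proof.
elim: w w' => [|c w IH] [|c' w'] //.
- by move=> _ hw' /esym/eqP; rewrite expands_nil.
- by move=> hw _ /eqP; rewrite expands_nil.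
move=> /= /andP[hc hw] /andP[hc' hw']; rewrite /expands /= -!/(expands _).
case: c hc => [[c|ab]|//] _; case: c' hc' => [[c'|ab']|//] _ /=.
- by case=> /val_inj -> /(IH _ hw hw') ->.
- by case=> e _; have := svalP c; rewrite e => /andP[_]; case/andP: (svalP ab') => ->.
- by case=> e _; have := svalP c'; rewrite -e => /andP[_]; case/andP: (svalP ab) => ->.
case=> e1 e2 /(IH _ hw hw') ->; congr (inl (inr _) :: _); apply: val_inj.
by rewrite /= [sval ab]surjective_pairing e1 e2 -surjective_pairing.
Qed.

(** On the paths that start or end at [k] this is 0. *)
Definition bracket x : cpa K Qm := fun p =>
  if free (qword p) then wcoef x (qstart p) (expands (qword p)) else 0.

Lemma wcoef_bracket x v w :
  wcoef (bracket x) v w = if free w then wcoef x v (expands w) else 0.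
Proof.
have [h|nw] := boolP (is_walk v w); first by rewrite (wcoef_walk _ h).
by rewrite wcoef_nwalk //; case: ifP => // hw; rewrite wcoef_nwalk ?is_walk_expands.
Qed.

Lemma bracket_lin_cont : lin_cont bracket.
Proof.
split=> [x y|c x|n].
- apply: cpaP => v w _; rewrite wcoefD !wcoef_bracket wcoefD.
  by case: ifP; rewrite ?addr0.
- apply: cpaP => v w _; rewrite wcoefZ !wcoef_bracket wcoefZ.
  by case: ifP; rewrite ?mulr0.
exists (2 * n)%N => x hx v w lt_w; rewrite wcoef_bracket; case: ifP => // _.
by apply: hx; apply: leq_ltn_trans (size_expands w) _; rewrite ltn_pmul2l.
Qed.

Lemma bracket_mpow1 x : mpow 1 x -> mpow 1 (bracket x).
Proof. by move=> hx; apply: mpow1P => v; rewrite wcoef_bracket /= hx. Qed.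

Lemma bracket_idem i : bracket (idem i) = idem i.
Proof.
apply: cpaP => v w _; rewrite wcoef_bracket !wcoef_idem.
case: ifP => [hw|]; first by rewrite /nilp !size_eq0 expands_nil.
by case: w => [//|c w] _; rewrite andbF.
Qed.

Lemma bracket_word w : free w -> bracket (word (expands w)) = word w.
Proof.
move=> hw; apply: cpaP => v w' hv; rewrite wcoef_bracket !wcoef_word hv.
case: ifP => [hw'|nw]; last by case: eqP nw => // ->; rewrite hw.
rewrite is_walk_expands // hv /=.
by case: (w' =P w) => [->|ne]; [rewrite eqxx | case: eqP => // /expands_inj -/(_ hw' hw)].
Qed.

Lemma bracket_corner x i j : corner i j x -> corner i j (bracket x).
Proof.
move=> /cornerP h; apply/cornerP => v w hv; rewrite wcoef_bracket.
case: ifP => [hw|]; last by rewrite eqxx.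
have hs : is_walk v (expands w) by rewrite is_walk_expands.
by case/(h _ _ hs) => -> <-; rewrite walk_end_expands.
Qed.

(** A path of the premutation can be cut at fewer places than its expansion: the
    missing cuts are at [k]. *)
Lemma sum_cuts (F : seq (arrow X) -> seq (arrow X) -> K) w : free w ->
  (forall s b t, src b = k -> F s (b :: t) = 0) ->
  \sum_(i < (size (expands w)).+1) F (take i (expands w)) (drop i (expands w)) =
  \sum_(j < (size w).+1) F (expands (take j w)) (expands (drop j w)).
Proof.
elim: w F => [|c w IH] F; first by rewrite !big_ord1.
move=> /= /andP[hc hw] hF; rewrite [RHS]big_ord_recl /= [expands [::]]/=.
case: c hc => [[c|ab]|//] _; rewrite /expands /= -/(expands w).
  rewrite big_ord_recl /=; congr (_ + _).
  by apply: (IH (fun s => F (val c :: s))) => // s b t; apply: hF.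
rewrite 2!big_ord_recl /= (hF [:: _]) ?add0r; last first.
  by case/andP: (valP ab) => _ /eqP.
congr (_ + _).
by apply: (IH (fun s => F [:: (val ab).1, (val ab).2 & s])) => // s b t; apply: hF.
Qed.

(** These two conditions say that no path of [x] starts, respectively ends, at
    [k]. *)
Definition starts_off x := idem k * x = 0.
Definition ends_off x := x * idem k = 0.

Lemma starts_offP x : starts_off x <-> forall s, wcoef x k s = 0.
Proof.
split=> [h s|h].
  by have := congr1 (fun z => wcoef z k s) h; rewrite wcoef_idemM eqxx wcoef0.
by apply: cpaP => v s _; rewrite wcoef_idemM wcoef0; case: eqP => // ->.
Qed.

Hypothesis no_loop : forall a : arrow X, src a = k -> tgt a <> k.

Lemma expands_surj v s : is_walk v s -> v != k -> walk_end v s != k ->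
  exists2 w, free w & s = expands w.
Proof.
elim: {s}_.+1 {-2}s (ltnSn (size s)) v => // n IH [|a s] lt_s v.
  by exists [::].
move=> /= /andP[/eqP ea hs] nv ne.
have [ta|ta] := eqVneq (tgt a) k; last first.
  have [w hw ->] := IH s lt_s (tgt a) hs ta ne.
  have ha : (src a != k) && (tgt a != k) by rewrite ea nv.
  by exists (inl (inl (exist _ a ha : kept_arrow k X)) :: w).
case: s lt_s hs ne => [|b s] lt_s hs ne; first by rewrite /walk_end /= ta eqxx in ne.
move: hs => /= /andP[/eqP eb hs].
have tb : tgt b != k by apply/eqP; apply: no_loop; rewrite eb ta.
have [w hw ->] := IH s (ltnW lt_s) (tgt b) hs tb ne.
have hab : (tgt (a, b).1 == k) && (src (a, b).2 == k) by rewrite /= ta eb ta eqxx.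
by exists (inl (inr (exist _ (a, b) hab : comp_arrow k X)) :: w).
Qed.

End Bracket.
Arguments bracket {V K} k {X} x.

(** * The potential of a premutation *)

Section PremutationPotential.
Context {V : finType} {K : fieldType}.
Variables (k : V) (X : qp V K).
Local Notation Qm := (premut_quiver k X).
Local Notation free := (all (@unstarred _ _ k X)).
Hypothesis no_loop : forall a : arrow X, src a = k -> tgt a <> k.

Lemma expands_cut (w : seq (arrow Qm)) i : free w -> (i <= size (expands w))%N ->
  (exists j, take i (expands w) = expands (take j w) /\
             drop i (expands w) = expands (drop j w)) \/
  exists b s, drop i (expands w) = b :: s /\ src b = k.
Proof.
elim: w i => [|c w IH] [|i] //.
- by left; exists 0%N.
- by left; exists 0%N; rewrite !take0 !drop0.
move=> /= /andP[hc hw]; case: c hc => [[c|ab]|//] _; rewrite /expands /= -/(expands w).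
  rewrite ltnS => le_i; case: (IH i hw le_i) => [[j [e1 e2]]|h]; last by right.
  by left; exists j.+1; rewrite /= e1 e2.
case: i => [|i] le_i.
  right; exists (val ab).2, (expands w); rewrite drop0; split => //.
  by case/andP: (valP ab) => _ /eqP.
case: (IH i hw le_i) => [[j [e1 e2]]|h]; last by right.
by left; exists j.+1; rewrite /= e1 e2.
Qed.

Lemma expands_head_off (c : arrow Qm) w : free (c :: w) ->
  exists b s, [/\ expands (c :: w) = b :: s, src b = src c & src b <> k].
Proof.
case: c => [[c|ab]|//] _.
  exists (val c), (expands w); split=> //.
  by case/andP: (valP c) => /eqP.
exists (val ab).1, ((val ab).2 :: expands w); split=> //.
by case/andP: (valP ab) => /eqP e _ /no_loop.
Qed.

Lemma is_cycle_expands (w : seq (arrow Qm)) :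
  free w -> is_cycle (expands w) = is_cycle w.
Proof.
case: w => [//|c w] hw; have [b [s [e es _]]] := expands_head_off hw.
rewrite e !is_cycle_walk -e -es is_walk_expands // walk_end_expands //.
Qed.

(** The rotations of an expanded cycle that do not start at [k] are the expansions
    of the rotations of the cycle. *)
Lemma cyc_bracket (x : cpa K X) c : starts_off k x -> is_cycle c ->
  cyc (bracket k x) c = if free c then cyc x (expands c) else 0.
Proof.
move=> /starts_offP hx cc; rewrite cycE cc.
have free_rot d : d \in rotations c -> free d = free c.
  by case/rotationsP => i _ ->; apply: eq_all_r => ?; rewrite mem_rot.
case: ifP => hc; last first.
  rewrite big_seq big1 // => -[//|a d] hd.
  by rewrite word_coefE wcoef_bracket (free_rot _ hd) hc.
rewrite cycE is_cycle_expands // cc.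
pose good (d : seq (arrow X)) := if d is b :: _ then src b != k else true.
transitivity (\sum_(d <- rotations (expands c) | good d) word_coef x d); last first.
  rewrite big_mkcond; apply: eq_bigr => -[//|b d] _ /=.
  by case: eqP => // e; rewrite word_coefE e hx.
rewrite -[RHS]big_filter.
have P : perm_eq [seq d <- rotations (expands c) | good d] (map (@expands _ _ k X) (rotations c)).
  apply: uniq_perm; first by rewrite filter_uniq ?rotations_uniq.
    rewrite map_inj_in_uniq ?rotations_uniq // => d d' hd hd'.
    by apply: expands_inj; rewrite free_rot.
  move=> d; rewrite mem_filter; apply/andP/mapP => [[gd /rotationsP[i lt_i e]]|[d' /rotationsP[i lt_i ->] ->]].
    case: (expands_cut hc (ltnW lt_i)) => [[j [e1 e2]]|[b [s [e1 e2]]]].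
      exists (rot j c); last by rewrite e /rot expands_cat e1 e2.
      by apply: mem_rot_rotations; case/andP: cc.
    by move: gd; rewrite e /rot e1 /= e2 eqxx.
  split; last first.
    rewrite /rot expands_cat -{3}(cat_take_drop i c) expands_cat -rot_size_cat.
    apply: mem_rot_rotations; rewrite -expands_cat cat_take_drop expands_nil //.
    by case/andP: cc.
  have : free (rot i c) by rewrite free_rot // mem_rot_rotations //; case/andP: cc.
  case: (rot i c) => [//|a s] /expands_head_off[b [t [-> _ /eqP]]] //.
rewrite [RHS](perm_big _ P) big_map big_seq [RHS]big_seq; apply: eq_bigr => -[|a d] hd.
  by move/rotations_size: hd cc; case: (c).
have fd : free (a :: d) by rewrite free_rot.
have [b [s [e es _]]] := expands_head_off fd.
by rewrite e !word_coefE wcoef_bracket fd e es.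
Qed.

Definition triangles_at : cpa K Qm := \sum_(ab : comp_arrow k X) word (comp_triangle ab).

(** The potential of the premutation, read off from a lift that has no path
    starting at [k]. *)
Lemma premutation_pot (x : cpa K X) : cyc x = qp_pot X -> starts_off k x ->
  qp_pot (premutation k X) = cyc (bracket k x + triangles_at).
Proof.
move=> ex hx; apply: potentialP => c; rewrite cycD.
have [cc|nc] := boolP (is_cycle c); last by rewrite !pcoef_cycle ?addr0.
rewrite cyc_bracket // ex.
have -> : qp_pot (premutation k X) c = premut_coef c.
  by rewrite -[LHS]/(if is_cycle c then premut_coef c else 0) cc.
by [].
Qed.

Lemma off_lift : exists x, [/\ cyc x = qp_pot X, starts_off k x & ends_off k x].
Proof.
pose good (d : seq (arrow X)) := if d is b :: _ then src b != k else true.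
have [c cc|x ex hx] := @potential_lift _ _ _ (qp_pot X) good.
  case: c cc => [//|a c] cc; have [ea|na] := eqVneq (src a) k; last first.
    by exists (a :: c) => //; rewrite -{1}[_ :: _]rot0; apply: mem_rot_rotations.
  exists (rot 1 (a :: c)); first exact: mem_rot_rotations.
  have := no_loop ea; move: cc; rewrite is_cycle_walk rot1_cons /= eqxx /=.
  case: c => [|b c] /=; last by rewrite /good /= => /andP[/andP[/eqP -> _] _] /eqP.
  by rewrite /walk_end /= ea => /eqP.
exists x; split=> //.
  apply/starts_offP => s; have [w|nw] := boolP (is_walk k s); last by rewrite wcoef_nwalk.
  apply/eqP; case: eqP => // /eqP /hx[]; case: s w => [//|a s] /= /andP[/eqP ea _] _.
  by rewrite /good ea eqxx.
apply: cpaP => v s w; rewrite wcoef_Midem wcoef0.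
case: eqP => // e; apply/eqP; case: eqP => // /eqP /hx[].
case: s w e => [//|a s] w e; rewrite is_cycle_walk => /andP[_].
move: e => /= e; rewrite walk_end_cons; move: e; rewrite walk_end_cons => -> /eqP ->.
by rewrite /good eqxx.
Qed.

End PremutationPotential.
Arguments triangles_at {V K} k X.

(** * Quotients by arrows of an isomorphism and its inverse *)

Section Quotients.
Context {V : finType} {K : fieldType}.
Implicit Types Q : quiver V.

Lemma rquotM Q a (x y : cpa K Q) : mpow 1 y -> rquot a (x * y) = x * rquot a y.
Proof.
move=> hy; apply: cpaP => v s _; rewrite wcoef_rquot !wcoefM size_rcons.
rewrite big_ord_recr /= [X in _ + X](_ : _ = 0) ?addr0; last first.
  by rewrite drop_oversize ?size_rcons // hy // mulr0.
apply: eq_bigr => i _; have le_i : (i <= size s)%N by rewrite -ltnS.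
rewrite wcoef_rquot -!cats1 takel_cat // drop_cat; case: ltnP => // ge_i.
have -> : nat_of_ord i = size s by lia.
by rewrite drop_size subnn.
Qed.

Lemma rquotD Q a (x y : cpa K Q) : rquot a (x + y) = rquot a x + rquot a y.
Proof. by apply: cpaP => v s _; rewrite !(wcoefD, wcoef_rquot). Qed.

Lemma rquot_sum Q a I (r : seq I) P (F : I -> cpa K Q) :
  rquot a (\sum_(i <- r | P i) F i) = \sum_(i <- r | P i) rquot a (F i).
Proof.
apply: (big_morph _ (rquotD a)).
by apply: cpaP => v s _; rewrite wcoef_rquot !wcoef0.
Qed.

Lemma lquot_sum Q a I (r : seq I) P (F : I -> cpa K Q) :
  lquot a (\sum_(i <- r | P i) F i) = \sum_(i <- r | P i) lquot a (F i).
Proof.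
apply: (big_morph _ (lquotD a)).
by apply: cpaP => v s _; rewrite wcoef_lquot !wcoef0 if_same.
Qed.

Lemma lquot_mpow1M Q a (x y : cpa K Q) : mpow 1 x -> lquot a (x * y) = lquot a x * y.
Proof. by move=> hx; rewrite lquotM hx // scale0r add0r. Qed.

Lemma rquot_arrow Q a b :
  rquot a (word [:: b]) = if a == b then idem (src a) else 0 :> cpa K Q.
Proof.
apply: cpaP => v s w; rewrite wcoef_rquot wcoef_word -cats1 is_walk_cat w /= andbT.
case: s w => [|c s] w; last first.
  rewrite (_ : c :: s ++ [:: a] == [:: b] = false); last first.
    by apply/eqP => -[_]; case: (s).
  by rewrite andbF; case: ifP; rewrite ?wcoef0 // wcoef_idem andbF.
rewrite /walk_end /= eqseq_cons eqxx andbT.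
case: (a =P b) => _; last by rewrite andbF wcoef0.
by rewrite wcoef_idem /= !andbT eq_sym.
Qed.

Lemma lquot_expansion1 Q (x : cpa K Q) :
  mpow 1 x -> x = \sum_a word [:: a] * lquot a x.
Proof. by move=> hx; rewrite [LHS]lquot_expansion cst_mpow1 // add0r. Qed.

Section Isomorphism.
Variables (Q Q' : quiver V) (phi : cpa K Q -> cpa K Q') (psi : cpa K Q' -> cpa K Q).
Hypothesis iso : alg_iso phi psi.

(** The quotients of the images of the arrows form a noncommutative Jacobian
    matrix; this is the chain rule for [phi] and its inverse. *)
Lemma rquot_inverse (a' a'' : arrow Q') :
  \sum_a phi (rquot a (psi (word [:: a'']))) * rquot a' (phi (word [:: a])) =
  if a' == a'' then idem (src a'') else 0.
Proof.
case: iso => h1 h2 K1 K2.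
transitivity (rquot a' (word [:: a''] : cpa K Q')); last first.
  by rewrite rquot_arrow; case: (a' =P a'') => [->|].
rewrite -[word [:: a''] in RHS]K2 [psi _ in RHS]rquot_expansion; last first.
  exact: (hom_arrow_mpow h2).
rewrite (hom_sum h1) rquot_sum; apply: eq_bigr => a _.
by rewrite (homM h1) rquotM //; apply: (hom_arrow_mpow h1).
Qed.

Lemma lquot_inverse (b' b'' : arrow Q') :
  \sum_b lquot b' (phi (word [:: b])) * phi (lquot b (psi (word [:: b'']))) =
  if b' == b'' then idem (tgt b'') else 0.
Proof.
case: iso => h1 h2 K1 K2.
transitivity (lquot b' (word [:: b''] : cpa K Q')); last first.
  by rewrite lquot_arrow; case: (b' =P b'') => [->|].
rewrite -[word [:: b''] in RHS]K2 [psi _ in RHS]lquot_expansion1; last first.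
  exact: (hom_arrow_mpow h2).
rewrite (hom_sum h1) lquot_sum; apply: eq_bigr => a _.
by rewrite (homM h1) lquot_mpow1M //; apply: (hom_arrow_mpow h1).
Qed.

End Isomorphism.

End Quotients.

Section BracketMore.
Context {V : finType} {K : fieldType}.
Variables (k : V) (X : qp V K).
Local Notation Qm := (premut_quiver k X).
Local Notation free := (all (@unstarred _ _ k X)).

Lemma bracketM_off x y : ends_off k x ->
  bracket k (x * y) = bracket k x * bracket k y :> cpa K Qm.
Proof.
move=> hx; have {}hx v s : walk_end v s = k -> wcoef x v s = 0.
  move=> e; have := congr1 (fun z => wcoef z v s) hx.
  by rewrite wcoef_Midem e eqxx wcoef0.
apply: cpaP => v w hv; rewrite wcoef_bracket [RHS]wcoefM.
case: ifP => [hw|nw]; last first.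
  rewrite big1 // => i _; rewrite !wcoef_bracket.
  move: nw; rewrite -{1}(cat_take_drop i w) all_cat.
  by case: (all _ (take i w)) => /= [->|_]; rewrite ?mulr0 ?mul0r.
rewrite wcoefM (sum_cuts (F := fun s t => wcoef x v s * wcoef y (walk_end v s) t)) //.
  apply: eq_bigr => i _; rewrite !wcoef_bracket.
  move: hw; rewrite -{1}(cat_take_drop i w) all_cat => /andP[h1 h2].
  by rewrite h1 h2 walk_end_expands.
move=> s b t hb; have [h|nw] := boolP (is_walk (walk_end v s) (b :: t)).
  by move: h => /= /andP[/eqP e _]; rewrite hx ?mul0r // -e.
by rewrite [X in _ * X]wcoef_nwalk ?mulr0.
Qed.

Lemma bracket1 : bracket k 1 = 1 :> cpa K Qm.
Proof.
rewrite -!cst_sum_idem (lc_sum _ _ _ (bracket_lin_cont k X)).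
by apply: eq_bigr => v _; apply: bracket_idem.
Qed.

Lemma corner_ends_off (x : cpa K X) i j : corner i j x -> j <> k -> ends_off k x.
Proof.
move=> [_ <-] ne; rewrite /ends_off -mulrA; have -> : idem j * idem k = 0 :> cpa K X.
  by apply: cpaP => v s _; rewrite wcoef_idemM wcoef_idem wcoef0; case: eqP => // ->; case: eqP.
by rewrite mulr0.
Qed.

Lemma corner_starts_off (x : cpa K X) i j : corner i j x -> i <> k -> starts_off k x.
Proof.
move=> [<- _] ne; rewrite /starts_off mulrA; have -> : idem k * idem i = 0 :> cpa K X.
  apply: cpaP => v s _; rewrite wcoef_idemM wcoef_idem wcoef0.
  by case: (v =P k) => // ->; case: eqP => // e; case: ne.
by rewrite mul0r.
Qed.

(** Set to 0 on the arrows not incident to [k], so that it is defined on all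
    arrows. *)
Definition star (c : arrow X) : cpa K Qm :=
  if insub c is Some c' then @word V K Qm [:: inr c'] else 0.

Lemma star_val (c : star_arrow k X) : star (val c) = @word V K Qm [:: inr c].
Proof. by rewrite /star valK. Qed.

Lemma corner_star c : corner (tgt c) (src c) (star c).
Proof.
rewrite /star; case: insubP => [c' _ <-|_]; last exact: corner0.
exact: (@corner_arrow _ _ Qm (inr c')).
Qed.

Lemma mpow_star c : mpow 1 (star c).
Proof. by rewrite /star; case: insubP => [c' _ _|_]; [apply: mpow_arrow | apply: mpow0]. Qed.

Lemma bracket_kept (c : kept_arrow k X) :
  bracket k (word [:: val c]) = @word V K Qm [:: inl (inl c)].
Proof. exact: (@bracket_word _ _ k X [:: inl (inl c)]). Qed.

Lemma bracket_comp (ab : comp_arrow k X) :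
  bracket k (word [:: (val ab).1; (val ab).2]) = @word V K Qm [:: inl (inr ab)].
Proof. exact: (@bracket_word _ _ k X [:: inl (inr ab)]). Qed.

(** The new triangles as a double sum over arrows, which separates the two
    sides of [k]. *)
Lemma triangles_atE : triangles_at k X =
  \sum_(a | tgt a == k) \sum_(b | src b == k)
    bracket k (word [:: a; b]) * star b * star a.
Proof.
rewrite pair_big /=.
pose F (ab : arrow X * arrow X) : cpa K Qm := bracket k (word [:: ab.1; ab.2]) * star ab.2 * star ab.1.
rewrite -[RHS]/(\sum_(ab : arrow X * arrow X | (tgt ab.1 == k) && (src ab.2 == k)) F ab).
rewrite (big_sub [pred ab | (tgt ab.1 == k) && (src ab.2 == k)]).
apply: eq_bigr => ab _; rewrite /F bracket_comp.
rewrite -[(val ab).2]/(val (exist _ (val ab).2 (comp_star2 ab) : star_arrow k X)) star_val.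
rewrite -[(val ab).1]/(val (exist _ (val ab).1 (comp_star1 ab) : star_arrow k X)) star_val.
by rewrite !word_cat.
Qed.

End BracketMore.
Arguments star {V K} k {X} c.

(** * The homomorphism induced between premutations *)

Lemma word_nil (V : finType) (K : fieldType) (Q : quiver V) : word [::] = 1 :> cpa K Q.
Proof. by apply: cpaP => v s w; rewrite wcoef_word w wcoef1 /nilp size_eq0. Qed.

Section PremutationFunctor.
Context {V : finType} {K : fieldType}.
Variables (k : V).

Section OneDirection.
Variables (X X' : qp V K).
Hypothesis no_loop : forall a : arrow X, src a = k -> tgt a <> k.
Hypothesis no_loop' : forall a : arrow X', src a = k -> tgt a <> k.
Variables (phi : cpa K X -> cpa K X') (psi : cpa K X' -> cpa K X).
Hypothesis iso : alg_iso phi psi.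
Local Notation Qm := (premut_quiver k X).
Local Notation Qm' := (premut_quiver k X').
Local Notation free := (all (@unstarred _ _ k X)).

(** If [phi] describes the arrows into [k] by a matrix acting from one side, then
    the reversed arrows have to transform by the inverse matrix acting from the
    other side; that matrix consists of the quotients of [psi]. *)
Definition in_star (a : arrow X) : cpa K Qm' :=
  \sum_(a' | tgt a' == k) star k a' * bracket k (phi (rquot a (psi (word [:: a'])))).

Definition out_star (b : arrow X) : cpa K Qm' :=
  \sum_(b' | src b' == k) bracket k (phi (lquot b (psi (word [:: b'])))) * star k b'.

(** The homomorphism between premutations induced by [phi]: inside the brackets it
    is [phi], and on the reversed arrows it is given by the inverse Jacobian
    matrices. *)
Definition premut_image (c : arrow Qm) : cpa K Qm' :=
  match c with
  | inl c' => bracket k (phi (word (expand (inl c'))))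
  | inr c' => if tgt (val c') == k then in_star (val c') else out_star (val c')
  end.

Lemma premut_image_mpow c : mpow 1 (premut_image c).
Proof.
case: iso => h1 h2 _ _; case: c => [c|c] /=.
  apply: bracket_mpow1; apply: (hom_mpow h1); apply: mpow_word.
  by case: c.
case: ifP => _; apply: mpow_sum => b _.
  by apply: (mpowMr _ (leqnn 1)); apply: mpow_star.
by apply: (mpowMl _ (leqnn 1)); apply: mpow_star.
Qed.

Lemma premut_image_corner c : corner (src c) (tgt c) (premut_image c).
Proof.
case: iso => h1 h2 _ _; case: c => [[c|ab]|c] /=.
- by apply: bracket_corner; apply: (corner_hom h1); apply: corner_arrow.
- apply: bracket_corner; apply: (corner_hom h1).
  by rewrite -[[:: _; _]]/([:: _] ++ [:: _]) -word_cat; apply: cornerM; apply: corner_arrow.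
case: ifP => tc; apply: corner_sum => b /eqP hb.
  rewrite (eqP tc) -[in X in corner X]hb; apply: cornerM; first exact: corner_star.
  apply: bracket_corner; apply: (corner_hom h1); apply: corner_rquot.
  by apply: (corner_hom h2); apply: corner_arrow.
have /eqP sc : src (val c) == k by have := valP c; rewrite tc orbF.
rewrite sc -[in X in corner _ X]hb; apply: cornerM; last exact: corner_star.
apply: bracket_corner; apply: (corner_hom h1); apply: corner_lquot.
by apply: (corner_hom h2); apply: corner_arrow.
Qed.

Section Hat.
Variable hat : cpa K Qm -> cpa K Qm'.
Hypothesis hat_hom : alg_hom hat.
Hypothesis hat_arrow : forall c, hat (word [:: c]) = premut_image c.

Lemma hat_free_word w : free w -> hat (word w) = bracket k (phi (word (expands w))).
Proof.
case: iso => h1 h2 _ _; elim: w => [_|c w IH /= /andP[hc hw]].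
  by rewrite [expands [::]]/= !word_nil (hom1 hat_hom) (hom1 h1) bracket1.
rewrite -[c :: w]/([:: c] ++ w) -word_cat (homM hat_hom) hat_arrow IH //.
rewrite expands_cat -word_cat (homM h1) bracketM_off.
  by case: c hc => // c _; rewrite [expands [:: _]]cats0.
have [i [j [hij ne]]] : exists i j, corner i j (word (expands [:: c]) : cpa K X) /\ j <> k.
  case: c hc => [[c|ab]|//] _; rewrite /expands /=.
    exists (src (val c)), (tgt (val c)); split; first exact: corner_arrow.
    by case/andP: (valP c) => _ /eqP.
  exists (src (val ab).1), (tgt (val ab).2); split.
    by rewrite -[[:: _; _]]/([:: _] ++ [:: _]) -word_cat; apply: cornerM; apply: corner_arrow.
  by apply: no_loop; case/andP: (valP ab) => _ /eqP.
by apply: (corner_ends_off (corner_hom h1 hij)).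
Qed.

(** Both sides are multiplicative along products that are cut away from [k], and
    each path that neither starts nor ends at [k] is a product of kept and
    composite arrows. *)
Lemma hat_bracket x : starts_off k x -> ends_off k x ->
  hat (bracket k x) = bracket k (phi x).
Proof.
case: iso => h1 h2 _ _ hs he.
apply: (@lin_cont_ext _ _ _ _ (hat \o bracket k) (bracket k \o phi)).
- by apply: lin_cont_comp (lin_cont_hom hat_hom); apply: bracket_lin_cont.
- by apply: lin_cont_comp (bracket_lin_cont k X'); apply: lin_cont_hom.
- by move=> v _ /=; rewrite bracket_idem (hom_idem hat_hom) (hom_idem h1) bracket_idem.
move=> a s nz /=.
have w : is_walk (src a) (a :: s) by apply: contraNT nz => nw; rewrite wcoef_nwalk.
have na : src a != k.
  by apply: contraNneq nz => e; rewrite e; move/starts_offP: hs => ->.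
have ne : walk_end (src a) (a :: s) != k.
  apply: contraNneq nz => e; have := congr1 (fun z => wcoef z (src a) (a :: s)) he.
  by rewrite wcoef_Midem e eqxx wcoef0 => ->.
have [t ht ->] := expands_surj no_loop w na ne.
by rewrite bracket_word // hat_free_word.
Qed.

Lemma hat_star_in a : tgt a = k -> hat (star k a) = in_star a.
Proof.
move=> ta; have ha : (src a == k) || (tgt a == k) by rewrite ta eqxx orbT.
have -> : star k a = @word V K Qm [:: inr (exist _ a ha : star_arrow k X)].
  by rewrite -star_val.
by rewrite hat_arrow /= ta eqxx.
Qed.

Lemma hat_star_out b : src b = k -> hat (star k b) = out_star b.
Proof.
move=> sb; have hb : (src b == k) || (tgt b == k) by rewrite sb eqxx.
have -> : star k b = @word V K Qm [:: inr (exist _ b hb : star_arrow k X)].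
  by rewrite -star_val.
by rewrite hat_arrow /=; case: eqP => // /(no_loop sb).
Qed.

End Hat.
End OneDirection.

Lemma star_idem (X : qp V K) (a : arrow X) : star k a * idem (src a) = star k a.
Proof. by case: (corner_star k a). Qed.

Lemma idem_star (X : qp V K) (a : arrow X) : idem (tgt a) * star k a = star k a.
Proof. by case: (corner_star k a). Qed.

End PremutationFunctor.

(** * Premutation respects right equivalence *)

(** Cancelling a matrix [v] with its inverse [l] between two summations over
    arrows. *)
Lemma sum_inverse_matrix (A : pzRingType) (I J : finType) (P : pred I) (P' : pred J)
    (M : J -> A) (l : J -> I -> A) (v : I -> J -> A) (e s : J -> A) :
  (forall j j', P' j -> P' j' ->
     \sum_(i | P i) l j i * v i j' = if j == j' then e j' else 0) ->
  (forall j, P' j -> e j * s j = s j) ->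
  \sum_(i | P i) (\sum_(j | P' j) M j * l j i) * (\sum_(j | P' j) v i j * s j) =
  \sum_(j | P' j) M j * s j.
Proof.
move=> hlv hes.
transitivity (\sum_(j | P' j) \sum_(j' | P' j')
    M j * (\sum_(i | P i) l j i * v i j') * s j').
  under eq_bigr => i _ do rewrite mulr_suml.
  rewrite exchange_big; apply: eq_bigr => j _.
  under eq_bigr => i _ do rewrite mulr_sumr.
  rewrite exchange_big; apply: eq_bigr => j' _.
  by rewrite mulr_sumr mulr_suml; apply: eq_bigr => i _; rewrite !mulrA.
apply: eq_bigr => j hj; rewrite (bigD1 j) //= hlv // eqxx -mulrA hes //.
rewrite [X in _ + X]big1 ?addr0 // => j' hj'; have [hj'1 ne] := andP hj'.
by rewrite hlv // eq_sym (negPf ne) mulr0 mul0r.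
Qed.

Section MoreQuotients.
Context {V : finType} {K : fieldType}.
Variable (Q : quiver V).

Lemma rquot_off a (x : cpa K Q) i j : corner i j x -> tgt a != j -> rquot a x = 0.
Proof.
move=> /cornerP h ne; apply: cpaP => v s _; rewrite wcoef_rquot wcoef0.
have [w|nw] := boolP (is_walk v (rcons s a)); last by rewrite wcoef_nwalk.
apply/eqP; case: eqP => // /eqP /(h _ _ w)[_].
by rewrite /walk_end map_rcons last_rcons => e; rewrite e eqxx in ne.
Qed.

Lemma lquot_off a (x : cpa K Q) i j : corner i j x -> src a != i -> lquot a x = 0.
Proof.
move=> /cornerP h ne; apply: cpaP => v s _; rewrite wcoef_lquot wcoef0.
case: eqP => // _.
have [w|nw] := boolP (is_walk (src a) (a :: s)); last by rewrite wcoef_nwalk.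
apply/eqP; case: eqP => // /eqP /(h _ _ w)[e _].
by rewrite e eqxx in ne.
Qed.

End MoreQuotients.

Section PremutationIso.
Context {V : finType} {K : fieldType}.
Variables (k : V).

Lemma alg_iso_sym (Q Q' : quiver V) (phi : cpa K Q -> cpa K Q') psi :
  alg_iso phi psi -> alg_iso psi phi.
Proof. by case. Qed.

Lemma star_inE (X : qp V K) (c : star_arrow k X) : tgt (val c) = k \/
  (tgt (val c) <> k /\ src (val c) = k).
Proof.
case: (eqVneq (tgt (val c)) k) => [|/eqP ne]; first by left.
by right; split=> //; case/orP: (valP c) => /eqP.
Qed.

Lemma off_src (X : qp V K) : (forall a : arrow X, src a = k -> tgt a <> k) ->
  forall a : arrow X, tgt a = k -> src a <> k.
Proof. by move=> noX a e e'; apply: noX e' e. Qed.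

Section InverseMatrices.
Variables (X X' : qp V K).
Hypothesis no_loop : forall a : arrow X, src a = k -> tgt a <> k.
Variables (phi : cpa K X -> cpa K X') (psi : cpa K X' -> cpa K X).
Hypothesis iso : alg_iso phi psi.

Lemma bracket_rquot_inverse (a' a'' : arrow X') : tgt a'' = k ->
  \sum_(a | tgt a == k) bracket k (phi (rquot a (psi (word [:: a''])))) *
     bracket k (rquot a' (phi (word [:: a]))) =
  if a' == a'' then idem (src a'') else 0.
Proof.
case: (iso) => h1 h2 _ _ ta.
have hc a : corner (src a'') (src a) (phi (rquot a (psi (word [:: a''])))).
  apply: (corner_hom h1); apply: corner_rquot; apply: (corner_hom h2).
  exact: corner_arrow.
under eq_bigr => a /eqP hta.
  rewrite -bracketM_off; last by apply: corner_ends_off (hc a) _; apply: off_src hta.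
  over.
rewrite -(lc_sum _ _ _ (bracket_lin_cont k X')).
rewrite (_ : \sum_(a | _) _ = if a' == a'' then idem (src a'') else 0).
  by case: ifP => _; rewrite ?bracket_idem ?(lc0 (bracket_lin_cont k X')).
rewrite -(rquot_inverse iso) big_mkcond; apply: eq_bigr => a _.
case: ifP => // /negbT hta.
rewrite (@rquot_off _ _ _ a _ (src a'') k) ?(hom0 h1) ?mul0r //.
by rewrite -ta; apply: (corner_hom h2); apply: corner_arrow.
Qed.

Lemma bracket_lquot_inverse (b' b'' : arrow X') : src b'' = k ->
  \sum_(b | src b == k) bracket k (lquot b' (phi (word [:: b]))) *
     bracket k (phi (lquot b (psi (word [:: b''])))) =
  if b' == b'' then idem (tgt b'') else 0.
Proof.
case: (iso) => h1 h2 _ _ sb.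
have hc b : corner (tgt b') (tgt b) (lquot b' (phi (word [:: b]))).
  by apply: corner_lquot; apply: (corner_hom h1); apply: corner_arrow.
under eq_bigr => b /eqP hsb.
  rewrite -bracketM_off; last by apply: corner_ends_off (hc b) _; apply: no_loop.
  over.
rewrite -(lc_sum _ _ _ (bracket_lin_cont k X')).
rewrite (_ : \sum_(b | _) _ = if b' == b'' then idem (tgt b'') else 0).
  by case: ifP => _; rewrite ?bracket_idem ?(lc0 (bracket_lin_cont k X')).
rewrite -(lquot_inverse iso) big_mkcond; apply: eq_bigr => b _.
case: ifP => // /negbT hsb.
rewrite (@lquot_off _ _ _ b _ k (tgt b'')) ?(hom0 h1) ?mulr0 //.
by rewrite -sb; apply: (corner_hom h2); apply: corner_arrow.
Qed.

End InverseMatrices.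

Section Inverse.
Variables (X X' : qp V K).
Hypothesis no_loop : forall a : arrow X, src a = k -> tgt a <> k.
Hypothesis no_loop' : forall a : arrow X', src a = k -> tgt a <> k.
Variables (phi : cpa K X -> cpa K X') (psi : cpa K X' -> cpa K X).
Hypothesis iso : alg_iso phi psi.
Variables (hat : cpa K (premut_quiver k X) -> cpa K (premut_quiver k X'))
          (hat' : cpa K (premut_quiver k X') -> cpa K (premut_quiver k X)).
Hypothesis hat_hom : alg_hom hat.
Hypothesis hat_arrow : forall c, hat (word [:: c]) = premut_image phi psi c.
Hypothesis hat'_hom : alg_hom hat'.
Hypothesis hat'_arrow : forall c, hat' (word [:: c]) = premut_image psi phi c.

Lemma hat'_bracket_corner x i j : corner i j x -> i <> k -> j <> k ->
  hat' (bracket k (phi x)) = bracket k x.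
Proof.
case: iso => h1 h2 K1 K2 hx ni nj; have hx' := corner_hom h1 hx.
rewrite (hat_bracket no_loop' (alg_iso_sym iso) hat'_hom hat'_arrow) ?K1 //.
  exact: corner_starts_off hx' ni.
exact: corner_ends_off hx' nj.
Qed.

(** On kept and composite arrows this is [psi (phi x) = x]; on reversed arrows it
    is the statement that the Jacobian matrices are inverse to each other. *)
Lemma hat'_hat : cancel hat hat'.
Proof.
case: (iso) => h1 h2 K1 K2.
apply: (@alg_hom_ext _ _ _ _ (hat' \o hat) id) => //.
  exact: alg_hom_comp.
move=> c /=; rewrite hat_arrow; case: c => [[c|ab]|c] /=.
- rewrite (hat'_bracket_corner (corner_arrow _)) ?bracket_kept //.
    by case/andP: (valP c) => /eqP.
  by case/andP: (valP c) => _ /eqP.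
- rewrite -bracket_comp; have /andP[/eqP e1 /eqP e2] := valP ab.
  apply: (@hat'_bracket_corner _ (src (val ab).1) (tgt (val ab).2)).
  + by rewrite -[[:: _; _]]/([:: _] ++ [:: _]) -word_cat; apply: cornerM; apply: corner_arrow.
  + exact: (off_src no_loop e1).
  exact: no_loop.
rewrite -star_val; set a := val c; have [ta|[/eqP/negPf ta sa]] := star_inE c.
  rewrite /a ta eqxx -/a (hom_sum hat'_hom).
  pose u a' := bracket k (rquot a (psi (word [:: a']))).
  transitivity (\sum_(a' | tgt a' == k) (\sum_(a'' | tgt a'' == k)
       star k a'' * bracket k (psi (rquot a' (phi (word [:: a'']))))) * u a').
    apply: eq_bigr => a' /eqP ta'; rewrite (homM hat'_hom).
    rewrite (hat_star_in hat'_arrow ta'); congr (_ * _).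
    have hc : corner (src a') (src a) (rquot a (psi (word [:: a']))).
      by apply: corner_rquot; apply: (corner_hom h2); apply: corner_arrow.
    rewrite (hat'_bracket_corner hc) //; first exact: (off_src no_loop' ta').
    exact: (off_src no_loop ta).
  under eq_bigr => a' _ do rewrite mulr_suml.
  rewrite exchange_big (bigD1 a) ?ta //=.
  have E a'' : tgt a'' = k -> \sum_(a' | tgt a' == k)
      star k a'' * bracket k (psi (rquot a' (phi (word [:: a''])))) * u a' =
      if a == a'' then star k a else 0.
    move=> ta''; under eq_bigr do rewrite -mulrA.
    rewrite -mulr_sumr (bracket_rquot_inverse no_loop' (alg_iso_sym iso)) //.
    by case: (a =P a'') => [->|_]; rewrite ?mulr0 // star_idem.
  rewrite (E a ta) eqxx [X in _ + X]big1 ?addr0 // => a'' hne.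
  have [/eqP ta'' ne] := andP hne.
  by rewrite E // eq_sym (negPf ne).
rewrite /a ta -/a (hom_sum hat'_hom).
pose v b' := bracket k (lquot a (psi (word [:: b']))).
transitivity (\sum_(b' | src b' == k) v b' * (\sum_(b'' | src b'' == k)
     bracket k (psi (lquot b' (phi (word [:: b''])))) * star k b'')).
  apply: eq_bigr => b' /eqP sb'; rewrite (homM hat'_hom).
  rewrite (hat_star_out no_loop' hat'_arrow sb'); congr (_ * _).
  have hc : corner (tgt a) (tgt b') (lquot a (psi (word [:: b']))).
    by apply: corner_lquot; apply: (corner_hom h2); apply: corner_arrow.
  by rewrite (hat'_bracket_corner hc) //; [exact: no_loop | exact: no_loop'].
under eq_bigr => b' _ do rewrite mulr_sumr.
rewrite exchange_big (bigD1 a) ?sa ?eqxx //=.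
have E b'' : src b'' = k -> \sum_(b' | src b' == k)
    v b' * (bracket k (psi (lquot b' (phi (word [:: b''])))) * star k b'') =
    if a == b'' then star k a else 0.
  move=> sb''; under eq_bigr do rewrite mulrA.
  rewrite -mulr_suml (bracket_lquot_inverse no_loop' (alg_iso_sym iso)) //.
  by case: (a =P b'') => [->|_]; rewrite ?mul0r // idem_star.
rewrite (E a sa) eqxx [X in _ + X]big1 ?addr0 // => b'' hne.
have [/eqP sb'' ne] := andP hne.
by rewrite E // eq_sym (negPf ne).
Qed.

(** Writing [phi] of the arrows into and out of [k] through their Jacobian
    matrices, these cancel against the matrices of the reversed arrows: those of
    the outgoing arrows directly, those of the incoming arrows after a rotation. *)
Lemma cyc_hat_triangles : cyc (hat (triangles_at k X)) = cyc (triangles_at k X').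
Proof.
case: (iso) => h1 h2 K1 K2.
pose r a' a := bracket k (rquot a' (phi (word [:: a]))).
pose l b' b := bracket k (lquot b' (phi (word [:: b]))).
pose u a a'' := bracket k (phi (rquot a (psi (word [:: a''])))).
pose v b b'' := bracket k (phi (lquot b (psi (word [:: b''])))).
pose m a' b' : cpa K (premut_quiver k X') := bracket k (word [:: a'; b']).
pose N a' := \sum_(b' | src b' == k) m a' b' * star k b'.
have brE a b : tgt a = k -> src b = k -> bracket k (phi (word [:: a; b])) =
    \sum_(b' | src b' == k) (\sum_(a' | tgt a' == k) r a' a * m a' b') * l b' b.
  move=> ta sb; rewrite -[[:: a; b]]/([:: a] ++ [:: b]) -word_cat (homM h1).
  have ca : corner (src a) k (phi (word [:: a])).
    by rewrite -ta; apply: (corner_hom h1); apply: corner_arrow.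
  have cb : corner k (tgt b) (phi (word [:: b])).
    by rewrite -sb; apply: (corner_hom h1); apply: corner_arrow.
  rewrite [phi (word [:: a])]rquot_expansion; last exact: (hom_arrow_mpow h1).
  rewrite [phi (word [:: b])]lquot_expansion1; last exact: (hom_arrow_mpow h1).
  rewrite (bigID (fun a' => tgt a' == k)) /= [X in _ + X]big1 ?addr0; last first.
    by move=> a' ne; rewrite (rquot_off ca ne) mul0r.
  rewrite [X in _ * X](bigID (fun b' => src b' == k)) /= [X in _ * (_ + X)]big1 ?addr0; last first.
    by move=> b' ne; rewrite (lquot_off cb ne) mulr0.
  rewrite mulr_sumr (lc_sum _ _ _ (bracket_lin_cont k X')); apply: eq_bigr => b' /eqP sb'.
  rewrite mulrA bracketM_off; last first.
    apply: (@corner_ends_off _ _ _ _ _ (src a) (tgt b')); last exact: no_loop'.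
    apply: (cornerM (j := k) _ (corner_arrow _)); apply: corner_sum => a' /eqP ta'.
    rewrite -[in X in corner _ X]ta'.
    exact: (cornerM (corner_rquot a' ca) (corner_arrow a')).
  congr (_ * _); rewrite mulr_suml (lc_sum _ _ _ (bracket_lin_cont k X')).
  apply: eq_bigr => a' /eqP ta'; rewrite -mulrA bracketM_off ?word_cat //.
  apply: (@corner_ends_off _ _ _ _ _ (src a) (src a')); last exact: off_src ta'.
  exact: corner_rquot ca.
rewrite triangles_atE (hom_sum hat_hom).
transitivity (cyc (\sum_(a | tgt a == k) (\sum_(a' | tgt a' == k) r a' a * N a') *
    (\sum_(a'' | tgt a'' == k) star k a'' * u a a''))).
  congr cyc; apply: eq_bigr => a /eqP ta; rewrite (hom_sum hat_hom).
  transitivity ((\sum_(b | src b == k) bracket k (phi (word [:: a; b])) * out_star phi psi b) * in_star phi psi a).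
    rewrite mulr_suml; apply: eq_bigr => b /eqP sb.
    rewrite !(homM hat_hom) (hat_star_in hat_arrow ta) (hat_star_out no_loop hat_arrow sb).
    congr (_ * _ * _).
    have hc : corner (src a) (tgt b) (word [:: a; b] : cpa K X).
      by rewrite -[[:: a; b]]/([:: a] ++ [:: b]) -word_cat; apply: cornerM; apply: corner_arrow.
    apply: (hat_bracket no_loop iso hat_hom hat_arrow).
      by apply: corner_starts_off hc _; apply: off_src ta.
    by apply: corner_ends_off hc _; apply: no_loop.
  congr (_ * _).
  under eq_bigr => b /eqP sb do rewrite (brE a b ta sb).
  rewrite (@sum_inverse_matrix _ _ _ _ (fun b' => src b' == k) _ _ _ (fun b' => idem (tgt b'))).
  - rewrite (eq_bigr (fun b' => \sum_(a' | tgt a' == k) r a' a * (m a' b' * star k b'))).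
      rewrite exchange_big; apply: eq_bigr => a' _.
      by rewrite /N mulr_sumr.
    by move=> b' _; rewrite mulr_suml; apply: eq_bigr => a' _; rewrite mulrA.
  - by move=> b' b'' _ /eqP sb''; apply: (bracket_lquot_inverse no_loop iso).
  by move=> b' _; apply: idem_star.
transitivity (cyc (\sum_(a | tgt a == k) (\sum_(a'' | tgt a'' == k) star k a'' * u a a'') *
    (\sum_(a' | tgt a' == k) r a' a * N a'))).
  by apply: potentialP => c; rewrite !cyc_sum; apply: eq_bigr => a _; rewrite cyc_mulC.
rewrite (@sum_inverse_matrix _ _ _ _ (fun a' => tgt a' == k) _ _ _ (fun a' => idem (src a'))); first last.
- move=> a' /eqP ta'; rewrite /N mulr_sumr; apply: eq_bigr => b' /eqP sb'; rewrite mulrA.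
  congr (_ * _); have [] : corner (src a') (tgt b') (m a' b'); last by [].
  apply: bracket_corner; rewrite -[[:: a'; b']]/([:: a'] ++ [:: b']) -word_cat.
  by apply: cornerM; apply: corner_arrow.
- move=> a' a'' /eqP ta' _; rewrite eq_sym.
  rewrite (bracket_rquot_inverse no_loop iso _ ta').
  by case: (a'' =P a') => [->|].
rewrite triangles_atE; apply: potentialP => c; rewrite !cyc_sum; apply: eq_bigr => a _.
by rewrite cyc_mulC /N mulr_suml.
Qed.

End Inverse.

Lemma hat_exists (X X' : qp V K) (phi : cpa K X -> cpa K X') psi :
  alg_iso phi psi -> (forall a : arrow X', src a = k -> tgt a <> k) ->
  exists2 hat : cpa K (premut_quiver k X) -> cpa K (premut_quiver k X'), alg_hom hat &
  forall c, hat (word [:: c]) = premut_image phi psi c.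
Proof.
move=> iso noX'; apply: hom_of_arrows => c; first exact: premut_image_mpow.
exact: premut_image_corner.
Qed.

(** Premutation is functorial for isomorphisms that respect the potentials. *)
Theorem premutation_right_equivalent (X X' : qp V K) :
  (forall a : arrow X, src a = k -> tgt a <> k) ->
  (forall a : arrow X', src a = k -> tgt a <> k) ->
  right_equivalent X X' -> right_equivalent (premutation k X) (premutation k X').
Proof.
move=> noX noX' /right_equivalentP[phi [psi [iso hW]]].
have [hat hh hE] := hat_exists iso noX'.
have [hat' hh' hE'] := hat_exists (alg_iso_sym iso) noX.
have [h1 h2 K1 K2] := iso.
apply/right_equivalentP; exists hat, hat'; split.
  split=> //.
    exact: (hat'_hat noX noX' iso hh hE hh' hE').
  exact: (hat'_hat noX' noX (alg_iso_sym iso) hh' hE' hh hE).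
move=> x ex; have [y [ey y1 y2]] := off_lift noX.
have y1' : starts_off k (phi y) by rewrite /starts_off -(hom_idem h1) -(homM h1) y1 (hom0 h1).
rewrite (premutation_pot noX' (hW y ey) y1').
rewrite (hom_cyc (y := bracket k y + triangles_at k X) hh); last first.
  by rewrite ex -premutation_pot.
apply: potentialP => c; rewrite (homD hh) !cycD (cyc_hat_triangles noX noX' iso hh hE).
by rewrite (hat_bracket noX iso hh hE).
Qed.

End PremutationIso.

(** * Linear parts and direct sums *)

Section LinearParts.
Context {V : finType} {K : fieldType}.
Implicit Types Q : quiver V.

Definition acoef Q (x : cpa K Q) (a : arrow Q) : K := wcoef x (src a) [:: a].

(** Modulo the square of the arrow ideal, an element without constant part is
    the combination of arrows given by [acoef]. *)
Lemma mpow2P Q (x : cpa K Q) : mpow 1 x -> (forall a, acoef x a = 0) -> mpow 2 x.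
Proof.
move=> h1 ha v [|a [|b s]] // lt_s; first exact: h1.
have [w|nw] := boolP (is_walk v [:: a]); last by rewrite wcoef_nwalk.
by move: w => /= /andP[/eqP <- _]; apply: ha.
Qed.

Lemma acoefD Q (x y : cpa K Q) a : acoef (x + y) a = acoef x a + acoef y a.
Proof. exact: wcoefD. Qed.

Lemma acoefB Q (x y : cpa K Q) a : acoef (x - y) a = acoef x a - acoef y a.
Proof. exact: wcoefB. Qed.

Lemma acoefZ Q c (x : cpa K Q) a : acoef (c *: x) a = c * acoef x a.
Proof. exact: wcoefZ. Qed.

Lemma acoef_sum Q I (r : seq I) P (F : I -> cpa K Q) a :
  acoef (\sum_(i <- r | P i) F i) a = \sum_(i <- r | P i) acoef (F i) a.
Proof. exact: wcoef_sum. Qed.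

Lemma acoef_arrow Q (a b : arrow Q) : acoef (word [:: b]) a = (a == b)%:R.
Proof. by rewrite /acoef wcoef_word eqseq_cons !eqxx /= eqxx !andbT. Qed.

Lemma mpow2_acoef Q (x : cpa K Q) a : mpow 2 x -> acoef x a = 0.
Proof. by apply. Qed.

Definition lin Q (x : cpa K Q) : cpa K Q := \sum_a acoef x a *: word [:: a].

Lemma acoef_lin Q (x : cpa K Q) a : acoef (lin x) a = acoef x a.
Proof.
rewrite acoef_sum (bigD1 a) //= big1 => [|b ne].
  by rewrite acoefZ acoef_arrow eqxx mulr1 addr0.
by rewrite acoefZ acoef_arrow eq_sym (negPf ne) mulr0.
Qed.

Lemma mpow_lin Q (x : cpa K Q) : mpow 1 (lin x).
Proof. by apply: mpow_sum => a _; apply: mpowZ; apply: mpow_arrow. Qed.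

Lemma sub_lin Q (x : cpa K Q) : mpow 1 x -> mpow 2 (x - lin x).
Proof.
move=> h; apply: mpow2P; first by apply: mpowB => //; apply: mpow_lin.
by move=> a; rewrite acoefB acoef_lin subrr.
Qed.

Lemma corner_acoef Q (x : cpa K Q) i j a : corner i j x -> acoef x a != 0 ->
  src a = i /\ tgt a = j.
Proof. by move=> /cornerP h; apply: h; rewrite /= eqxx. Qed.

Lemma corner_lin Q (x : cpa K Q) i j : corner i j x -> corner i j (lin x).
Proof.
move=> h; apply: corner_sum => a _.
have [->|nz] := eqVneq (acoef x a) 0; first by rewrite scale0r; apply: corner0.
have [<- <-] := corner_acoef h nz; apply: cornerZ; exact: corner_arrow.
Qed.

Lemma wcoef_lin Q (x : cpa K Q) v s : size s != 1%N -> wcoef (lin x) v s = 0.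
Proof.
move=> ns; rewrite wcoef_sum big1 // => a _; rewrite wcoefZ wcoef_word.
by case: (s =P [:: a]) ns => [->|_] //; rewrite andbF mulr0.
Qed.

(** Modulo the square of the arrow ideal a homomorphism acts through its linear
    part. *)
Lemma hom_lin Q Q' (F : cpa K Q -> cpa K Q') x : alg_hom F -> mpow 1 x ->
  mpow 2 (F x - \sum_a acoef x a *: F (word [:: a])).
Proof.
move=> h hx; have := hom_mpow h (sub_lin hx); rewrite (homB h) /lin (hom_sum h).
by rewrite (eq_bigr (fun a => acoef x a *: F (word [:: a]))) // => a _; rewrite (homZ h).
Qed.

Lemma wcoefM2 Q (x y : cpa K Q) (u z : arrow Q) : mpow 1 x -> mpow 1 y ->
  tgt u = src z -> wcoef (x * y) (src u) [:: u; z] = acoef x u * acoef y z.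
Proof.
move=> hx hy e; rewrite wcoefM !big_ord_recl big_ord0 /= addr0.
by rewrite hx // mul0r add0r [X in _ + _ * X]hy // mulr0 addr0 /acoef -e.
Qed.

End LinearParts.

Section DirectSum.
Context {V : finType} {K : fieldType}.
Variables (T Z : qp V K).
Local Notation D := (sum_quiver T Z).

Lemma sum_embedding : exists2 inj : cpa K Z -> cpa K D, alg_hom inj &
  forall z, inj (word [:: z]) = @word V K D [:: inr z].
Proof.
apply: hom_of_arrows => z; first exact: mpow_arrow.
exact: (@corner_arrow _ _ D (inr z)).
Qed.

Lemma sum_projection : exists2 pr : cpa K D -> cpa K Z, alg_hom pr &
  forall a, pr (word [:: a]) = if a is inr z then word [:: z] else 0.
Proof.
apply: hom_of_arrows => -[t|z]; [exact: mpow0|exact: mpow_arrow|exact: corner0|].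
exact: corner_arrow.
Qed.

Variable inj : cpa K Z -> cpa K D.
Hypothesis inj_hom : alg_hom inj.
Hypothesis injE : forall z, inj (word [:: z]) = @word V K D [:: inr z].

Lemma wcoef_embedding x v (s : seq (arrow Z)) :
  wcoef (inj x) v (map inr s : seq (arrow D)) = wcoef x v s.
Proof.
elim: s x v => [|z s IH] x v; rewrite (hom_expansion inj_hom) wcoefD wcoef_cst wcoef_sum /=.
  by rewrite big1 ?addr0 // => a _; rewrite injE wcoef_arrowM_nil.
rewrite add0r (bigD1 z) //= big1 ?addr0 => [|a ne].
  rewrite injE wcoef_arrowM_cons eqxx /= IH wcoef_lquot eqxx.
  case: eqP => [-> //|ne]; rewrite wcoef_nwalk //=.
  by apply/negP => /andP[/eqP e _]; case: ne.
by rewrite injE wcoef_arrowM_cons eq_sym; case: eqP => // -[e]; rewrite e eqxx in ne.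
Qed.

Lemma wcoef_embedding_out x v (s : seq (arrow D)) :
  ~~ all (@right_arrow _ _ T Z) s -> wcoef (inj x) v s = 0.
Proof.
elim: s x v => [//|b s IH] x v hs; rewrite (hom_expansion inj_hom) wcoefD wcoef_cst wcoef_sum /=.
rewrite add0r big1 // => a _; rewrite injE wcoef_arrowM_cons.
case: eqP => //= e; case: ifP => // _; apply: IH.
by move: hs; rewrite e /=.
Qed.

Lemma all_right_map (s : seq (arrow D)) : all (@right_arrow _ _ T Z) s ->
  s = map inr (pmap (@right_arrow _ _ T Z) s).
Proof. by elim: s => [//|[t|z] s IH] //= /IH {1}->. Qed.

Lemma is_cycle_map_inr (s : seq (arrow Z)) :
  is_cycle (map inr s : seq (arrow D)) = is_cycle s.
Proof.
case: s => [//|z s]; rewrite /is_cycle /=.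
set p := path _ _ _; have -> // : p = path (fun a b => tgt a == src b) z (rcons s z).
by rewrite /p -[rcons _ (inr z)](map_rcons inr s z) path_map.
Qed.

Lemma rotations_map (A B : eqType) (f : A -> B) (s : seq A) :
  injective f -> rotations (map f s) = map (map f) (rotations s).
Proof.
move=> hf; rewrite /rotations size_map -undup_map_inj; last exact: inj_map.
by rewrite -map_comp; congr undup; apply: eq_map => i /=; rewrite map_rot.
Qed.

Lemma cyc_embedding x c : is_cycle c -> cyc (inj x) c =
  if all (@right_arrow _ _ T Z) c then cyc x (pmap (@right_arrow _ _ T Z) c) else 0.
Proof.
move=> cc; case: ifP => hc; last first.
  rewrite cycE cc big_seq big1 // => -[//|a d] /rotationsP[i _ e].
  rewrite word_coefE wcoef_embedding_out // e -(eq_all_r (s1 := c)) ?hc //.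
  by move=> ?; rewrite mem_rot.
rewrite {1}(all_right_map hc); rewrite (all_right_map hc) in cc; move: cc.
set s := pmap _ _; rewrite is_cycle_map_inr => cc.
rewrite !cycE is_cycle_map_inr cc rotations_map; last by move=> ? ? [].
rewrite big_map; apply: eq_bigr => -[//|z d] _; rewrite /= !word_coefE.
exact: (wcoef_embedding x _ (z :: d)).
Qed.

End DirectSum.

(** * Cancellation of the trivial part *)

Lemma is_cycle2 (V : finType) (Q : quiver V) (a b : arrow Q) :
  is_cycle [:: a; b] = (tgt a == src b) && (tgt b == src a).
Proof. by rewrite /is_cycle /= andbT. Qed.

Section Cancellation.
Context {V : finType} {K : fieldType}.
Variables (X T Z Y : qp V K) (I : finType).
Local Notation D := (qp_sum T Z).

Variables (c e : I -> arrow X) (y : arrow Y -> arrow X).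
(** Every arrow is a [c i], an [e i] or the image of a unique arrow of [Y]. *)
Variable (cl : arrow X -> I + I + arrow Y).
Hypothesis cl_c : forall i, cl (c i) = inl (inl i).
Hypothesis cl_e : forall i, cl (e i) = inl (inr i).
Hypothesis cl_inv : forall a, a = match cl a with
  inl (inl i) => c i | inl (inr i) => e i | inr j => y j end.
Hypothesis src_e : forall i, src (e i) = tgt (c i).
Hypothesis tgt_e : forall i, tgt (e i) = src (c i).
Hypothesis c_noloop : forall i, src (c i) <> tgt (c i).
Hypothesis src_y : forall j, src (y j) = src j.
Hypothesis tgt_y : forall j, tgt (y j) = tgt j.

Variable x : cpa K X.
Hypothesis x_quadratic : mpow 3 (x - \sum_i word [:: c i] * word [:: e i]).

Variable eps : I -> cpa K Y.
Hypothesis eps_mpow : forall i, mpow 2 (eps i).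
(** The potential does not see what is substituted for the [c i], so these values
    can be adapted to a given splitting. *)
Hypothesis family : forall eta : I -> cpa K Y,
  (forall i, mpow 1 (eta i)) ->
  (forall i, corner (src (c i)) (tgt (c i)) (eta i)) ->
  exists rho : cpa K X -> cpa K Y, [/\ alg_hom rho,
    forall i, rho (word [:: c i]) = eta i,
    forall i, rho (word [:: e i]) = eps i,
    forall j, rho (word [:: y j]) = word [:: j] &
    cyc (rho x) = qp_pot Y].

Hypothesis T_trivial : qp_trivial T.
Hypothesis Z_reduced : qp_reduced Z.
Variables (Phi : cpa K X -> cpa K D) (Theta : cpa K D -> cpa K X).
Hypothesis iso : alg_iso Phi Theta.
Hypothesis PhiW : cyc (Phi x) = qp_pot D.

Let hPhi : alg_hom Phi. Proof. by case: iso. Qed.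
Let hTheta : alg_hom Theta. Proof. by case: iso. Qed.
Let PhiK : cancel Phi Theta. Proof. by case: iso. Qed.
Let ThetaK : cancel Theta Phi. Proof. by case: iso. Qed.

Let pc i := Phi (word [:: c i]).
Let pe i := Phi (word [:: e i]).
Let lam i u := acoef (pc i) u.
Let mu i u := acoef (pe i) u.

Let pc_mpow i : mpow 1 (pc i). Proof. exact: hom_arrow_mpow. Qed.
Let pe_mpow i : mpow 1 (pe i). Proof. exact: hom_arrow_mpow. Qed.

Let lam_corner i u : lam i u != 0 -> src u = src (c i) /\ tgt u = tgt (c i).
Proof. by apply: corner_acoef; apply: (corner_hom hPhi); apply: corner_arrow. Qed.

Let mu_corner i u : mu i u != 0 -> src u = tgt (c i) /\ tgt u = src (c i).
Proof.
rewrite -src_e -tgt_e.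
by apply: corner_acoef; apply: (corner_hom hPhi); apply: corner_arrow.
Qed.

Lemma Phi_quadratic : mpow 3 (Phi x - \sum_i pc i * pe i).
Proof.
have := hom_mpow hPhi x_quadratic; rewrite (homB hPhi) (hom_sum hPhi).
by under eq_bigr do rewrite (homM hPhi).
Qed.

Lemma wcoef_quadratic (u z : arrow D) : tgt u = src z ->
  wcoef (Phi x) (src u) [:: u; z] = \sum_i lam i u * mu i z.
Proof.
move=> euz; have := Phi_quadratic (src u) (isT : (size [:: u; z] < 3)%N).
rewrite wcoefB => /eqP; rewrite subr_eq0 => /eqP ->.
by rewrite wcoef_sum; apply: eq_bigr => i _; rewrite wcoefM2.
Qed.

(** The quadratic part of the potential, transported to the splitting, as a
    symmetric form on arrows. *)
Definition quad (z u : arrow D) : K := \sum_i (lam i z * mu i u + mu i z * lam i u).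

Lemma quad_term0 i (z u : arrow D) :
  (z == u) || ~~ is_cycle [:: z; u] -> lam i z * mu i u = 0.
Proof.
move=> h; have [->|nz1] := eqVneq (lam i z) 0; first by rewrite mul0r.
have [->|nz2] := eqVneq (mu i u) 0; first by rewrite mulr0.
have [s1 t1] := lam_corner nz1; have [s2 t2] := mu_corner nz2.
case/orP: h => [/eqP ezu|]; last by rewrite is_cycle2 s1 t1 s2 t2 !eqxx.
by case: (@c_noloop i); rewrite -s1 -s2 ezu.
Qed.

Lemma is_cycle2C (z u : arrow D) : is_cycle [:: u; z] = is_cycle [:: z; u].
Proof. by rewrite !is_cycle2 andbC. Qed.

Lemma quad_pot (z u : arrow D) :
  quad z u = if z == u then 0 else qp_pot D [:: z; u].
Proof.
have [zu|ne] := eqVneq z u.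
  rewrite /quad big1 // => i _; rewrite zu quad_term0 ?eqxx // mulrC.
  by rewrite quad_term0 ?eqxx // addr0.
have [cc|nc] := boolP (is_cycle [:: z; u]); last first.
  rewrite pcoef_cycle // /quad big1 // => i _; rewrite quad_term0 ?nc ?orbT //.
  by rewrite mulrC quad_term0 ?addr0 // is_cycle2C nc orbT.
have /andP[/eqP e1 /eqP e2] : (tgt z == src u) && (tgt u == src z).
  by rewrite -is_cycle2.
rewrite -PhiW cycE cc.
have -> : rotations [:: z; u] = [:: [:: z; u]; [:: u; z]].
  by rewrite /rotations /= inE /rot /= eqseq_cons (negPf ne).
rewrite !big_cons big_nil addr0 !word_coefE !wcoef_quadratic // -big_split.
by apply: eq_bigr => i _; rewrite [mu i z * _]mulrC.
Qed.

Lemma pot_loop (z : arrow D) : qp_pot D [:: z; z] = 0.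
Proof.
have [cc|nc] := boolP (is_cycle [:: z; z]); last by rewrite pcoef_cycle.
rewrite -PhiW cycE cc.
have -> : rotations [:: z; z] = [:: [:: z; z]].
  by rewrite /rotations /= inE /rot /= eqxx.
have /andP[/eqP e1 _] : (tgt z == src z) && (tgt z == src z).
  by rewrite -is_cycle2.
rewrite big_seq1 word_coefE wcoef_quadratic // big1 // => i _.
by rewrite quad_term0 ?eqxx.
Qed.

Lemma potDE (s : seq (arrow D)) :
  qp_pot D s = if is_cycle s then @sum_coef V K T Z s else 0.
Proof. by []. Qed.

Lemma potD_right (z : arrow Z) (u : arrow D) : qp_pot D [:: (inr z : arrow D); u] = 0.
Proof.
rewrite potDE; case: ifP => // _.
by case: u => u; rewrite /sum_coef //=; apply: Z_reduced.
Qed.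

Lemma potD_left (a b : arrow T) : is_cycle [:: a; b] ->
  qp_pot D [:: (inl a : arrow D); inl b] = qp_pot T [:: a; b].
Proof. by rewrite potDE !is_cycle2 /= => ->.
Qed.

(** The form [quad] vanishes on the arrows of [Z], as [Z] is reduced.  Since the
    [c i] and [e i] are linearly independent to first order, this forces their
    linear parts to avoid [Z]. *)
Lemma linear_part_right i (z : arrow Z) : lam i (inr z) = 0 /\ mu i (inr z) = 0.
Proof.
pose q := \sum_i (lam i (inr z) *: word [:: e i] + mu i (inr z) *: word [:: c i]) : cpa K X.
have q_mpow : mpow 2 q.
  rewrite -[q]PhiK; apply: (hom_mpow hTheta).
  have -> : Phi q = \sum_i (lam i (inr z) *: pe i + mu i (inr z) *: pc i).
    rewrite (hom_sum hPhi); apply: eq_bigr => j _.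
    by rewrite (homD hPhi) !(homZ hPhi).
  apply: mpow2P; first by apply: mpow_sum => j _; apply: mpowD; apply: mpowZ.
  move=> u; rewrite acoef_sum; transitivity (quad (inr z) u).
    by apply: eq_bigr => j _; rewrite acoefD !acoefZ.
  by rewrite quad_pot potD_right if_same.
have inj_c : injective c by move=> j j' ej; have := cl_c j; rewrite ej cl_c => -[].
have inj_e : injective e by move=> j j' ej; have := cl_e j; rewrite ej cl_e => -[].
have ce j j' : (c j == e j') = false.
  by apply/eqP => ej; have := cl_c j; rewrite ej cl_e.
split.
  have := mpow2_acoef (e i) q_mpow; rewrite acoef_sum (bigD1 i) //= big1 => [|j ne].
    by rewrite acoefD !acoefZ !acoef_arrow eqxx [e i == _]eq_sym ce mulr1 mulr0 !addr0.
  by rewrite acoefD !acoefZ !acoef_arrow (inj_eq inj_e) [i == j]eq_sym (negPf ne) [e i == _]eq_sym ce !mulr0 addr0.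
have := mpow2_acoef (c i) q_mpow; rewrite acoef_sum (bigD1 i) //= big1 => [|j ne].
  by rewrite acoefD !acoefZ !acoef_arrow eqxx ce mulr1 mulr0 add0r addr0.
by rewrite acoefD !acoefZ !acoef_arrow (inj_eq inj_c) [i == j]eq_sym (negPf ne) ce !mulr0 addr0.
Qed.

(** The arrows of a trivial part are combinations of derivatives of its
    potential, hence of the linear parts of the [c i] and [e i]. *)
Lemma trivial_span (b : arrow T) : exists al be : I -> K,
  mpow 2 (@word V K D [:: inl b] - \sum_i (al i *: pc i + be i *: pe i)).
Proof.
have [_ /(_ b)[kk Ekk]] := T_trivial.
have dq (a u : arrow T) : acoef (deriv_pot (qp_pot T) a) u = quad (inl a) (inl u).
  rewrite /acoef; have w : is_walk (src u) [:: u] by rewrite /= eqxx.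
  rewrite (wcoef_walk _ w) /deriv_pot -[qstart _]/(src u) -[qword _]/[:: u].
  rewrite quad_pot.
  have [ct|nc] := boolP (is_cycle [:: a; u]); last first.
    rewrite pcoef_cycle // mul0rn if_same.
    have nc' : ~~ is_cycle ([:: inl a; inl u] : seq (arrow D)) by [].
    by rewrite pcoef_cycle // if_same.
  have /andP[/eqP e1 /eqP e2] : (tgt a == src u) && (tgt u == src a).
    by rewrite -is_cycle2.
  rewrite e1 eqxx -potD_left //.
  have [->|ne] := eqVneq a u; first by rewrite pot_loop mul0rn eqxx.
  case: eqP => [[eau]|_]; first by rewrite eau eqxx in ne.
  rewrite /= eqxx /rot /= eqseq_cons [u == a]eq_sym (negPf ne) /= addn0.
  by rewrite mulr1n.
(* The derivative of the quadratic form at [a] is the combination of the linear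
   parts of [c i] and [e i] with coefficients [mu i a] and [lam i a]. *)
exists (fun i => \sum_a kk a * mu i (inl a)), (fun i => \sum_a kk a * lam i (inl a)).
apply: mpow2P.
  apply: mpowB; first exact: mpow_arrow.
  by apply: mpow_sum => i _; apply: mpowD; apply: mpowZ.
move=> u; rewrite acoefB acoef_arrow acoef_sum; case: u => [u|z]; last first.
  rewrite big1 ?subr0 // => i _; have [l0 m0] := linear_part_right i z.
  by rewrite acoefD !acoefZ -/(lam i _) -/(mu i _) l0 m0 !mulr0 addr0.
have -> : (inl u == inl b :> arrow D) = (u == b) by [].
rewrite -acoef_arrow Ekk acoef_sum; apply/eqP; rewrite subr_eq0; apply/eqP.
under eq_bigr => a _ do rewrite acoefZ dq mulr_sumr.
rewrite exchange_big; apply: eq_bigr => i _; rewrite acoefD !acoefZ !mulr_suml -big_split.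
by apply: eq_bigr => a _; rewrite mulrDr !mulrA addrC.
Qed.

(** The automorphism [kap] moves [c i] to the element with linear image in the
    splitting.  Composing a member of the family with the inverse of [kap] gives
    a homomorphism that kills these elements; it is again a member of the family,
    for the values that it takes on the [c i], and so it respects the potentials. *)
Lemma exists_lagrangian_family : exists rho : cpa K X -> cpa K Y,
  [/\ alg_hom rho, forall i, mpow 2 (rho (word [:: c i])),
      forall i, rho (word [:: e i]) = eps i,
      forall j, rho (word [:: y j]) = word [:: j] &
      cyc (rho x) = qp_pot Y /\ forall i, rho (Theta (lin (pc i))) = 0].
Proof.
pose img a := if cl a is inl (inl i) then Theta (lin (pc i)) else word [:: a].
have [kap hkap kapE] : exists2 kap : cpa K X -> cpa K X, alg_hom kap &
    forall a, kap (word [:: a]) = img a.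
  apply: hom_of_arrows => a; rewrite /img; have := cl_inv a; case: (cl a) => [[i|i]|j] ea.
  - by apply: (hom_mpow hTheta); apply: mpow_lin.
  - exact: mpow_arrow.
  - exact: mpow_arrow.
  - rewrite ea; apply: (corner_hom hTheta); apply: corner_lin; apply: (corner_hom hPhi).
    exact: corner_arrow.
  - exact: corner_arrow.
  - exact: corner_arrow.
have kap_c i : kap (word [:: c i]) = Theta (lin (pc i)) by rewrite kapE /img cl_c.
have kap_id a : (forall i, cl a <> inl (inl i)) -> kap (word [:: a]) = word [:: a].
  by move=> h; rewrite kapE /img; case: (cl a) h => [[i|i]|j] // /(_ i).
have kap_uni a : mpow 2 (kap (word [:: a]) - word [:: a]).
  rewrite kapE /img; have := cl_inv a; case: (cl a) => [[i|i]|j] ea.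
  - rewrite ea -[word _]PhiK -/(pc i) -(homB hTheta) -opprB (homN hTheta).
    by apply: mpowN; apply: (hom_mpow hTheta); apply: sub_lin.
  - by rewrite subrr; apply: mpow0.
  - by rewrite subrr; apply: mpow0.
have [kap' [_ hkap' kapK kapK']] := unipotent_hom_iso hkap kap_uni.
have [||rho0 [hrho0 rho0_c rho0_e rho0_y _]] := family (eta := fun=> 0).
- by move=> i; apply: mpow0.
- by move=> i; apply: corner0.
(* [rho0] kills the [c i]; composed with the inverse of [kap] it is the member
   of the family for these values. *)
pose eta i := rho0 (kap' (word [:: c i])).
have eta_mpow i : mpow 2 (eta i).
  have h : mpow 2 (kap' (word [:: c i]) - word [:: c i]).
    rewrite -{2}[word _]kapK -(homB hkap') -opprB (homN hkap').
    by apply: mpowN; apply: (hom_mpow hkap').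
  by have := hom_mpow hrho0 h; rewrite (homB hrho0) rho0_c subr0.
have [||rho [hrho rho_c rho_e rho_y rhoW]] := family (eta := eta).
- by move=> i; apply: mpow_le (eta_mpow i).
- move=> i; apply: (corner_hom hrho0); apply: (corner_hom hkap').
  exact: corner_arrow.
exists rho; split=> // [i|]; first by rewrite rho_c.
split=> // i.
have rhoE : rho =1 rho0 \o kap'.
  apply: alg_hom_ext => // [|a /=]; first exact: alg_hom_comp.
  have := cl_inv a; case ca : (cl a) => [[j|j]|j] ea.
  - by rewrite ea rho_c.
  - by rewrite -[word _ in RHS]kap_id ?kapK ?ea ?rho_e ?rho0_e // -ea ca.
  - by rewrite -[word _ in RHS]kap_id ?kapK ?ea ?rho_y ?rho0_y // -ea ca.
by rewrite rhoE /= -kap_c kapK rho0_c.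
Qed.

(** The trivial part is purely quadratic and [Z] has no quadratic terms, so the
    trivial part is given by the linear parts of the [c i] and [e i]. *)
Lemma sum_potential (inj : cpa K Z -> cpa K D) (z : cpa K Z) : alg_hom inj ->
  (forall a, inj (word [:: a]) = @word V K D [:: inr a]) -> cyc z = qp_pot Z ->
  cyc (\sum_i lin (pc i) * lin (pe i) + inj z) = qp_pot D.
Proof.
move=> hinj injE ez; set xT := \sum_i _.
have xT_len d v : size d != 2%N -> wcoef xT v d = 0.
  move=> nd; rewrite wcoef_sum big1 // => i _; rewrite wcoefM big1 // => k _.
  have [s1|ns1] := eqVneq (size (take k d)) 1%N; last by rewrite wcoef_lin ?mul0r.
  rewrite [X in _ * X]wcoef_lin ?mulr0 //; apply: contraNneq nd => s2.
  by rewrite -(cat_take_drop k d) size_cat s1 s2.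
have xT_approx : mpow 3 (Phi x - xT).
  rewrite -[Phi x](subrK (\sum_i pc i * pe i)) -addrA; apply: mpowD.
    exact: Phi_quadratic.
  rewrite -sumrB; apply: mpow_sum => i _.
  have -> : pc i * pe i - lin (pc i) * lin (pe i) =
      (pc i - lin (pc i)) * pe i + lin (pc i) * (pe i - lin (pe i)).
    by rewrite mulrBl mulrBr addrA subrK.
  apply: mpowD.
    by apply: (mpowM (m := 2) (n := 1)); [apply: sub_lin | ].
  by apply: (mpowM (m := 1) (n := 2)); [apply: mpow_lin | apply: sub_lin].
apply: potentialP => d; have [cd|nd] := boolP (is_cycle d); last by rewrite !pcoef_cycle.
rewrite cycD (cyc_embedding hinj injE) // ez.
have [s2|ns2] := eqVneq (size d) 2%N.
  have -> : cyc xT d = qp_pot D d.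
    rewrite -PhiW; apply/eqP; rewrite eq_sym -subr_eq0 -cycB.
    by rewrite (cyc_mpow xT_approx) ?s2.
  case: ifP => _; rewrite ?addr0 // Z_reduced ?addr0 //.
  by rewrite size_pmap (leq_trans (count_size _ _)) ?s2.
have -> : cyc xT d = 0.
  rewrite cycE cd big_seq big1 // => -[//|a r] /rotations_size sr.
  by rewrite word_coefE xT_len // sr.
rewrite add0r potDE cd /sum_coef; case: (boolP (all (@left_arrow _ _ T Z) d)) => [hl|//].
have [T2 _] := T_trivial; rewrite T2; last first.
  move=> sp; case/eqP: ns2; rewrite -sp size_pmap; apply/esym/eqP.
  by rewrite -all_count.
by case: d hl cd {ns2} => [//|[a|a] d].
Qed.

(** The homomorphism of [exists_lagrangian_family] kills one factor of each term
    of the trivial potential, so its restriction to [Z] maps the potential of [Z]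
    to that of [Y].  It sends the arrows of the trivial part to order two, hence
    its restriction to [Z] is invertible to first order, with inverse induced by
    the inclusion of the arrows of [Y] and the projection to [Z]. *)
Theorem cancellation : right_equivalent Z Y.
Proof.
have [rho [hrho rho_c rho_e rho_y [rhoW rho_t]]] := exists_lagrangian_family.
have [inj hinj injE] := sum_embedding T Z.
have [pr hpr prE] := sum_projection T Z.
have [iY hiY iYE] : exists2 iY : cpa K Y -> cpa K X, alg_hom iY &
    forall j, iY (word [:: j]) = word [:: y j].
  apply: hom_of_arrows => j; first exact: mpow_arrow.
  by rewrite -src_y -tgt_y; apply: corner_arrow.
pose chi := rho \o Theta; have hchi : alg_hom chi by apply: alg_hom_comp.
pose phi := chi \o inj; have hphi : alg_hom phi by apply: alg_hom_comp.
pose psi := pr \o (Phi \o iY).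
have hpsi : alg_hom psi by do 2![apply: alg_hom_comp => //].
have phiW z : cyc z = qp_pot Z -> cyc (phi z) = qp_pot Y.
  move=> ez; have eD := sum_potential hinj injE ez.
  have := hom_cyc hchi (etrans eD (esym PhiW)).
  rewrite (homD hchi) (hom_sum hchi) big1 ?add0r => [->|i _].
    by rewrite /chi /= PhiK.
  by rewrite (homM hchi) [chi (lin (pc i))]rho_t mul0r.
have chi_c i : mpow 2 (chi (pc i)) by rewrite /chi /= PhiK.
have chi_e i : mpow 2 (chi (pe i)) by rewrite /chi /= PhiK rho_e.
have chi_T b : mpow 2 (chi (@word V K D [:: inl b])).
  have [al [be hb]] := trivial_span b.
  rewrite -[@word V K D _](subrK (\sum_i (al i *: pc i + be i *: pe i))) (homD hchi).
  apply: mpowD; first exact: (hom_mpow hchi).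
  rewrite (hom_sum hchi); apply: mpow_sum => i _; rewrite (homD hchi) !(homZ hchi).
  by apply: mpowD; apply: mpowZ.
have pr_right (w : cpa K D) : mpow 1 w -> (forall z, acoef w (inr z) = 0) -> mpow 2 (pr w).
  move=> hw w0; have := hom_lin hpr hw; rewrite big1 ?subr0 // => -[t|z] _.
    by rewrite prE scaler0.
  by rewrite w0 scale0r.
suff [psi' isoZY] : exists psi', alg_iso phi psi'.
  by apply/right_equivalentP; exists phi, psi'.
(* What remains is that [phi] and [psi] are inverse to each other to first
   order. *)
apply: (inverse_function hphi hpsi); last first.
- move=> j; rewrite /psi /phi /= iYE; set w := Phi _.
  have hw : mpow 1 w by apply: hom_arrow_mpow.
  have chi_w : chi w = word [:: j] by rewrite /chi /= PhiK rho_y.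
  pose w' := w - inj (pr w).
  have hw' : mpow 1 w' by apply: mpowB => //; apply: (hom_mpow hinj); apply: (hom_mpow hpr).
  have -> : chi (inj (pr w)) - word [:: j] = - chi w'.
    by rewrite /w' (homB hchi) chi_w opprB.
  apply: mpowN; rewrite -[chi w'](subrK (\sum_a acoef w' a *: chi (word [:: a]))).
  apply: mpowD; first exact: (hom_lin hchi hw').
  apply: mpow_sum => -[t|z] _; first by apply: mpowZ.
  suff -> : acoef w' (inr z) = 0 by rewrite scale0r; apply: mpow0.
  rewrite acoefB -[acoef (inj _) _]/(wcoef (inj (pr w)) (src z) (map inr [:: z] : seq (arrow D))).
  rewrite (wcoef_embedding hinj injE) -/(acoef (pr w) z).
  have /(mpow2_acoef z) := hom_lin hpr hw; rewrite acoefB => /eqP.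
  rewrite subr_eq0 => /eqP ->; rewrite acoef_sum (bigD1 (inr z)) //= big1 => [|a ne].
    by rewrite prE acoefZ acoef_arrow eqxx mulr1 addr0 subrr.
  rewrite prE acoefZ; case: a ne => [t|z'] ne; first by rewrite [acoef 0 _]wcoef0 mulr0.
  rewrite acoef_arrow; case: (z =P z') ne => [->|_ _]; first by rewrite eqxx.
  by rewrite mulr0.
move=> z; rewrite /psi /phi /= injE /chi /=; set v := Theta _.
have hv : mpow 1 v by apply: (hom_mpow hTheta); apply: mpow_arrow.
pose G := pr \o Phi; have hG : alg_hom G by apply: alg_hom_comp.
have hGF : alg_hom (G \o (iY \o rho)) by do 2![apply: alg_hom_comp => //].
have Gv : G v = word [:: z] by rewrite /G /= ThetaK prE.
rewrite -Gv -[pr _]/((G \o (iY \o rho)) v).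
have G_c i : mpow 2 (G (word [:: c i])).
  by apply: (pr_right _ (pc_mpow i)) => z'; case: (linear_part_right i z').
have G_e i : mpow 2 (G (word [:: e i])).
  by apply: (pr_right _ (pe_mpow i)) => z'; case: (linear_part_right i z').
have := mpowB (hom_lin hGF hv) (hom_lin hG hv).
set S1 := \sum_a _; set S2 := \sum_a _ => h.
rewrite (_ : _ - _ = ((G \o (iY \o rho)) v - S1 - (G v - S2)) + (S1 - S2)); last first.
  by rewrite opprB [RHS]addrACA subrK [S2 - _ + _]addrAC subrr sub0r.
apply: mpowD h _; rewrite -sumrB; apply: mpow_sum => a _; rewrite -scalerBr; apply: mpowZ.
rewrite /=; have := cl_inv a; case: (cl a) => [[i|i]|j] ->.
- by apply: mpowB => //; apply: (hom_mpow hG); apply: (hom_mpow hiY).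
- by rewrite rho_e; apply: mpowB => //; apply: (hom_mpow hG); apply: (hom_mpow hiY).
by rewrite rho_y iYE subrr; apply: mpow0.
Qed.

End Cancellation.

(** * Flips of one-puncture dart maps *)

Section Darts.
Context {V D : finType}.
Variable sr : D -> V.
Hypothesis fiber2 : forall v, #|[set d | sr d == v]| = 2.

Definition dart_quiver (f : D -> D) : quiver V := Quiver sr (fun d => sr (f d)).

Definition bar (d : D) : D := odflt d [pick b | (sr b == sr d) && (b != d)].

Lemma bar_spec d : sr (bar d) = sr d /\ bar d != d.
Proof.
rewrite /bar; case: pickP => [b /andP[/eqP -> ->] //|none].
have := fiber2 (sr d); rewrite (cardsD1 d) inE eqxx => -[] /eqP.
have -> : [set d0 | sr d0 == sr d] :\ d = finset.set0.
  by apply/setP => b; rewrite !inE andbC none.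
by rewrite cards0.
Qed.

Lemma sr_bar d : sr (bar d) = sr d. Proof. by case: (bar_spec d). Qed.
Lemma bar_neq d : bar d != d. Proof. by case: (bar_spec d). Qed.

Lemma fiber_cases x d : sr x = sr d -> x = d \/ x = bar d.
Proof.
move=> e; have [->|ne] := eqVneq x d; first by left.
right; have := fiber2 (sr d); rewrite (cardsD1 d) inE eqxx => -[].
rewrite (cardsD1 (bar d)) !inE bar_neq sr_bar eqxx => -[] /eqP.
rewrite cards_eq0 => /eqP/setP/(_ x); rewrite !inE e eqxx ne !andbT.
by move/eqP.
Qed.

Lemma barK : involutive bar.
Proof.
move=> d; have [e|e] := @fiber_cases (bar (bar d)) d (etrans (sr_bar _) (sr_bar _)) => //.
by have := bar_neq (bar d); rewrite e eqxx.
Qed.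

(** The [f]-cycles are the triangles, and the cycles of [bar] after [f] are the
    turns around the punctures. *)
Record one_puncture_map (f : D -> D) : Prop := OnePunctureMap {
  f3 : forall d, f (f (f d)) = d;
  f_neq : forall d, f d != d;
  one_cycle : forall x y, fconnect (fun d => bar (f d)) x y }.

Section Theory.
Variable f : D -> D.
Hypothesis hf : one_puncture_map f.
Let g d := bar (f d).

Lemma f_inj : injective f.
Proof. by move=> x y e; rewrite -(f3 hf x) e (f3 hf). Qed.

Lemma g_inj : injective g.
Proof. by apply: inj_comp f_inj; apply: (can_inj barK). Qed.

Lemma order_g x : order g x = #|D|.
Proof. by apply: eq_card => y; rewrite inE (one_cycle hf). Qed.

Lemma mem_traject_g x y : y \in traject g x #|D|.
Proof. by rewrite -(order_g x) -/(orbit g x) -fconnect_orbit (one_cycle hf). Qed.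

Lemma uniq_traject_g x : uniq (traject g x #|D|).
Proof. by rewrite -(order_g x); apply: orbit_uniq. Qed.

Lemma iter_g x : iter #|D| g x = x.
Proof. by rewrite -(order_g x); apply: (iter_order g_inj). Qed.

Lemma card_gt2 (x : D) : (2 < #|D|)%N.
Proof.
have u : uniq [:: x; f x; f (f x)].
  rewrite /= !inE !negb_or !(eq_sym x) (f_neq hf) /= andbT [f x == _]eq_sym (f_neq hf) andbT.
  by apply/eqP => e; have := f_neq hf (f (f x)); rewrite (f3 hf) e eqxx.
by have := max_card (mem [:: x; f x; f (f x)]); rewrite (card_uniqP u).
Qed.

Lemma iter_g_neq i x : (0 < i < 3)%N -> iter i g x != x.
Proof.
move=> /andP[i0 i3]; apply/eqP => e; have := uniq_traject_g x.
have lt := card_gt2 x; rewrite -(subnKC lt) addSn /= inE; case/andP=> /negP[].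
case: i i0 i3 e => [|[|[|i]]] //= _ _ e.
  by rewrite e eqxx.
by rewrite inE e eqxx orbT.
Qed.

Lemma no_loop_dart x : sr (f x) <> sr x.
Proof.
move=> /fiber_cases[e|e]; first by have := f_neq hf x; rewrite e eqxx.
by have := @iter_g_neq 1 x isT; rewrite /= /g e barK eqxx.
Qed.

(** Each of the two steps of a 2-cycle continues along [f] or along [g].  Two
    steps along [f] contradict the order of [f], mixed steps give a loop, and two
    steps along [g] give a short [g]-cycle. *)
Lemma no_2cycle_dart : ~ has_2cycle (dart_quiver f).
Proof.
move=> [a [b]]; rewrite is_cycle2 => /andP[/eqP /= e1 /eqP /= e2].
have [fe|fe] := fiber_cases (esym e1); have [fe'|fe'] := fiber_cases (esym e2).
- by have := f_neq hf (f (f a)); rewrite (f3 hf) -fe -fe' eqxx.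
- by apply: (@no_loop_dart (f (f a))); rewrite (f3 hf) -fe e2.
- by apply: (@no_loop_dart (f (f b))); rewrite (f3 hf) -fe' e1.
by have := @iter_g_neq 2 a isT; rewrite /= /g -fe -fe' eqxx.
Qed.

Lemma card_ge6 (x : D) : (5 < #|D|)%N.
Proof.
pose s := [:: x; f x; f (f x); bar x; f (bar x); f (f (bar x))].
have u3 y : uniq [:: y; f y; f (f y)].
  rewrite /= !inE !negb_or !(eq_sym y) (f_neq hf) /= andbT [f y == _]eq_sym (f_neq hf) andbT.
  by apply/eqP => e; have := f_neq hf (f (f y)); rewrite (f3 hf) e eqxx.
have n0 y : bar y != y by apply: bar_neq.
have n1 : bar x != f x.
  by apply/eqP => e; apply: (@no_loop_dart x); rewrite -e sr_bar.
have n2 : bar x != f (f x).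
  by apply/eqP => e; apply: (@no_loop_dart (f (f x))); rewrite (f3 hf) -e sr_bar.
have fe y z : (f y == f z) = (y == z) by apply: inj_eq; apply: f_inj.
have fe2 y z : (f y == z) = (y == f (f z)) by rewrite -{1}(f3 hf z) fe.
have u : uniq s.
  rewrite /s (cat_uniq [:: x; f x; f (f x)] [:: bar x; f (bar x); f (f (bar x))]) !u3 andbT /=.
  rewrite !inE !negb_or !fe !fe2 !(f3 hf) n0 n1 n2 /=.
  by rewrite ?(f3 hf) ?n0 ?n1 ?n2.
by have := max_card (mem s); rewrite (card_uniqP u).
Qed.

Section Flip.
Variable k : V.

(** The flip of the arc [k] on darts that keep their source.  If [b] starts at [k]
    and its triangle is [b, f b, f (f b)], then the new triangles are
    [f (f b), f (bar b), b], for the two darts [b] at [k]. *)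
Definition flip (x : D) : D :=
  if sr x == k then f (f x)
  else if sr (f x) == k then f (bar (f x))
  else if sr (f (f x)) == k then bar (f (f x))
  else f x.

Lemma flip_out x : sr x = k -> flip x = f (f x).
Proof. by rewrite /flip => ->; rewrite eqxx. Qed.

Lemma flip_in x : sr (f x) = k -> flip x = f (bar (f x)).
Proof.
move=> e; rewrite /flip e eqxx; case: eqP => // e'.
by case: (@no_loop_dart x); rewrite e e'.
Qed.

Lemma flip_opp x : sr (f (f x)) = k -> flip x = bar (f (f x)).
Proof.
move=> e; rewrite /flip e eqxx; case: eqP => [e'|_].
  by case: (@no_loop_dart (f (f x))); rewrite (f3 hf) e e'.
by case: eqP => // e'; case: (@no_loop_dart (f x)); rewrite e e'.
Qed.

Lemma flip_far x : sr x != k -> sr (f x) != k -> sr (f (f x)) != k -> flip x = f x.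
Proof. by rewrite /flip => /negPf -> /negPf -> /negPf ->. Qed.

(** The position of [k] in the triangle of [x]; at most one side of a triangle is
    [k], as there are no loops. *)
Variant dart_position x : Type :=
| DartOut of sr x = k & sr (f x) <> k & sr (f (f x)) <> k
| DartIn of sr x <> k & sr (f x) = k & sr (f (f x)) <> k
| DartOpp of sr x <> k & sr (f x) <> k & sr (f (f x)) = k
| DartFar of sr x <> k & sr (f x) <> k & sr (f (f x)) <> k.

Lemma dart_positionP x : dart_position x.
Proof.
have n1 : sr (f x) <> sr x := @no_loop_dart x.
have n2 : sr (f (f x)) <> sr (f x) := @no_loop_dart (f x).
have n3 : sr x <> sr (f (f x)) by have := @no_loop_dart (f (f x)); rewrite (f3 hf).
case: (eqVneq (sr x) k) => [e|/eqP e].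
  by apply: DartOut => // e'; [apply: n1 | apply: n3]; rewrite e e'.
case: (eqVneq (sr (f x)) k) => [e'|/eqP e'].
  by apply: DartIn => // e''; apply: n2; rewrite e' e''.
case: (eqVneq (sr (f (f x))) k) => [e''|/eqP e'']; first exact: DartOpp.
exact: DartFar.
Qed.

Lemma flip3 x : flip (flip (flip x)) = x.
Proof.
case: (dart_positionP x) => h1 h2 h3.
- have e1 : sr (f (f (f x))) = k by rewrite (f3 hf).
  have e2 : sr (f (f (f (bar (f (f (f x))))))) = k by rewrite (f3 hf) sr_bar (f3 hf).
  by rewrite (flip_out h1) (flip_in e1) (flip_opp e2) !(f3 hf) barK.
- have e1 : sr (f (f (f (bar (f x))))) = k by rewrite (f3 hf) sr_bar.
  by rewrite (flip_in h2) (flip_opp e1) (f3 hf) barK (flip_out h2) (f3 hf).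
- have e1 : sr (bar (f (f x))) = k by rewrite sr_bar.
  have e2 : sr (f (f (f (bar (f (f x)))))) = k by rewrite (f3 hf).
  by rewrite (flip_opp h3) (flip_out e1) (flip_in e2) (f3 hf) barK (f3 hf).
rewrite (@flip_far x); try exact/eqP.
rewrite (@flip_far (f x)) ?(f3 hf); try exact/eqP.
by rewrite (@flip_far (f (f x))) ?(f3 hf) //; exact/eqP.
Qed.

Lemma flip_inj : injective flip.
Proof. by move=> x y e; rewrite -(flip3 x) e flip3. Qed.

Lemma flip_neq x : flip x != x.
Proof.
have [h1 _ _|_ h2 _|_ _ h3|/eqP h1 /eqP h2 /eqP h3] := dart_positionP x; apply/eqP.
- rewrite (flip_out h1) => e; have := f_neq hf (f (f x)).
  by rewrite (f3 hf) e eqxx.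
- rewrite (flip_in h2) => e; apply: (@no_loop_dart (f x)).
  by rewrite -[in LHS]e (f3 hf) sr_bar.
- rewrite (flip_opp h3) => e; apply: (@no_loop_dart (f (f x))).
  by rewrite (f3 hf) -[in LHS]e sr_bar.
by rewrite flip_far // => e; have := f_neq hf x; rewrite e eqxx.
Qed.

Let g' x := bar (flip x).

(** The flip changes the turn around the puncture as follows: it no longer
    crosses [k], so the darts at [k] are removed, and they are inserted again
    after the opposite darts, where the new arc is crossed. *)
Definition detour x : seq D :=
  if sr x == k then [::] else if sr (f (f x)) == k then [:: x; f (f x)] else [:: x].

Let last_detour x := if sr (f (f x)) == k then f (f x) else x.

Lemma detour_path s x : fpath g x s -> sr x <> k ->
  fpath g' (last_detour x) (flatten (map detour s)).
Proof.
have [n] := ubnP (size s); elim: n => [//|n IH] in s x *; move=> lt_s hs nx.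
have step p z t : (size t < n)%N -> g' p = z -> sr z <> k -> fpath g z t ->
    fpath g' p (detour z ++ flatten (map detour t)).
  move=> lt_t ep nz ht; have := IH t z lt_t ht nz.
  rewrite /detour /last_detour; case: (eqVneq (sr z) k) => [//|_].
  case: eqP => [ez|_] /=; last by rewrite ep eqxx.
  by rewrite ep /g' (flip_opp ez) barK !eqxx.
case: s lt_s hs => [//|y s] lt_s /= /andP[/eqP gx hs].
have [h1|h2] := eqVneq (sr (f x)) k; last first.
  move/eqP: h2 => h2; apply: step => //; last by rewrite -gx /g sr_bar.
  rewrite -gx /last_detour; case: (dart_positionP x) => h3 h4 h5 //; last first.
    by case: eqP => // _; rewrite /g' flip_far //; apply/eqP.
  by rewrite h5 eqxx /g' flip_out // (f3 hf).
have sy : sr y = k by rewrite -gx /g sr_bar.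
rewrite {1}/detour sy eqxx /=; case: s lt_s hs => [//|z s] lt_s /= /andP[/eqP gy hs].
apply: step => //; first exact: ltnW.
  rewrite -gy -gx /last_detour; case: eqP => [h2|_]; last by rewrite /g' flip_in.
  by case: (@no_loop_dart (f x)); rewrite h1 h2.
by rewrite -gy /g sr_bar => e; apply: (@no_loop_dart y); rewrite sy e.
Qed.

Lemma mem_detour y : exists2 x, y \in detour x & sr x != k.
Proof.
have [e|ne] := eqVneq (sr y) k; last first.
  by exists y => //; rewrite /detour (negPf ne); case: ifP => _; rewrite inE eqxx.
have n : sr (f y) != k by apply/eqP => e'; apply: (@no_loop_dart y); rewrite e e'.
by exists (f y) => //; rewrite /detour (negPf n) (f3 hf) e eqxx !inE eqxx orbT.
Qed.

(** Both sides are paths along the flipped turn from the same dart, by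
    [detour_path]; they have the same length because as many darts are inserted
    as are removed. *)
Lemma detour_traject x : sr x <> k ->
  flatten (map detour (traject g x #|D|)) = traject g' x #|D|.
Proof.
move=> nx; have N0 : (0 < #|D|)%N by apply: leq_trans (card_gt2 x).
have sz : size (flatten (map detour (traject g x #|D|))) = #|D|.
  rewrite size_flatten /shape -map_comp sumnE big_map.
  have P : perm_eq (traject g x #|D|) (enum D).
    apply: uniq_perm; [exact: uniq_traject_g | exact: enum_uniq | move=> y].
    by rewrite mem_traject_g mem_enum.
  rewrite (perm_big _ P) big_enum /=.
  have : (\sum_(y : D) (size (detour y) + (sr y == k)) =
          \sum_(y : D) (1 + (sr (f (f y)) == k)))%N.
    apply: eq_bigr => y _; rewrite /detour.
    have [h1 _ h3|h1 _ h3|h1 _ h3|h1 _ h3] := dart_positionP y.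
    - by rewrite h1 eqxx; case: eqP h3.
    - by case: eqP h1 => // _ _; case: eqP h3.
    - by case: eqP h1 => // _ _; rewrite h3 eqxx.
    by case: eqP h1 => // _ _; case: eqP h3.
  (* The darts opposite to [k] are as many as the darts at [k]. *)
  rewrite !big_split /= sum1_card [X in (_ = _ + X)%N -> _](_ : _ = \sum_(y : D) (sr y == k))%N.
    by move/addIn.
  by rewrite [RHS](reindex_inj (inj_comp f_inj f_inj)).
move: sz; case: #|D| N0 => // n _ /=.
have := @detour_path (traject g (g x) n) x (fpath_traject _ _ _) nx.
rewrite /detour /last_detour; case: (x =P x) => // _.
case: (eqVneq (sr x) k) => [//|_]; case: eqP => [e|_] /=.
  rewrite -/detour => /fpathP[m ->] /= [] <-; rewrite size_traject.
  by rewrite /g' (flip_opp e) barK.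
by rewrite -/detour => /fpathP[m ->] /= [] <-; rewrite size_traject.
Qed.

(** By [detour_traject] the flipped turn visits every dart. *)
Lemma flip_one_puncture : one_puncture_map flip.
Proof.
have g'_inj : injective g' by apply: inj_comp flip_inj; apply: (can_inj barK).
split; [exact: flip3 | exact: flip_neq | move=> y z].
have [d] : exists d, d \in [set d | sr d == k].
  by apply/card_gt0P; rewrite fiber2.
rewrite inE => /eqP ed; pose x := f d.
have nx : sr x <> k by rewrite /x => e; apply: (@no_loop_dart d); rewrite e ed.
have conn w : fconnect g' x w.
  have [w' hw _] := mem_detour w.
  have : w \in traject g' x #|D|.
    rewrite -detour_traject //; apply/flatten_mapP; exists w' => //.
    exact: mem_traject_g.
  by case/trajectP => i _ ->; apply: fconnect_iter.
by apply: (connect_trans _ (conn z)); rewrite fconnect_sym.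
Qed.

End Flip.
End Theory.
End Darts.

(** * The potentials of dart quivers *)

Section PowerSeries.
Context {V : finType} {K : fieldType}.
Implicit Types Q : quiver V.
Variable R : nat -> K.

Lemma mpowX Q (x : cpa K Q) n : mpow 1 x -> mpow n (x ^+ n).
Proof.
move=> hx; elim: n => [//|n IH]; rewrite exprS.
exact: (mpowM (m := 1)).
Qed.

Lemma wcoef_psubst Q (x : cpa K Q) v s : wcoef (psubst R x) v s =
  \sum_(n < (size s).+1) R n * wcoef (x ^+ n) v s.
Proof.
have [w|nw] := boolP (is_walk v s); last first.
  by rewrite wcoef_nwalk // big1 // => n _; rewrite wcoef_nwalk ?mulr0.
rewrite (wcoef_walk _ w) /psubst; apply: eq_bigr => n _.
by rewrite (wcoef_walk _ w).
Qed.

Lemma psubst_approx Q (x : cpa K Q) n : mpow 1 x ->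
  mpow n (psubst R x - \sum_(i < n) R i *: x ^+ i).
Proof.
move=> hx v s lt_s; rewrite wcoefB wcoef_psubst wcoef_sum.
rewrite -(big_mkord xpredT (fun i => R i * wcoef (x ^+ i) v s)).
rewrite -(big_mkord xpredT (fun i => wcoef (R i *: x ^+ i) v s)).
rewrite [X in _ - X](big_cat_nat (n := (size s).+1)) //= opprD addrA.
rewrite [X in _ - X]big_nat_cond [X in _ - X]big1 ?subr0 => [|i].
  by apply/eqP; rewrite subr_eq0; apply/eqP; apply: eq_bigr => i _; rewrite wcoefZ.
by rewrite andbT => /andP[lt_si _]; rewrite wcoefZ (mpowX hx) ?mulr0.
Qed.

Lemma lin_cont_psubst Q Q' (F : cpa K Q -> cpa K Q') x : lin_cont F ->
  mpow 1 x -> mpow 1 (F x) -> (forall n, F (x ^+ n) = F x ^+ n) ->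
  F (psubst R x) = psubst R (F x).
Proof.
move=> hF hx hFx FX; apply: mpow_all => n; have [m hm] := lcC hF n.
pose M := maxn m n.
pose S := \sum_(i < M) R i *: x ^+ i.
have FS : F S = \sum_(i < M) R i *: F x ^+ i.
  by rewrite lc_sum //; apply: eq_bigr => i _; rewrite (lcZ hF) FX.
have -> : F (psubst R x) - psubst R (F x) =
    F (psubst R x - S) - (psubst R (F x) - \sum_(i < M) R i *: F x ^+ i).
  by rewrite (lcB hF) -FS opprB addrA subrK.
apply: mpowB.
  by apply: hm; apply: (mpow_le (leq_maxl m n)); apply: psubst_approx.
by apply: (mpow_le (leq_maxr m n)); apply: psubst_approx.
Qed.

(** The coefficients of a power series in [x] at cycles of length [n] only involve
    the powers up to [n]. *)
Lemma cyc_psubst Q (x y : cpa K Q) : mpow 1 x -> mpow 1 y ->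
  (forall n, cyc (x ^+ n) = cyc (y ^+ n)) -> cyc (psubst R x) = cyc (psubst R y).
Proof.
move=> hx hy exy; apply: potentialP => c; pose n := (size c).+1.
have E z : mpow 1 z -> cyc (psubst R z) c = \sum_(i < n) R i * cyc (z ^+ i : cpa K Q) c.
  move=> hz; rewrite -[psubst R z](subrK (\sum_(i < n) R i *: z ^+ i)) cycD.
  rewrite (cyc_mpow (psubst_approx (n := n) hz)) // add0r cyc_sum.
  by apply: eq_bigr => i _; rewrite cycZ.
by rewrite !E //; apply: eq_bigr => i _; rewrite exy.
Qed.

Lemma cyc_exp_mulC Q (u v : cpa K Q) n : cyc ((u * v) ^+ n) = cyc ((v * u) ^+ n).
Proof.
case: n => [//|n]; rewrite exprS -mulrA cyc_mulC.
have H m : v * (u * v) ^+ m * u = (v * u) ^+ m.+1.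
  elim: m => [|m IH]; first by rewrite expr0 mulr1 expr1.
  by rewrite exprS exprS -IH !mulrA.
by rewrite H.
Qed.

Lemma psubst_mpow Q (x : cpa K Q) n : R 0%N = 0 -> mpow 1 x -> mpow n x ->
  mpow n (psubst R x).
Proof.
move=> R0 h1 hx v s lt_s; rewrite wcoef_psubst big1 // => -[[|i] lt_i] _ /=.
  by rewrite R0 mul0r.
by rewrite exprS (mpowMr _ (leqnn n)) ?mulr0.
Qed.

Lemma psubst_corner Q (x : cpa K Q) i j : R 0%N = 0 -> corner i j x ->
  corner i j (psubst R x).
Proof.
move=> R0 hx; apply/cornerP => v s w; rewrite wcoef_psubst => nz.
have [hv|nv] := eqVneq v i; last first.
  case/eqP: nz; rewrite big1 // => -[[|n] ?] _ /=; first by rewrite R0 mul0r.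
  case: hx => hx _; have : wcoef (idem i * (x * x ^+ n)) v s = 0.
    by rewrite wcoef_idemM (negPf nv).
  by rewrite mulrA hx -exprS => ->; rewrite mulr0.
split=> //; apply/eqP; case: eqP => // /eqP nj.
case/eqP: nz; rewrite big1 // => -[[|n] ?] _ /=; first by rewrite R0 mul0r.
case: hx => _ hx; have : wcoef (x ^+ n * x * idem j) v s = 0.
  by rewrite wcoef_Midem (negPf nj).
by rewrite -mulrA hx -exprSr => ->; rewrite mulr0.
Qed.

End PowerSeries.

Section TriangleSums.
Context {V D : finType} {K : fieldType}.
Variable sr : D -> V.
Hypothesis fiber2 : forall v, #|[set d | sr d == v]| = 2.
Variable f : D -> D.
Hypothesis hf : one_puncture_map sr f.
Local Notation Q := (dart_quiver sr f).
Local Notation g := (fun d => bar sr (f d)).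

Definition tri (b : D) : seq D := [:: b; f b; f (f b)].

Lemma cyc_word (Q' : quiver V) s (c : seq (arrow Q')) :
  cyc (word s : cpa K Q') c = (is_cycle c && (s \in rotations c))%:R.
Proof.
rewrite cycE; case: ifP => // cc.
have E d : d \in rotations c -> word_coef (word s : cpa K Q') d = (d == s)%:R.
  move=> hd; have := rotations_cycle hd cc; case: d hd => [//|a d] hd.
  by rewrite word_coefE wcoef_word is_cycle_walk => /andP[-> _].
rewrite big_seq (eq_bigr _ E) -big_seq /=.
have [hs|ns] := boolP (s \in rotations c).
  rewrite (bigD1_seq s) ?rotations_uniq //= eqxx big1 ?addr0 // => d.
  by move/negPf->.
rewrite big_seq big1 // => d hd; case: eqP => // e.
by rewrite -e hd in ns.
Qed.

Lemma rotations_tri b : rotations (tri b) =i [:: tri b; tri (f b); tri (f (f b))].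
Proof.
have E : [seq rot i (tri b) | i <- iota 0 (size (tri b))] =
    [:: tri b; tri (f b); tri (f (f b))].
  by rewrite /tri /= !(f3 hf).
by move=> c; rewrite mem_undup E.
Qed.

Lemma is_cycle_tri b : is_cycle (tri b : seq (arrow Q)).
Proof. by rewrite /is_cycle /= !(f3 hf) !eqxx. Qed.

Lemma uniq_tri y : uniq (tri y).
Proof.
rewrite /= !inE !negb_or !(eq_sym y) (f_neq hf) /= andbT [f y == _]eq_sym (f_neq hf) andbT.
by apply/eqP => e; have := f_neq hf (f (f y)); rewrite (f3 hf) e eqxx.
Qed.

(** Any choice of one dart in each triangle gives the same sum of triangles as a
    potential; the choice can be adapted to a vertex. *)
Definition tri_transversal (P : pred D) := forall b, count P (tri b) = 1%N.

Definition tri_sum (P : pred D) : cpa K Q := \sum_(b | P b) @word V K Q (tri b).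

Lemma cyc_tri_sum P (c : seq (arrow Q)) : tri_transversal P ->
  cyc (tri_sum P) c = [exists b, c == tri b]%:R.
Proof.
move=> hP; rewrite cyc_sum; case: existsP => [[b /eqP ec]|nt]; last first.
  rewrite big1 // => b _; rewrite cyc_word; case: (boolP (_ \in _)); last by rewrite andbF.
  move=> /rotations_sym; rewrite (rotations_tri b) !inE => h; case: nt.
  by case/or3P: h => /eqP ->; [exists b | exists (f b) | exists (f (f b))].
rewrite ec; transitivity (\sum_(d | P d) (d \in tri b)%:R : K).
  apply: eq_bigr => d _; rewrite cyc_word is_cycle_tri (rotations_tri b) !inE.
  congr (_%:R); congr nat_of_bool.
  by rewrite /tri; apply/or3P/or3P => -[] /eqP;
    [constructor 1|constructor 2|constructor 3|constructor 1|constructor 2|constructor 3];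
    apply/eqP; congruence.
rewrite -natr_sum; congr (_%:R); transitivity (count P (tri b)); last exact: hP.
rewrite -sum1_count big_mkcond [RHS]big_mkcond /=.
rewrite -[tri b]/(tri b) [RHS](big_uniq _ (uniq_tri b)) [RHS]big_mkcond /=.
by apply: eq_bigr => d _; case: (d \in _); case: (P d).
Qed.

Lemma froots_transversal : tri_transversal (froots f).
Proof.
move=> b; have inj : injective f by apply: (f_inj hf).
have R x : froot f (f x) = froot f x.
  by apply/esym/eqP; rewrite (root_connect (fconnect_sym inj)) fconnect1.
have E : {in tri b, froots f =1 pred1 (froot f b)}.
  move=> x; rewrite !inE => /or3P[] /eqP -> /=; rewrite /roots /= ?R //; exact: eq_sym.
rewrite (eq_in_count E) count_uniq_mem ?uniq_tri //.
have : fconnect f b (froot f b) by apply: connect_root.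
rewrite fconnect_orbit => /trajectP[i _ ->].
suff -> : iter i f b \in tri b by [].
elim: i => [|i /=]; first by rewrite inE eqxx.
rewrite !inE => /or3P[] /eqP ->; rewrite ?(f3 hf) ?eqxx ?orbT //.
Qed.

Lemma traject_rot x y : exists i, traject g y #|D| = rot i (traject g x #|D|).
Proof.
have /trajectP[i lt_i ->] := mem_traject_g hf x y; exists i.
have e1 : #|D| = (i + (#|D| - i))%N by rewrite subnKC // ltnW.
have e2 : #|D| = ((#|D| - i) + i)%N by rewrite subnK // ltnW.
rewrite {2}e1 trajectD {1}e2 trajectD -iterD subnK ?(ltnW lt_i) //.
rewrite (iter_g fiber2 hf) /rot drop_size_cat ?size_traject //.
by rewrite take_size_cat ?size_traject.
Qed.

Lemma cyc_omega R x y :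
  cyc (psubst R (@omega V K Q f x)) = cyc (psubst R (@omega V K Q f y)).
Proof.
have N0 : (0 < #|D|)%N by apply: leq_trans (card_gt2 hf x).
have m z : mpow 1 (@omega V K Q f z).
  by apply: mpow_word; rewrite size_traject.
apply: cyc_psubst => // n.
have [i e] := traject_rot x y.
rewrite /omega e -[in LHS](cat_take_drop i (traject _ x _)) /rot.
by rewrite -!word_cat cyc_exp_mulC.
Qed.

(** The potential depends neither on the starting point of the turn nor on the
    representatives of the triangles. *)
Lemma pot_R_cyc R x y P : tri_transversal P ->
  @pot_R V K Q f R x = cyc (- psubst R (@omega V K Q f y) + tri_sum P).
Proof.
move=> hP; apply: potentialP => c; rewrite /pot_R !cycD !cycN (cyc_omega R x y); congr (_ + _).
by rewrite (cyc_tri_sum _ hP) -(cyc_tri_sum _ froots_transversal).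
Qed.

End TriangleSums.

(** * The premutation at an arc and the flipped potential *)

Lemma corner_word (V : finType) (K : fieldType) (Q : quiver V) (a : arrow Q) s :
  corner (src a) (walk_end (src a) (a :: s)) (word (a :: s) : cpa K Q).
Proof.
apply/cornerP => v t w; rewrite wcoef_word w andTb.
case: (t =P a :: s) w => [->|_ _]; last by rewrite eqxx.
by move=> /= /andP[/eqP <- _].
Qed.

Section FlipPremutation.
Context {V D : finType} {K : fieldType}.
Variable sr : D -> V.
Hypothesis fiber2 : forall v, #|[set d | sr d == v]| = 2.
Variable f : D -> D.
Hypothesis hf : one_puncture_map sr f.
Variables (R : nat -> K) (k : V).
Hypothesis R0 : R 0%N = 0.

Local Notation Q := (dart_quiver sr f).
Local Notation f' := (flip sr f k).
Local Notation Q' := (dart_quiver sr f').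
Local Notation bar := (bar sr).
Local Notation g := (fun d => bar (f d)).

(** The two darts at the mutated arc index the two 2-cycles of the premutation. *)
Definition out_dart : finType := {b : D | sr b == k}.
Variable i0 : out_dart.

Definition X0 : qp V K := QP Q (@pot_R V K Q f R (val i0)).
Definition Y0 : qp V K := QP Q' (@pot_R V K Q' f' R (val i0)).
Local Notation Qm := (premut_quiver k X0).

Let no_loop : forall a : arrow X0, src a = k -> tgt a <> k.
Proof. by move=> a /= e e'; apply: (no_loop_dart fiber2 hf (x := a)); rewrite e. Qed.

Let srK (i : out_dart) : sr (val i) = k.
Proof. by apply/eqP; apply: (valP i). Qed.

Let n1 x : sr (f x) <> sr x. Proof. exact: (no_loop_dart fiber2 hf). Qed.

Let ff x : f (f (f x)) = x. Proof. exact: (f3 hf). Qed.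

Lemma comp_dart_subproof (i : out_dart) :
  (tgt (f (f (val i)) : arrow X0, val i : arrow X0).1 == k) && (src (f (f (val i)) : arrow X0, val i : arrow X0).2 == k).
Proof. by rewrite /= ff srK eqxx. Qed.

(** The composite arrow through [k] inside the triangle of a dart at [k]; it forms
    a 2-cycle with [opp_kept]. *)
Definition diag_comp (i : out_dart) : arrow Qm :=
  inl (inr (exist _ (f (f (val i)) : arrow X0, val i : arrow X0) (comp_dart_subproof i) : comp_arrow k X0)).

Lemma opp_dart_subproof (i : out_dart) :
  (src (f (val i) : arrow X0) != k) && (tgt (f (val i) : arrow X0) != k).
Proof.
have e := srK i; apply/andP; split; apply/eqP => /= e'.
  by apply: (@n1 (val i)); rewrite e.
by apply: (@n1 (f (f (val i)))); rewrite ff e.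
Qed.

Definition opp_kept (i : out_dart) : arrow Qm :=
  inl (inl (exist _ (f (val i) : arrow X0) (opp_dart_subproof i) : kept_arrow k X0)).

(** A flipped triangle at [k] consists of the composite arrow that turns around
    one end of [k] and of two reversed arrows; the reversed arrow of [f (f x)]
    starts where [x] does.  The last branch is never reached. *)
Definition flip_arrow (x : D) : arrow Qm :=
  if insub (x : arrow X0, bar (f x) : arrow X0) is Some ab then inl (inr (ab : comp_arrow k X0))
  else if insub (f (f x) : arrow X0) is Some c then inr (c : star_arrow k X0)
  else if insub (x : arrow X0) is Some c then inl (inl (c : kept_arrow k X0))
  else diag_comp i0.

(** The partition of the arrows of the premutation into the arrows of the two
    2-cycles and those of the flipped quiver, inverse to [flip_arrow]. *)
Definition flip_class (a : arrow Qm) : out_dart + out_dart + arrow Y0 :=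
  match a with
  | inl (inl c) => if insub (f (f (val c))) is Some i then inl (inr i) else inr (val c)
  | inl (inr ab) => if insub (val ab).2 is Some i then
      if val i == f (val ab).1 then inl (inl i) else inr (val ab).1 else inr (val ab).1
  | inr c => inr (f (val c))
  end.

Lemma flip_arrow_in x : sr (f x) = k ->
  exists2 ab : comp_arrow k X0, val ab = (x, bar (f x)) & flip_arrow x = inl (inr ab).
Proof.
move=> e; rewrite /flip_arrow; case: insubP => [ab _ eab|]; first by exists ab.
by rewrite /= e (sr_bar fiber2) e eqxx.
Qed.

Lemma flip_arrow_star x : sr (f x) <> k -> sr x = k \/ sr (f (f x)) = k ->
  exists2 c : star_arrow k X0, val c = f (f x) & flip_arrow x = inr c.
Proof.
move=> /eqP/negPf ne h; rewrite /flip_arrow; case: insubP => [ab|_]; first by rewrite /= ne.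
case: insubP => [c _ ec|]; first by exists c.
by rewrite /= ff; case: h => ->; rewrite eqxx ?orbT.
Qed.

Lemma flip_arrow_far x : sr (f x) <> k -> sr x <> k -> sr (f (f x)) <> k ->
  exists2 c : kept_arrow k X0, val c = x & flip_arrow x = inl (inl c).
Proof.
move=> /eqP/negPf h1 /eqP/negPf h2 /eqP/negPf h3; rewrite /flip_arrow.
case: insubP => [ab|_]; first by rewrite /= h1.
case: insubP => [c|_]; first by rewrite /= ff h2 h3.
by case: insubP => [c _ ec|]; [exists c | rewrite /= h1 h2].
Qed.

Lemma flip_class_c i : flip_class (diag_comp i) = inl (inl i).
Proof. by rewrite /flip_class /= valK ff eqxx. Qed.

Lemma flip_class_e i : flip_class (opp_kept i) = inl (inr i).
Proof. by rewrite /flip_class /= ff valK. Qed.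

Lemma flip_class_y x : flip_class (flip_arrow x) = inr x.
Proof.
have [h1 h2 h3|h1 h2 h3|h1 h2 h3|h1 h2 h3] := dart_positionP fiber2 hf k x.
- by have [//||c ec ->] := flip_arrow_star (x := x); [left | rewrite /= ec ff].
- have [ab eab ->] := flip_arrow_in h2; rewrite /flip_class eab /=.
  by case: insubP => [i _ ->|//]; rewrite (negPf (bar_neq fiber2 _)).
- by have [//||c ec ->] := flip_arrow_star (x := x); [right | rewrite /= ec ff].
have [c ec ->] := flip_arrow_far h2 h1 h3; rewrite /flip_class ec.
by case: insubP => // i /eqP.
Qed.

Lemma flip_class_inv (a : arrow Qm) : a = match flip_class a with
  inl (inl i) => diag_comp i | inl (inr i) => opp_kept i | inr j => flip_arrow j end.
Proof.
case: a => [[c|ab]|c] /=.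
- case: insubP => [i _ ei|h].
    by congr (inl (inl _)); apply: val_inj; rewrite /= ei ff.
  have [c' ec' ->] : exists2 c' : kept_arrow k X0, val c' = val c & flip_arrow (val c) = inl (inl c').
    by have /andP[/eqP h1 /eqP h2] := valP c; apply: flip_arrow_far => //; apply/eqP.
  by congr (inl (inl _)); apply: val_inj.
- have /andP[/eqP ta /eqP sb] := valP ab.
  case: insubP => [i _ ei|/eqP[]]; last exact: sb.
  case: eqP => [e|ne].
    congr (inl (inr _)); apply: val_inj; rewrite /= e ff -e ei.
    exact: surjective_pairing.
  have [ab' eab' ->] := flip_arrow_in ta.
  congr (inl (inr _)); apply: val_inj; rewrite eab'.
  have [eb|eb] := fiber_cases fiber2 (etrans sb (esym ta)).
    by case: ne; rewrite ei.
  by apply: etrans (surjective_pairing _) _; congr pair.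
have hc := valP c.
have [c' ec' ->] : exists2 c' : star_arrow k X0, val c' = f (f (f (val c))) & flip_arrow (f (val c)) = inr c'.
  apply: flip_arrow_star.
    case/orP: hc => /eqP /= e e'.
      by apply: (@n1 (f (f (val c)))); rewrite ff e e'.
    by apply: (@n1 (f (val c))); rewrite e e'.
  by rewrite ff; case/orP: hc => /eqP /= ->; [right | left].
by congr inr; apply: val_inj; rewrite ec' ff.
Qed.

Lemma src_flip_arrow x : src (flip_arrow x) = sr x.
Proof.
have [h1 h2 h3|h1 h2 h3|h1 h2 h3|h1 h2 h3] := dart_positionP fiber2 hf k x.
- by have [//||c ec ->] := flip_arrow_star (x := x); [left | rewrite /= ec ff].
- by have [ab eab ->] := flip_arrow_in h2; rewrite /= eab.
- by have [//||c ec ->] := flip_arrow_star (x := x); [right | rewrite /= ec ff].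
by have [c ec ->] := flip_arrow_far h2 h1 h3; rewrite /= ec.
Qed.

Lemma tgt_flip_arrow x : tgt (flip_arrow x) = sr (f' x).
Proof.
have [h1 h2 h3|h1 h2 h3|h1 h2 h3|h1 h2 h3] := dart_positionP fiber2 hf k x.
- have [//||c ec ->] := flip_arrow_star (x := x); first by left.
  by rewrite /= ec flip_out.
- by have [ab eab ->] := flip_arrow_in h2; rewrite /= eab (flip_in fiber2 hf).
- have [//||c ec ->] := flip_arrow_star (x := x); first by right.
  by rewrite /= ec (flip_opp fiber2 hf) // (sr_bar fiber2).
have [c ec ->] := flip_arrow_far h2 h1 h3; rewrite /= ec flip_far //; exact/eqP.
Qed.

(** Representatives of the triangles that serve both before and after the flip,
    chosen not to start at [k]. *)
Definition rep_dart : pred D := fun x =>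
  (sr (f x) == k) || [&& sr x != k, sr (f (f x)) != k & froots f x].

Lemma rep_dart_out x : sr x = k -> rep_dart x = false.
Proof.
move=> e; rewrite /rep_dart e eqxx /= orbF; apply/eqP => e'.
by apply: (@n1 x); rewrite e e'.
Qed.

Lemma rep_dart_opp x : sr (f (f x)) = k -> rep_dart x = false.
Proof.
move=> e; rewrite /rep_dart e eqxx andbF orbF; apply/eqP => e'.
by apply: (@n1 (f x)); rewrite e e'.
Qed.

Lemma rep_dart_in x : sr (f x) = k -> rep_dart x.
Proof. by rewrite /rep_dart => ->; rewrite eqxx. Qed.

Lemma rep_dart_far x : sr x <> k -> sr (f x) <> k -> sr (f (f x)) <> k ->
  rep_dart x = froots f x.
Proof. by rewrite /rep_dart => /eqP -> /eqP/negPf -> /eqP ->. Qed.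

Lemma rep_dart_transversal : tri_transversal f rep_dart.
Proof.
move=> x; rewrite /tri /=.
have [h1 h2 h3|h1 h2 h3|h1 h2 h3|h1 h2 h3] := dart_positionP fiber2 hf k x.
- by rewrite (rep_dart_out h1) (@rep_dart_opp (f x)) ?ff // (@rep_dart_in (f (f x))) ?ff.
- by rewrite (rep_dart_in h2) (@rep_dart_out (f x)) // (@rep_dart_opp (f (f x))) ?ff.
- by rewrite (rep_dart_opp h3) (@rep_dart_in (f x)) // (@rep_dart_out (f (f x))).
rewrite (rep_dart_far h1 h2 h3) (@rep_dart_far (f x)) ?ff // (@rep_dart_far (f (f x))) ?ff //.
exact: (froots_transversal hf x).
Qed.

Lemma rep_dart_transversal' : tri_transversal f' rep_dart.
Proof.
move=> x; rewrite /tri /=.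
have [h1 h2 h3|h1 h2 h3|h1 h2 h3|h1 h2 h3] := dart_positionP fiber2 hf k x.
- have e : sr (f (f (f x))) = k by rewrite ff.
  rewrite (flip_out _ h1) (flip_in fiber2 hf e) ff (rep_dart_out h1).
  by rewrite (rep_dart_in e) (@rep_dart_opp (f (bar x))) // ff (sr_bar fiber2).
- have e : sr (f (f (f (bar (f x))))) = k by rewrite ff (sr_bar fiber2).
  rewrite (flip_in fiber2 hf h2) (flip_opp fiber2 hf e) ff (barK fiber2).
  by rewrite (rep_dart_in h2) (rep_dart_opp e) (rep_dart_out h2).
- have e : sr (bar (f (f x))) = k by rewrite (sr_bar fiber2).
  rewrite (flip_opp fiber2 hf h3) (flip_out _ e) (rep_dart_opp h3) (rep_dart_out e).
  by rewrite rep_dart_in // ff.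
have E y : sr y <> k -> sr (f y) <> k -> sr (f (f y)) <> k -> f' y = f y.
  by move=> *; apply: flip_far; apply/eqP.
rewrite (E x) // (E (f x)) ?ff //.
rewrite (rep_dart_far h1 h2 h3) (@rep_dart_far (f x)) ?ff // (@rep_dart_far (f (f x))) ?ff //.
exact: (froots_transversal hf x).
Qed.

Let d1 : D := f (val i0).

Let d1_off : sr d1 <> k. Proof. by rewrite -(srK i0); apply: n1. Qed.

Let om : cpa K X0 := @omega V K Q f d1.
Let x0 : cpa K X0 := - psubst R om + (tri_sum rep_dart : cpa K Q).
Let xm : cpa K Qm := bracket k x0 + triangles_at k X0.

(** The turn, started away from [k], closes up at its first dart. *)
Lemma omega_last : sr (f (last d1 (traject g (g d1) #|D|.-1))) = sr d1.
Proof.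
have := iter_g fiber2 hf d1; have := leq_trans (isT : 0 < 3)%N (card_gt2 hf d1).
case: #|D| => //= n _ e; rewrite -[in RHS]e (sr_bar fiber2) last_traject.
by congr (sr (f _)); case: n {e} => [//|n]; rewrite iterSr.
Qed.

Let om_corner : corner (sr d1) (sr d1) om.
Proof.
rewrite -{2}omega_last /om /omega [#|_|]/=.
have := leq_trans (isT : 0 < 3)%N (card_gt2 hf d1).
case: #|D| => // n _ /=; have := @corner_word V K Q d1 (traject g (g d1) n).
by rewrite /walk_end /= last_map.
Qed.

Let om_mpow : mpow 6 om.
Proof. by apply: mpow_word; rewrite size_traject; apply: (card_ge6 fiber2 hf d1). Qed.

Lemma x0_pot : cyc x0 = qp_pot X0.
Proof. by rewrite /= (pot_R_cyc fiber2 hf R (val i0) d1 rep_dart_transversal). Qed.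

Lemma starts_offD x y : starts_off k x -> starts_off k y -> starts_off k (x + y : cpa K X0).
Proof. by rewrite /starts_off mulrDr => -> ->; rewrite addr0. Qed.

Lemma x0_off : starts_off k x0.
Proof.
apply: starts_offD.
  rewrite /starts_off mulrN.
  by rewrite (corner_starts_off (psubst_corner R0 om_corner) d1_off) oppr0.
rewrite /starts_off mulr_sumr big1 // => b hb.
have nb : sr b <> k by move=> e; rewrite rep_dart_out in hb.
exact: (@corner_starts_off _ _ k X0 _ (sr b) _ (@corner_word V K Q b [:: f b; f (f b)]) nb).
Qed.

Lemma xm_pot : cyc xm = qp_pot (premutation k X0).
Proof. by rewrite (premutation_pot no_loop x0_pot x0_off). Qed.

Lemma bracket_diag (i : out_dart) : @bracket V K k X0 (@word V K Q (tri f (f (f (val i))))) =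
  @word V K Qm [:: diag_comp i] * word [:: opp_kept i] :> cpa K Qm.
Proof.
rewrite word_cat -bracket_word //; congr (bracket k (word _)).
by rewrite /tri /expands /= ff.
Qed.

Lemma bracket_far b : sr b <> k -> sr (f b) <> k -> sr (f (f b)) <> k ->
  @bracket V K k X0 (@word V K Q (tri f b)) = @word V K Qm (map flip_arrow (tri f b)).
Proof.
move=> h1 h2 h3; rewrite -bracket_word /=; last first.
  have [c _ ->] := flip_arrow_far h2 h1 h3.
  have [|//|//|c' _ ->] := @flip_arrow_far (f b); rewrite ?ff //.
  by have [|//|//|c'' _ ->] := @flip_arrow_far (f (f b)); rewrite ?ff.
congr (bracket k (word _)); rewrite /expands /tri /=.
have [c ec ->] := flip_arrow_far h2 h1 h3.
have [|//|//|c' ec' ->] := @flip_arrow_far (f b); rewrite ?ff //.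
have [|//|//|c'' ec'' ->] := @flip_arrow_far (f (f b)); rewrite ?ff //.
by rewrite /= ec ec' ec''.
Qed.

Lemma sum_in_out (A : nmodType) (G : D -> A) :
  \sum_(a | sr (f a) == k) G a = \sum_(i : out_dart) G (f (f (val i))).
Proof.
rewrite (reindex_inj (inj_comp (f_inj hf) (f_inj hf))) /=.
rewrite (eq_bigl (fun b => sr b == k)) => [|b]; last by rewrite ff.
exact: (big_sub [pred b | sr b == k] (fun b => G (f (f b)))).
Qed.

Lemma sum_rep (A : nmodType) (G : D -> A) : \sum_(b | rep_dart b) G b =
  \sum_(a | sr (f a) == k) G a +
  \sum_(b | [&& sr b != k, sr (f b) != k, sr (f (f b)) != k & froots f b]) G b.
Proof.
rewrite (bigID (fun b => sr (f b) == k)) /=; congr (_ + _); apply: eq_bigl => b.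
  by case: (sr (f b) =P k) => [e|_]; rewrite ?andbF // rep_dart_in.
have [h1 h2 h3|h1 h2 h3|h1 h2 h3|h1 h2 h3] := dart_positionP fiber2 hf k b.
- by rewrite rep_dart_out // h1 eqxx.
- by rewrite h2 eqxx !andbF.
- by rewrite rep_dart_opp // h3 eqxx /= !andbF.
by rewrite rep_dart_far //; move/eqP/negPf: h1 => ->; move/eqP/negPf: h2 => ->;
  move/eqP/negPf: h3 => ->; rewrite andbT.
Qed.

Local Notation wm s := (@word V K Qm s).

Lemma bracket_x0 : bracket k x0 = - bracket k (psubst R om) +
  (\sum_(i : out_dart) wm [:: diag_comp i] * wm [:: opp_kept i] +
   \sum_(b | [&& sr b != k, sr (f b) != k, sr (f (f b)) != k & froots f b])
      wm (map flip_arrow (tri f b))).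
Proof.
have bl := bracket_lin_cont (K := K) k X0.
rewrite /x0 (lcD bl) -scaleN1r (lcZ bl) scaleN1r; congr (_ + _).
rewrite /tri_sum sum_rep (lcD bl) !(lc_sum _ _ _ bl) sum_in_out; congr (_ + _).
  by apply: eq_bigr => i _; apply: bracket_diag.
apply: eq_bigr => b /and4P[/eqP h1 /eqP h2 /eqP h3 _]; exact: bracket_far.
Qed.

Lemma star_out (b : D) : sr b = k -> star k (b : arrow X0) = wm [:: flip_arrow (f b)].
Proof.
move=> h; have [||c ec ->] := @flip_arrow_star (f b).
- by move=> e; apply: (@n1 (f (f b))); rewrite ff e.
- by right; rewrite ff.
by rewrite -star_val ec ff.
Qed.

Lemma star_in (a : D) : sr (f a) = k -> star k (a : arrow X0) = wm [:: flip_arrow (f a)].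
Proof.
move=> h; have [||c ec ->] := @flip_arrow_star (f a).
- by move=> e; apply: (@n1 (f a)); rewrite h e.
- by left.
by rewrite -star_val ec ff.
Qed.

Lemma bracket_turn (a : D) : sr (f a) = k ->
  @bracket V K k X0 (@word V K Q [:: a; bar (f a)]) = wm [:: flip_arrow a].
Proof.
move=> h; have [ab eab ->] := flip_arrow_in h.
by rewrite -(bracket_comp (K := K)) eab.
Qed.

Lemma triangles_flip : triangles_at k X0 =
  \sum_(i : out_dart) (wm [:: diag_comp i] * wm [:: flip_arrow (f (val i))] * wm [:: flip_arrow (val i)]
    + wm [:: flip_arrow (f (f (val i)))] * wm [:: flip_arrow (f (bar (val i)))] * wm [:: flip_arrow (val i)]).
Proof.
rewrite triangles_atE (sum_in_out (fun a : D => \sum_(b | sr b == k)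
   @bracket V K k X0 (@word V K Q [:: a; b]) * star k (b : arrow X0) * star k (a : arrow X0))).
apply: eq_bigr => i _; have si := srK i.
have sbi : sr (bar (val i)) = k by rewrite (sr_bar fiber2).
rewrite (bigD1 (val i)) ?si //= (bigD1 (bar (val i))) /=; last first.
  by rewrite sbi eqxx (bar_neq fiber2).
rewrite [X in _ + (_ + X)]big1 ?addr0 => [|b]; last first.
  case/andP=> /andP[/eqP sb n1'] n2'.
  by case: (fiber_cases fiber2 (etrans sb (esym si))) => e; rewrite e eqxx in n1' n2'.
have hin : sr (f (f (f (val i)))) = k by rewrite ff.
rewrite (star_out si) (star_out sbi) (star_in hin) ff; congr (_ * _ * _ + _ * _ * _).
  have -> : wm [:: diag_comp i] = bracket k (word (expands [:: diag_comp i])).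
    by rewrite bracket_word.
  by rewrite /expands /=.
by have := bracket_turn hin; rewrite ff.
Qed.

(** The triangles at [k] give the quadratic part; the turn around the puncture has
    at least six darts, so its bracket has order at least three. *)
Lemma xm_quadratic :
  mpow 3 (xm - \sum_(i : out_dart) wm [:: diag_comp i] * wm [:: opp_kept i]).
Proof.
rewrite /xm bracket_x0 triangles_flip; set S := \sum_i _.
rewrite -!addrA; apply: mpowD.
  apply: mpowN => v s lt_s; rewrite wcoef_bracket; case: ifP => // _.
  apply: (psubst_mpow R0 (mpow_le _ om_mpow) om_mpow) => //.
  by apply: leq_ltn_trans (size_expands s) _; rewrite (ltn_pmul2l (m := 2) (n1 := size s) (n2 := 3)).
rewrite addrC !addrA subrK; apply: mpowD.
  by apply: mpow_sum => b _; apply: mpow_word; rewrite size_map.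
by apply: mpow_sum => i _; rewrite !word_cat; apply: mpowD; apply: mpow_word.
Qed.

Let eps (i : out_dart) : cpa K Y0 := - @word V K Q' [:: f (val i); val i].

Section Family.
Variable eta : out_dart -> cpa K Y0.
Hypothesis eta_mpow : forall i, mpow 1 (eta i).
Hypothesis eta_corner : forall i, corner (src (diag_comp i)) (tgt (diag_comp i)) (eta i).

(** The opposite arrow [e i] is eliminated through its relation: the part of the
    potential divisible by [c i] is [c i * (e i + new path)]. *)
Definition family_image (a : arrow Qm) : cpa K Y0 := match flip_class a with
  | inl (inl i) => eta i | inl (inr i) => eps i | inr x => @word V K Q' [:: x] end.

Lemma family_image_mpow a : mpow 1 (family_image a).
Proof.
rewrite /family_image; case: (flip_class a) => [[i|i]|x] //; last exact: mpow_arrow.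
by apply: mpowN; apply: mpow_word.
Qed.

Lemma family_image_corner a : corner (src a) (tgt a) (family_image a).
Proof.
rewrite /family_image; have := flip_class_inv a.
case: (flip_class a) => [[i|i]|x] ->; first exact: eta_corner.
  apply: cornerN => /=.
  have -> : sr (f (f (val i))) = @walk_end V Q' (sr (f (val i))) [:: f (val i); val i].
    by rewrite /walk_end /= (flip_out _ (srK i)).
  exact: (@corner_word V K Q' (f (val i))).
by rewrite src_flip_arrow tgt_flip_arrow; apply: (@corner_arrow V K Q' x).
Qed.

Variable rho : cpa K Qm -> cpa K Y0.
Hypothesis rho_hom : alg_hom rho.
Hypothesis rhoE : forall a, rho (wm [:: a]) = family_image a.

Let rho_c i : rho (wm [:: diag_comp i]) = eta i.
Proof. by rewrite rhoE /family_image flip_class_c. Qed.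
Let rho_e i : rho (wm [:: opp_kept i]) = eps i.
Proof. by rewrite rhoE /family_image flip_class_e. Qed.
Let rho_y x : rho (wm [:: flip_arrow x]) = @word V K Q' [:: x].
Proof. by rewrite rhoE /family_image flip_class_y. Qed.

Let F y := rho (bracket k (y : cpa K X0)).

Lemma F_mul x y : ends_off k x -> F (x * y) = F x * F y.
Proof. by move=> h; rewrite /F bracketM_off // (homM rho_hom). Qed.

Lemma F_far x : sr x <> k -> sr (f x) <> k -> sr (f (f x)) <> k ->
  F (@word V K Q [:: x]) = @word V K Q' [:: x].
Proof.
move=> h1 h2 h3; rewrite -rho_y; congr rho; have [c ec ->] := flip_arrow_far h2 h1 h3.
by rewrite -(bracket_kept (K := K)) ec.
Qed.

Lemma F_opp x : sr (f (f x)) = k ->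
  F (@word V K Q [:: x]) = - @word V K Q' [:: x; f (f x)].
Proof.
move=> h; have hb : sr (f (f x)) == k by apply/eqP.
pose i : out_dart := exist _ (f (f x)) hb.
have ex : f (val i) = x by rewrite /= ff.
have -> : - @word V K Q' [:: x; f (f x)] = eps i by rewrite /eps ex.
by rewrite -rho_e; congr rho; rewrite /opp_kept -(bracket_kept (K := K)) /= ff.
Qed.

Lemma F_turn x : sr (f x) = k ->
  F (@word V K Q [:: x; bar (f x)]) = @word V K Q' [:: x].
Proof. by move=> h; rewrite /F bracket_turn. Qed.

Lemma ends_off_word (a : arrow Q) s : walk_end (src a) (a :: s) <> k ->
  ends_off k (@word V K Q (a :: s) : cpa K X0).
Proof. by move=> h; apply: (@corner_ends_off _ _ k X0 _ _ _ (@corner_word V K Q a s) h). Qed.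

(** Along the turn, a passage through [k] becomes one composite arrow, and a dart
    opposite to [k] is replaced by minus its detour across the new arc. *)
Lemma F_gpath n x : (0 < n)%N -> sr x <> k -> sr (f (last x (traject g (g x) n.-1))) <> k ->
  F (@word V K Q (traject g x n)) =
  (-1) ^+ count (fun y => sr (f (f y)) == k) (traject g x n) *:
    @word V K Q' (flatten (map (detour sr f k) (traject g x n))).
Proof.
have [m] := ubnP n; elim: m => [//|m IH] in n x *.
case: n => [//|n] lt_n _ nx /= hl.
have tail y : (0 < n)%N -> sr y <> k -> y = g x -> 
    F (@word V K Q (traject g y n)) =
    (-1) ^+ count (fun y => sr (f (f y)) == k) (traject g y n) *:
    @word V K Q' (flatten (map (detour sr f k) (traject g y n))).
  move=> n0 ny ey; apply: IH => //; rewrite {}ey; move: n0 hl.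
  by case: (n).
have glue (s t : seq D) (c : nat) (w : seq D) : ends_off k (@word V K Q s : cpa K X0) ->
    F (@word V K Q s) = (-1) ^+ c *: @word V K Q' w ->
    F (@word V K Q t) = (-1) ^+ count (fun y => sr (f (f y)) == k) t *:
      @word V K Q' (flatten (map (detour sr f k) t)) ->
    F (@word V K Q (s ++ t)) = (-1) ^+ (c + count (fun y => sr (f (f y)) == k) t) *:
      @word V K Q' (w ++ flatten (map (detour sr f k) t)).
  move=> hs es et; rewrite -word_cat F_mul // es et -cpa_scaleAl -cpa_scaleAr scalerA.
  by rewrite -exprD word_cat.
have step : sr (f x) <> k -> F (@word V K Q [:: x]) =
      (-1) ^+ (sr (f (f x)) == k) *: @word V K Q' (detour sr f k x) ->
    F (@word V K Q (x :: traject g (g x) n)) =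
    (-1) ^+ ((sr (f (f x)) == k) + count (fun y => sr (f (f y)) == k) (traject g (g x) n)) *:
    @word V K Q' (detour sr f k x ++ flatten (map (detour sr f k) (traject g (g x) n))).
  move=> nfx hx; have [n0|n0] := posnP n.
    by rewrite n0 /= addn0 cats0.
  apply: (glue [:: x]) => //; first exact: ends_off_word.
  by apply: tail => //; rewrite (sr_bar fiber2).
have [h1 h2 h3|h1 h2 h3|h1 h2 h3|h1 h2 h3] := dart_positionP fiber2 hf k x => //; last first.
- apply: step => //; rewrite F_far // /detour; move/eqP/negPf: h1 => ->.
  by move/eqP/negPf: h3 => ->; rewrite expr0 scale1r.
- apply: step => //; rewrite F_opp // /detour h3 eqxx; move/eqP/negPf: h1 => ->.
  by rewrite expr1 scaleN1r.
have e1 : sr (bar (f x)) = k by rewrite (sr_bar fiber2).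
have e2 : sr (f (bar (f x))) <> k by move=> e; apply: (@n1 (bar (f x))); rewrite e e1.
have e3 : sr (f (f (bar (f x)))) <> k.
  by move=> e; apply: (@n1 (f (f (bar (f x))))); rewrite ff e e1.
have dx : detour sr f k x = [:: x].
  by rewrite /detour; move/eqP/negPf: h1 => ->; move/eqP/negPf: h3 => ->.
have dgx : detour sr f k (bar (f x)) = [::] by rewrite /detour e1 eqxx.
move/eqP/negPf: (h3) => n3; move/eqP/negPf: (e3) => ne3.
case: n lt_n hl {tail step} => [|[|n]] lt_n hl.
- by case: hl.
- by rewrite /= F_turn // dx dgx n3 ne3 expr0 scale1r.
rewrite /= dx dgx n3 ne3 !add0n.
apply: (glue [:: x; bar (f x)] _ 0%N [:: x]).
- exact: ends_off_word.
- by rewrite F_turn // expr0 scale1r.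
apply: (IH n.+1) => //; first exact: ltnW.
by rewrite (sr_bar fiber2).
Qed.

(** The turn passes opposite to [k] exactly twice, so the signs cancel. *)
Lemma F_omega : F om = @omega V K Q' f' d1.
Proof.
have N6 := card_ge6 fiber2 hf d1; have N0 : (0 < #|D|)%N by apply: leq_trans N6.
have P : perm_eq (traject g d1 #|D|) (enum D).
  apply: uniq_perm; [exact: (uniq_traject_g hf) | exact: enum_uniq | move=> y].
  by rewrite (mem_traject_g hf) mem_enum.
rewrite /om /omega [#|_|]/= F_gpath //; last by rewrite omega_last.
rewrite (detour_traject fiber2 hf d1_off) (permP P).
have -> : count (fun y => sr (f (f y)) == k) (enum D) = 2.
  rewrite -(fiber2 k) -sum1_count big_enum_cond -sum1_card.
  rewrite [RHS](reindex_inj (inj_comp (f_inj hf) (f_inj hf))) /=.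
  by apply: eq_bigl => y; rewrite inE.
by rewrite -signr_odd expr0 scale1r.
Qed.

Lemma F_omegaX n : F (om ^+ n) = F om ^+ n.
Proof.
elim: n => [|n IH]; first by rewrite !expr0 /F bracket1 (hom1 rho_hom).
by rewrite !exprS F_mul ?IH //; apply: corner_ends_off om_corner d1_off.
Qed.

Lemma F_psubst : F (psubst R om) = psubst R (@omega V K Q' f' d1).
Proof.
have hF : lin_cont F.
  by apply: (lin_cont_comp (bracket_lin_cont k X0)); apply: lin_cont_hom.
rewrite (lin_cont_psubst R hF) ?F_omega //.
- exact: mpow_le om_mpow.
- by apply: mpow_word; rewrite size_traject; apply: leq_trans (card_gt2 hf d1).
by move=> n; rewrite F_omegaX F_omega.
Qed.

(** Term by term: the turn becomes the flipped turn, the two triangles at [k]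
    cancel against half of the new triangles, the other half becomes the two new
    triangles of the flip, and the triangles away from [k] stay. *)
Lemma rho_potential : cyc (rho xm) = qp_pot Y0.
Proof.
rewrite /= (pot_R_cyc fiber2 (flip_one_puncture fiber2 hf k) R (val i0) d1 rep_dart_transversal').
congr cyc; rewrite /xm bracket_x0 triangles_flip !(homD rho_hom) (homN rho_hom).
rewrite -[rho (bracket k _)]/(F (psubst R om)) F_psubst -addrA; congr (_ + _).
rewrite /tri_sum sum_rep sum_in_out !(hom_sum rho_hom) addrAC -big_split /=; congr (_ + _).
  apply: eq_bigr => i _; have si := srK i.
  have e1 : sr (f (f (f (val i)))) = k by rewrite ff.
  have e2 : sr (f (f (f (bar (f (f (f (val i)))))))) = k by rewrite ff (sr_bar fiber2) ff.
  rewrite (homD rho_hom) !(homM rho_hom) !rho_y rho_c rho_e /eps.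
  rewrite mulrN -mulrA word_cat addrA addNr add0r !word_cat.
  congr word; rewrite /tri (flip_in fiber2 hf e1) (flip_opp fiber2 hf e2).
  by rewrite !ff (barK fiber2).
apply: eq_bigr => b /and4P[/eqP h1 /eqP h2 /eqP h3 _].
have E y : sr y <> k -> sr (f y) <> k -> sr (f (f y)) <> k -> f' y = f y.
  by move=> *; apply: flip_far; apply/eqP.
rewrite /tri (E b) // (E (f b)) ?ff //=.
by rewrite -[[:: _; _; _]]/([:: _] ++ [:: _] ++ [:: _]) -!word_cat !(homM rho_hom) !rho_y !word_cat.
Qed.

End Family.

Lemma eps_family (eta : out_dart -> cpa K Y0) :
  (forall i, mpow 1 (eta i)) ->
  (forall i, corner (src (diag_comp i)) (tgt (diag_comp i)) (eta i)) ->
  exists rho : cpa K Qm -> cpa K Y0, [/\ alg_hom rho,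
    forall i, rho (wm [:: diag_comp i]) = eta i,
    forall i, rho (wm [:: opp_kept i]) = eps i,
    forall x, rho (wm [:: flip_arrow x]) = @word V K Q' [:: x] &
    cyc (rho xm) = qp_pot Y0].
Proof.
move=> h1 h2.
have [rho hrho rhoE] := hom_of_arrows (family_image_mpow h1) (family_image_corner h2).
exists rho; split=> // [i|i|x|].
- by rewrite rhoE /family_image flip_class_c.
- by rewrite rhoE /family_image flip_class_e.
- by rewrite rhoE /family_image flip_class_y.
exact: (rho_potential hrho rhoE).
Qed.

(** The elimination family of [eps_family] is what [cancellation] requires. *)
Theorem reduced_premutation_flip (Z : qp V K) :
  is_reduced_part (premutation k X0) Z -> right_equivalent Z Y0.
Proof.
move=> [Zred [T [Ttriv /right_equivalentP[Phi [Theta [iso hW]]]]]].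
refine (@cancellation V K (premutation k X0) T Z Y0 out_dart diag_comp opp_kept
  flip_arrow flip_class flip_class_c flip_class_e flip_class_inv
  _ _ _ src_flip_arrow tgt_flip_arrow xm xm_quadratic eps _ eps_family
  Ttriv Zred Phi Theta iso (hW _ xm_pot)).
- by [].
- by [].
- by move=> i /= e; apply: (@n1 (f (val i))); rewrite e.
by move=> i; apply: mpowN; apply: mpow_word.
Qed.

End FlipPremutation.

(** * Non-degeneracy *)

Section NonDegenerate.
Context {V : finType} {K : fieldType}.
Implicit Types X Y Z : qp V K.

(** The image of an arrow has a nonzero linear part, otherwise its preimage under
    the inverse would have order two. *)
Lemma right_equivalent_arrow X Y : right_equivalent X Y ->
  forall a : arrow X, exists b : arrow Y, src b = src a /\ tgt b = tgt a.
Proof.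
move=> /right_equivalentP[phi [psi [[h1 h2 K1 K2] _]]] a.
have [b nz|all0] := pickP (fun b => acoef (phi (word [:: a])) b != 0).
  by exists b; apply: corner_acoef nz; apply: (corner_hom h1); apply: corner_arrow.
have h : mpow 2 (phi (word [:: a])).
  apply: mpow2P; first exact: (hom_arrow_mpow h1).
  by move=> b; apply/eqP; rewrite -[_ == _]negbK all0.
have := mpow2_acoef a (hom_mpow h2 h); rewrite K1 acoef_arrow eqxx => /eqP.
by rewrite oner_eq0.
Qed.

Lemma right_equivalent_no_2cycle X Y :
  right_equivalent X Y -> ~ has_2cycle Y -> ~ has_2cycle X.
Proof.
move=> h nY [a [b]]; rewrite is_cycle2 => /andP[/eqP e1 /eqP e2]; apply: nY.
have [a' [s1 t1]] := right_equivalent_arrow h a.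
have [b' [s2 t2]] := right_equivalent_arrow h b.
by exists a', b'; rewrite is_cycle2 t1 t2 s1 s2 e1 e2 !eqxx.
Qed.

Lemma reduced_part_right_equivalent X Y Z :
  right_equivalent X Y -> is_reduced_part Y Z -> is_reduced_part X Z.
Proof.
move=> h [Zred [T [Ttriv hT]]]; split=> //; exists T; split=> //.
exact: right_equivalent_trans h hT.
Qed.

Variables (D : finType) (sr : D -> V).
Hypothesis fiber2 : forall v, #|[set d | sr d == v]| = 2.
Variable R : nat -> K.
Hypothesis R0 : R 0%N = 0.

Definition dart_qp (f : D -> D) (x : D) : qp V K :=
  QP (dart_quiver sr f) (@pot_R V K (dart_quiver sr f) f R x).

Lemma dart_qp_base f x y : one_puncture_map sr f -> dart_qp f x = dart_qp f y.
Proof.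
move=> hf; rewrite /dart_qp; congr QP.
by rewrite !(pot_R_cyc fiber2 hf R _ x (froots_transversal hf)).
Qed.

(** Two premutations along the right equivalence are compared, and the base dart of
    the potential is moved to [k], where the flip is computed. *)
Lemma dart_mutation f x k Y Z : one_puncture_map sr f ->
  right_equivalent Y (dart_qp f x) -> is_mutation k Y Z ->
  exists2 f', one_puncture_map sr f' & right_equivalent Z (dart_qp f' x).
Proof.
move=> hf hY [no2 red].
have [d] : exists d, d \in [set d | sr d == k] by apply/card_gt0P; rewrite fiber2.
rewrite inE => ed; pose i0 : out_dart sr k := exist _ d ed.
exists (flip sr f k); first exact: flip_one_puncture.
rewrite (dart_qp_base x d (flip_one_puncture fiber2 hf k)).
apply: (reduced_premutation_flip fiber2 hf R0 (i0 := i0)).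
apply: reduced_part_right_equivalent red.
apply: premutation_right_equivalent.
- by move=> a /= e e'; apply: (no_loop_dart fiber2 hf (x := a)); rewrite e.
- move=> a e e'; apply: no2; exists a, a; split=> //.
  by rewrite is_cycle2 e e' eqxx.
apply: right_equivalent_sym.
by have := hY; rewrite (dart_qp_base x d hf).
Qed.

Theorem dart_qp_nondegenerate f x : one_puncture_map sr f ->
  nondegenerate_qp (dart_qp f x).
Proof.
move=> hf Y hY.
have [f' hf' hYf'] : exists2 f', one_puncture_map sr f' & right_equivalent Y (dart_qp f' x).
  elim: hY => [|k Y' Z _ [f' hf' hY'] hZ]; first by exists f => //; apply: right_equivalent_refl.
  exact: dart_mutation hf' hY' hZ.
apply: right_equivalent_no_2cycle hYf' _.
exact: (no_2cycle_dart fiber2 hf').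
Qed.

End NonDegenerate.

Section Triangulations.
Variable T : triangulation.
Hypothesis one_puncture : punctures T = 1%N.

Definition side_of (x : triangle T * 'I_3) := side x.1 x.2.

Lemma side_of_twice v : #|[set x | side_of x == v]| = 2.
Proof. exact: side_twice. Qed.

Lemma ordS3 (i : 'I_3) : ordS (ordS (ordS i)) = i.
Proof. by apply: val_inj; case: i => [[|[|[|i]]]]. Qed.

Lemma ordS3_neq (i : 'I_3) : ordS i != i.
Proof. by case: i => [[|[|[|i]]]]. Qed.

(** One orbit of [g_of] is what it means to have one puncture. *)
Lemma tri_f_one_puncture : one_puncture_map side_of (@tri_f T).
Proof.
have f3 x : @tri_f T (@tri_f T (@tri_f T x)) = x.
  by case: x => t i; rewrite /tri_f /= ordS3.
have f_inj : injective (@tri_f T) by move=> x y e; rewrite -(f3 x) e f3.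
have g_inj : injective (g_of (@tri_f T)).
  by apply: inj_comp f_inj; apply: (can_inj (barK side_of_twice)).
split=> // [[t i]|x y].
  by apply/eqP => -[e]; have := ordS3_neq i; rewrite e eqxx.
have sym := fconnect_sym g_inj.
rewrite -[fconnect _ _ _]/(fconnect (g_of (@tri_f T)) x y) -(root_connect sym).
apply/eqP; apply: (card_le1_eqP (A := [predI froots (g_of (@tri_f T)) & predT])).
- by rewrite -[X in (X <= _)%N]/(punctures T) one_puncture.
- by rewrite inE /= andbT; apply: roots_root.
by rewrite inE /= andbT; apply: roots_root.
Qed.

Theorem adjacency_nondegenerate (K : fieldType) (R : nat -> K)
    (a : arrow (adjacency_quiver T)) : R 0%N = 0 ->
  nondegenerate_qp (QP (adjacency_quiver T) (pot_R (@tri_f T) R a)).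
Proof.
move=> R0.
exact (@dart_qp_nondegenerate _ _ _ _ side_of_twice R R0 _ a tri_f_one_puncture).
Qed.

End Triangulations.

(** * Cyclic derivatives *)

Section CyclicDerivatives.
Context {V D : finType} {K : fieldType}.
Variable sr : D -> V.
Hypothesis fiber2 : forall v, #|[set d | sr d == v]| = 2.
Variable f : D -> D.
Hypothesis hf : one_puncture_map sr f.
Variable a0 : D.
Local Notation Q := (dart_quiver sr f).
Local Notation g := (fun d => bar sr (f d)).
Local Notation N := #|D|.
Local Notation wq s := (@word V K Q s).

Let N6 : (5 < N)%N. Proof. exact: (card_ge6 fiber2 hf a0). Qed.

Lemma iter_gM m x : iter (m * N) g x = x.
Proof. by elim: m => [//|m IH]; rewrite mulSn iterD IH (iter_g fiber2 hf). Qed.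

Lemma iter_g_fix i x : (iter i g x == x) = (N %| i)%N.
Proof.
have N0 : (0 < N)%N by apply: leq_trans N6.
rewrite {1}(divn_eq i N) addnC iterD iter_gM /dvdn.
have := uniq_traject_g hf x; have lt : (i %% N < N)%N by rewrite ltn_mod.
case: N N0 lt => // n _ lt u.
have := nth_uniq x _ _ u; rewrite size_traject => /(_ (i %% n.+1)%N 0%N lt isT).
by rewrite !nth_traject.
Qed.

Lemma rot_traject i m x : (i <= m * N)%N ->
  rot i (traject g x (m * N)) = traject g (iter i g x) (m * N).
Proof.
move=> le_i.
have -> : traject g x (m * N) =
    traject g x i ++ traject g (iter i g x) (m * N - i).
  by rewrite -trajectD subnKC.
have -> : traject g (iter i g x) (m * N) =
    traject g (iter i g x) (m * N - i) ++ traject g x i.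
  by rewrite -[in LHS](subnK le_i) trajectD -iterD subnK // iter_gM.
by rewrite /rot drop_size_cat ?size_traject // take_size_cat ?size_traject.
Qed.

Lemma mem_rotations_traject m x (c : seq D) : (0 < m)%N ->
  (c \in rotations (traject g x (m * N))) = (c == traject g (head a0 c) (m * N)).
Proof.
move=> m0; have mN : (0 < m * N)%N by rewrite muln_gt0 m0 (leq_trans _ N6).
apply/idP/eqP => [/rotationsP[i]|].
  rewrite size_traject => lt_i ->; rewrite rot_traject ?(ltnW lt_i) //.
  by case: (m * N)%N mN.
set y := head _ _ => ->; have /trajectP[i lt_i ->] := mem_traject_g hf x y.
rewrite -(rot_traject x (m := m) (i := i)); first by apply: mem_rot_rotations; case: (m * N)%N mN.
by apply: leq_trans (ltnW lt_i) _; rewrite leq_pmull.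
Qed.

Lemma count_dvdn m n : (0 < n)%N -> count (dvdn n) (iota 0 (m * n)) = m.
Proof.
move=> n0; elim: m => [//|m IH]; rewrite mulSn addnC iotaD count_cat IH add0n.
rewrite -[X in iota X n]addn0 iotaDl count_map.
rewrite (@eq_count _ _ (dvdn n)) => [|i /=]; last by rewrite dvdn_addr ?dvdn_mull.
case: n n0 {IH} => // n _.
rewrite (_ : iota 0 n.+1 = 0%N :: iota 1 n) // -cat1s count_cat [count _ [:: _]]/=.
rewrite (_ : count _ _ = 0)%N ?addn1 //.
apply/eqP; rewrite -leqn0 leqNgt -has_count; apply/hasPn => i.
by rewrite mem_iota => /andP[h1 h2]; rewrite gtnNdvd.
Qed.

Lemma word_traject_exp m : @omega V K Q f a0 ^+ m = wq (traject g a0 (m * N)).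
Proof.
elim: m => [|m IH]; first by rewrite expr0 mul0n word_nil.
rewrite exprS IH mulSn trajectD (iter_g fiber2 hf) -word_cat; congr (_ * _).
Qed.

Lemma psubst_R_ m : psubst (@R_ K m) (@omega V K Q f a0) =
  if m is 0%N then 0 else wq (traject g a0 (m * N)).
Proof.
have om1 : mpow 1 (@omega V K Q f a0).
  by apply: mpow_word; rewrite size_traject; apply: leq_trans N6.
apply: cpaP => v s _; rewrite wcoef_psubst; case: m => [|m].
  by rewrite wcoef0 big1 // => i _; rewrite mul0r.
rewrite -word_traject_exp; have [le_m|lt_s] := leqP m.+1 (size s).
  rewrite (bigD1 (Ordinal (le_m : (m.+1 < (size s).+1)%N))) //= big1 => [|i ne].
    by rewrite /R_ eqxx mul1r addr0.
  rewrite /R_ /=; case: eqP => [e|_]; last by rewrite mul0r.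
  by case/eqP: ne; apply: val_inj.
rewrite (mpowX om1) // big1 // => i _; rewrite /R_ /=.
case: eqP => [e|_]; last by rewrite mul0r.
by have := ltn_ord i; rewrite e ltnS leqNgt lt_s.
Qed.

Definition W m : potential K Q := @pot_R V K Q f (@R_ K m) a0.

Lemma W_coef m (c : seq D) : is_cycle (c : seq (arrow Q)) -> W m c =
  [exists b, c == tri f b]%:R - ((0 < m)%N && (c == traject g (head a0 c) (m * N)))%:R.
Proof.
move=> cc; rewrite /W (pot_R_cyc fiber2 hf _ a0 a0 (froots_transversal hf)) cycD cycN.
rewrite (cyc_tri_sum hf _ (froots_transversal hf)) addrC; congr (_ - _).
rewrite psubst_R_; case: m => [|m]; first by rewrite cyc0.
rewrite cyc_word cc /= -(mem_rotations_traject a0) //.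
by congr (_%:R); congr nat_of_bool; apply/idP/idP => /rotations_sym.
Qed.

Lemma is_walk_gpath x n : is_walk (sr x) (traject g x n : seq (arrow Q)).
Proof.
elim: n x => [//|n IH] x /=; rewrite eqxx /=.
by rewrite -(sr_bar fiber2 (f x)); apply: IH.
Qed.

Lemma walk_end_gpath x n : walk_end (sr x) (traject g x n : seq (arrow Q)) = sr (iter n g x).
Proof.
elim: n x => [//|n IH] x; rewrite /= walk_end_cons /= -(sr_bar fiber2 (f x)) IH.
by rewrite -iterSr.
Qed.

(** The turn repeated [m] times is invariant under [m] of its rotations, which is
    where the factor [m] comes from. *)
Lemma deriv_W m (al : D) : deriv_pot (W m) (al : arrow Q) =
  wq [:: f al; f (f al)] - m%:R *: wq (traject g (g al) (m * N).-1).
Proof.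
apply: cpaP => v u w; rewrite wcoefB wcoefZ !wcoef_word w !andTb.
rewrite (wcoef_walk _ w) /deriv_pot -[qstart _]/v -[qword _]/u -[tgt (al : arrow Q)]/(sr (f al)).
have [ev|nv] := eqVneq v (sr (f al)); last first.
  have [e|_] := eqVneq u [:: f al; f (f al)].
    by case/eqP: nv; move: w; rewrite e => /= /andP[/eqP].
  case: m => [|m]; first by rewrite mul0r subr0.
  have mN : (1 < m.+1 * N)%N by rewrite (leq_trans _ (leq_pmull _ _)) // (leq_trans _ N6).
  have [e|_] := eqVneq u _; last by rewrite mulr0 subr0.
  case/eqP: nv; move: w; rewrite e; case: (m.+1 * N)%N mN => [|[|n]] //= _.
  by rewrite (sr_bar fiber2) => /andP[/eqP].
set c := al :: u; have [cc|nc] := boolP (is_cycle (c : seq (arrow Q))); last first.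
  rewrite pcoef_cycle // mul0rn.
  have [e|_] := eqVneq u [:: f al; f (f al)].
    by move: nc; rewrite /c e (is_cycle_tri hf al).
  case: m => [|m]; first by rewrite mul0r subr0.
  have mN : (1 < m.+1 * N)%N by rewrite (leq_trans _ (leq_pmull _ _)) // (leq_trans _ N6).
  have [e|_] := eqVneq u _; last by rewrite mulr0 subr0.
  move: nc; have -> : c = traject g al (m.+1 * N).
    by rewrite /c e; case: (m.+1 * N)%N mN.
  have := iter_gM m.+1 al; have := is_walk_gpath al (m.+1 * N).
  have := walk_end_gpath al (m.+1 * N); case: (m.+1 * N)%N mN => // n _ e1 e2 e3.
  by rewrite [traject _ _ _]/= is_cycle_walk e2 /= e1 e3 eqxx.
pose cnt := count (fun i => rot i c == c) (iota 0 (size c)).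
rewrite W_coef // -/cnt [head _ _]/=.
have -> : [exists b, c == tri f b] = (u == [:: f al; f (f al)]).
  rewrite /c; apply/existsP/eqP => [[b /eqP[e1 ->]]|->]; first by rewrite e1.
  by exists al.
have cE : (0 < m)%N -> (c == traject g al (m * N)) = (u == traject g (g al) (m * N).-1).
  move=> m0; have : (0 < m * N)%N by rewrite muln_gt0 m0 (leq_trans _ N6).
  by case: (m * N)%N => // n _; rewrite /= eqseq_cons eqxx.
have [e|ne] := eqVneq u [:: f al; f (f al)].
  have -> : (0 < m)%N && (c == traject g al (m * N)) = false.
    apply/andP => -[m0 /eqP/(congr1 size)]; rewrite size_traject /c e /= => e3.
    by have := leq_pmull N m0; move: N6; rewrite -e3; lia.
  rewrite subr0 (_ : _ == traject g _ _ = false) ?andbF ?mulr0 ?subr0; last first.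
    apply/eqP => /(congr1 size); rewrite size_traject; case: (m) => [|k]; rewrite e => e3; first by move: e3; rewrite mul0n.
    by have := leq_pmull N (ltn0Sn k); move: N6 e3; rewrite /= mulSn; lia.
  have := uniq_tri hf al; rewrite /cnt /c e /= !inE => /and3P[/norP[n1 n2] _ _].
  by rewrite /rot /= !eqseq_cons eq_sym (negPf n1) [f (f al) == al]eq_sym (negPf n2) !eqxx.
case: (posnP m) => [-> |m0]; first by rewrite mul0r subrr mul0rn.
rewrite cE //; have [e|_] := eqVneq u _; last by rewrite mulr0 subrr mul0rn.
have ec : c = traject g al (m * N) by apply/eqP; rewrite cE // e.
have -> : cnt = m.
  rewrite /cnt ec size_traject -[RHS](count_dvdn m (n := N)) ?(leq_trans _ N6) //.
  apply: eq_in_count => i; rewrite mem_iota add0n => /andP[_ lt_i].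
  rewrite rot_traject ?(ltnW lt_i) // -(iter_g_fix _ al).
  by case: (m * N)%N lt_i => // k _; rewrite /= eqseq_cons; apply/andP/eqP => [[/eqP]|->].
by rewrite mulr1 !sub0r mulNrn.
Qed.

End CyclicDerivatives.

(** * Closed ideals and embeddings of quotients *)

Section ClosedIdeals.
Context {V : finType} {K : fieldType} {Q : quiver V}.
Variable S : set (cpa K Q).
Local Notation A := (cpa K Q).
Implicit Types x y z : A.

(** Membership in the ideal up to order [n]: the closed ideal consists of the
    elements for which this holds for all [n]. *)
Definition in_ideal_mod n x := exists2 z, ideal_generated S z & mpow n (x - z).

Lemma in_ideal_mod_mpow n x : mpow n x -> in_ideal_mod n x.
Proof. by move=> hx; exists 0; [apply: ideal_generated0 | rewrite subr0]. Qed.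

Lemma in_ideal_mod_ideal n x : ideal_generated S x -> in_ideal_mod n x.
Proof. by move=> hx; exists x => //; rewrite subrr; apply: mpow0. Qed.

Lemma in_ideal_mod_le m n x : (m <= n)%N -> in_ideal_mod n x -> in_ideal_mod m x.
Proof. by move=> le_mn [z hz hx]; exists z => //; apply: mpow_le hx. Qed.

Lemma in_ideal_modD n x y :
  in_ideal_mod n x -> in_ideal_mod n y -> in_ideal_mod n (x + y).
Proof.
move=> [z hz hx] [t ht hy]; exists (z + t); first exact: ideal_generatedD.
by rewrite opprD addrACA; apply: mpowD.
Qed.

Lemma in_ideal_modM m n x y :
  in_ideal_mod m x -> in_ideal_mod n y -> in_ideal_mod (m + n) (x * y).
Proof.
move=> [z hz hx] [t ht hy]; exists (z * y + (x - z) * t).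
  by apply: ideal_generatedD; [apply: ideal_generatedMr | apply: ideal_generatedMl].
rewrite opprD addrA -mulrBl -mulrBr; exact (mpowM hx hy).
Qed.

Lemma in_ideal_modZ n c x : in_ideal_mod n x -> in_ideal_mod n (c *: x).
Proof.
move=> [z hz hx]; exists (c *: z).
  by rewrite -[z]mul1r cpa_scaleAl; apply: ideal_generatedMl.
by rewrite -scalerBr; apply: mpowZ.
Qed.

Lemma in_ideal_mod_sum n I (r : seq I) (F : I -> A) :
  (forall i, in_ideal_mod n (F i)) -> in_ideal_mod n (\sum_(i <- r) F i).
Proof.
move=> hF; apply: big_ind => //; first by apply: in_ideal_mod_mpow; apply: mpow0.
by move=> x y; apply: in_ideal_modD.
Qed.

Lemma homogeneous_part n x : mpow n.+1 x -> mpow n.+2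
  (x - \sum_(w : n.+1.-tuple (arrow Q)) word_coef x w *: word w).
Proof.
move=> hx; have := truncated_expansion x (n := n.+1).
rewrite cst_mpow1 ?add0r; last exact: mpow_le hx.
rewrite big_ord_recr /= [X in x - (X + _)]big1 ?add0r // => j _.
rewrite big1 // => w _; case: (tupleP w) => a w' /=.
by rewrite word_coefE hx ?scale0r // /= size_tuple ltnS.
Qed.

(** If the paths of length [n] lie in the ideal up to longer paths, then this
    can be iterated: the [n]-th power of the arrow ideal lies in the closure of
    the ideal. *)
Lemma mpow_closed_ideal n x :
  (forall s : seq (arrow Q), size s = n.+1 -> in_ideal_mod n.+2 (word s)) ->
  mpow n.+1 x -> x \in closed_ideal S.
Proof.
move=> hw hx; apply/closed_idealP => k.
have hw' (s : seq (arrow Q)) j : size s = (j + n.+1)%N -> in_ideal_mod (size s).+1 (word s).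
  move=> es; rewrite -(cat_take_drop n.+1 s) -word_cat.
  have e1 : size (take n.+1 s) = n.+1 by rewrite size_takel // es leq_addl.
  have -> : (size (take n.+1 s ++ drop n.+1 s)).+1 = (n.+2 + size (drop n.+1 s))%N.
    by rewrite size_cat e1.
  apply: in_ideal_modM; first exact: hw.
  by apply: in_ideal_mod_mpow; apply: mpow_word.
have [z hz hxz] : in_ideal_mod (k + n.+1) x.
  elim: k => [|k [z hz hxz]]; first exact: in_ideal_mod_mpow.
  rewrite -[x](subrK z); apply: in_ideal_modD; last exact: in_ideal_mod_ideal.
  move: (x - z) hxz => y hy; rewrite addSn addnS in hy *.
  have hy' := homogeneous_part hy.
  rewrite -[y](subrK (\sum_(w : (k + n).+1.-tuple (arrow Q)) word_coef y w *: word w)).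
  apply: in_ideal_modD; first exact: in_ideal_mod_mpow.
  apply: in_ideal_mod_sum => w; apply: in_ideal_modZ.
  by have := hw' w k; rewrite size_tuple addnS; apply.
exists z => // p lt_p; apply/eqP; rewrite -subr_eq0; apply/eqP.
have := hxz (qstart p) (qword p); rewrite wcoefB -!wcoef_path => -> //.
by rewrite ltn_addr.
Qed.

(** A linear form that ignores long paths and vanishes on the products
    [x * d * y], for [d] a generator, vanishes on the closed ideal. *)
Lemma closed_ideal_form (theta : A -> K) n x :
  {morph theta : x y / x + y} -> (forall x, mpow n x -> theta x = 0) ->
  (forall x d y, S d -> theta (x * (d * y)) = 0) ->
  x \in closed_ideal S -> theta x = 0.
Proof.
move=> tD tn tS /closed_idealP/(_ n)[y [s hs ->] hxy].
have hd : mpow n (x - \sum_(t <- s) t.1.1 * t.1.2 * t.2).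
  move=> v u lt_u; have [w|nw] := boolP (is_walk v u); last by rewrite wcoef_nwalk.
  by rewrite wcoefB !(wcoef_walk _ w) hxy ?subrr.
rewrite -[x](subrK (\sum_(t <- s) t.1.1 * t.1.2 * t.2)) tD (tn _ hd) add0r.
elim: s hs {hxy hd} => [|t s IH] hs; first by rewrite big_nil tn //; apply: mpow0.
rewrite big_cons tD -mulrA tS ?add0r ?IH // => [u hu|].
  by apply: hs; rewrite inE hu orbT.
by apply: hs; rewrite inE eqxx.
Qed.

Lemma closed_ideal_mpow1 x :
  (forall d, S d -> mpow 1 d) -> x \in closed_ideal S -> mpow 1 x.
Proof.
move=> hS hx; apply: mpow1P => v.
apply: (closed_ideal_form (theta := fun x => wcoef x v [::]) (n := 1)) hx => [||y d z hd].
- by move=> ? ?; rewrite wcoefD.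
- by move=> ? h; apply: h.
- by have /(_ v [::] isT) := mpowMl y (leqnn 1) (mpowMr z (leqnn 1) (hS d hd)).
Qed.

End ClosedIdeals.

Section Projection.
Context {V : finType} {K : fieldType} {Q : quiver V} (S : set (cpa K Q)).

Definition cpa_proj (x : cpa K Q) : cpa_quot S := \pi_(cpa_quot S)%qT x.

Lemma cpa_projM x y : cpa_proj (x * y) = cpa_proj x * cpa_proj y.
Proof. exact: Defs.pi_mul. Qed.

Lemma cpa_proj0 : cpa_proj 0 = 0.
Proof.
apply: (addrI (cpa_proj 0)); rewrite addr0 -[in RHS](addr0 0).
exact/esym/Defs.pi_add.
Qed.

Lemma cpa_proj_eq0 x : (cpa_proj x == 0) = (x \in closed_ideal S).
Proof. by rewrite -cpa_proj0 eq_pi subr0. Qed.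

Lemma cpa_proj_surj z : exists x, z = cpa_proj x.
Proof. by exists (repr z); rewrite /cpa_proj reprK. Qed.

End Projection.

(** In a quiver without loops each arrow squares to zero, so a morphism of
    quotient rings sends it into the arrow ideal, and paths of length [n] into
    its [n]-th power.  This bounds the length of the nonzero paths in a ring
    embedded in a quotient where some power of the arrow ideal vanishes. *)
Lemma embedding_kills_long_words (V V' : finType) (K : fieldType)
    (Q : quiver V) (Q' : quiver V') (S : set (cpa K Q)) (S' : set (cpa K Q'))
    (phi : cpa_quot S' -> cpa_quot S) n (s : seq (arrow Q')) :
  {morph phi : x y / x * y} -> phi 1 = 1 -> phi 0 = 0 -> injective phi ->
  (forall a : arrow Q', word [:: a; a] = 0 :> cpa K Q') ->
  (forall d, S d -> mpow 1 d) ->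
  (forall x, mpow n x -> x \in closed_ideal S) ->
  (n <= size s)%N -> word s \in closed_ideal S'.
Proof.
move=> pM p1 p0 pI noloop hS hn le_n.
have harrow a : exists2 y, mpow 1 y & phi (cpa_proj S' (word [:: a])) = cpa_proj S y.
  have [y ey] := cpa_proj_surj (phi (cpa_proj S' (word [:: a]))).
  exists y => //; have yy : y * y \in closed_ideal S.
    by rewrite -cpa_proj_eq0 cpa_projM -ey -pM -cpa_projM word_cat noloop cpa_proj0 p0.
  have := closed_ideal_mpow1 hS yy => h; apply: mpow1P => v.
  have := h v [::] isT; rewrite wcoefM big_ord1 /= => /eqP.
  by rewrite mulf_eq0 orbb => /eqP.
have [z hz ez] : exists2 z, mpow (size s) z & phi (cpa_proj S' (word s)) = cpa_proj S z.
  elim: s {le_n} => [|a s [z hz ez]]; first by exists 1 => //; rewrite word_nil.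
  have [y hy ey] := harrow a; exists (y * z); first exact (mpowM hy hz).
  by rewrite -(word_cat [:: a]) !cpa_projM pM ey ez.
rewrite -cpa_proj_eq0; apply/eqP/pI; rewrite p0 ez; apply/eqP.
by rewrite cpa_proj_eq0; apply: hn; apply: mpow_le hz.
Qed.

(** * Lengths of the nonzero paths in the Jacobian algebras *)

Section SandwichedWords.
Context {V : finType} {K : fieldType} {Q : quiver V}.
Implicit Types x y : cpa K Q.

Lemma wcoef_wordM u y v s : wcoef (word u * y) v s =
  if is_walk v s && (take (size u) s == u)
  then wcoef y (walk_end v u) (drop (size u) s) else 0.
Proof.
have [w|nw] := boolP (is_walk v s); last by rewrite wcoef_nwalk.
rewrite wcoefM /=; case: eqP => [e|ne].
  have le_u : (size u <= size s)%N by rewrite -{1}e size_take_min geq_minr.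
  rewrite (bigD1 (Ordinal (le_u : (size u < (size s).+1)%N))) //= big1 => [|i ni].
    rewrite e wcoef_word eqxx andbT addr0.
    have -> : is_walk v u by move: w; rewrite -(cat_take_drop (size u) s) is_walk_cat e => /andP[].
    by rewrite mul1r.
  rewrite wcoef_word; case: eqP => [e'|_]; last by rewrite andbF mul0r.
  case/eqP: ni; apply: val_inj => /=; rewrite -e' size_takel // -ltnS; exact: ltn_ord.
rewrite big1 // => i _; rewrite wcoef_word; case: eqP => [e'|_]; last by rewrite andbF mul0r.
by case: ne; rewrite -e' size_takel // -ltnS; apply: ltn_ord.
Qed.

Lemma wcoef_sandwich_eq0 x u y v s :
  (forall i, take (size u) (drop i s) != u) -> wcoef (x * (word u * y)) v s = 0.
Proof.
move=> h; rewrite wcoefM big1 // => i _.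
by rewrite wcoef_wordM (negPf (h i)) andbF mulr0.
Qed.

(** A path one step longer than [u] contains [u] at most as a prefix and as a
    suffix. *)
Lemma wcoef_sandwich x u y v s : size s = (size u).+1 -> is_walk v s ->
  wcoef (x * (word u * y)) v s =
    (if take (size u) s == u
     then wcoef x v [::] * wcoef y (walk_end v u) (drop (size u) s) else 0) +
    (if drop 1 s == u
     then wcoef x v (take 1 s) * wcoef y (walk_end v s) [::] else 0).
Proof.
move=> es w; rewrite wcoefM es !big_ord_recl big1 ?addr0 => [|i _].
  rewrite /= take0 drop0 !wcoef_wordM w /=; congr (_ + _).
    by case: eqP; rewrite ?mulr0.
  have w1 := w; rewrite -(cat_take_drop 1 s) is_walk_cat in w1.
  have /andP[_ ->] := w1; have ed : size (drop 1 s) = size u by rewrite size_drop es subn1.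
  rewrite andTb (_ : bump 0 0 = 1%N) // [take (size u) _]take_oversize ?ed //.
  have [e|_] := eqVneq (drop 1 s) u; last by rewrite mulr0.
  rewrite [drop (size u) _]drop_oversize ?ed //; congr (_ * wcoef y _ _).
  by rewrite -{2}(cat_take_drop 1 s) e /walk_end map_cat last_cat.
rewrite wcoef_wordM; case: eqP => [e|_]; last by rewrite andbF mulr0.
have := congr1 size e; rewrite size_take_min size_drop es /bump /= => e'.
by have := ltn_ord i; move: e'; rewrite /bump !leq0n; lia.
Qed.

End SandwichedWords.

Section OnePuncture.
Context {V D : finType} {K : fieldType}.
Variable sr : D -> V.
Hypothesis fiber2 : forall v, #|[set d | sr d == v]| = 2.
Variable f : D -> D.
Hypothesis hf : one_puncture_map sr f.
Variable a0 : D.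
Local Notation Q := (dart_quiver sr f).
Local Notation g := (fun d => bar sr (f d)).
Local Notation N := #|D|.
Local Notation wq s := (@word V K Q s).
Implicit Types x y : cpa K Q.

Let ff (d : D) : f (f (f d)) = d. Proof. exact: (f3 hf). Qed.
Let N6 : (5 < N)%N. Proof. exact: (card_ge6 fiber2 hf a0). Qed.

(** Summing over all rotations of a cyclic path, the prefix and the suffix
    occurrences of a given complement of an arrow contribute the same amount for
    triangles and for turns. *)
Lemma sandwich_cycle_sum (h : D -> D) (u : D -> seq D) n x y b :
  injective h -> injective u -> (forall d, size (u d) = n) ->
  (forall d, sr (h d) = sr (f d)) -> (forall d, h d :: u (h d) = rcons (u d) d) ->
  (forall d, is_walk (sr d) (d :: u d : seq (arrow Q))) ->
  (forall d, walk_end (sr d) (d :: u d : seq (arrow Q)) = sr d) ->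
  \sum_d wcoef (x * (wq (u b) * y)) (sr d) (d :: u d : seq (arrow Q)) =
    wcoef x (sr (h b)) [::] * wcoef y (sr b) [:: b : arrow Q] +
    wcoef x (sr b) [:: b : arrow Q] * wcoef y (sr b) [::].
Proof.
move=> h_inj u_inj su sh hu wu eu.
pose c d : seq (arrow Q) := d :: u d.
rewrite (eq_bigr (fun d =>
    (if take n (c d) == u b
     then wcoef x (sr d) [::] * wcoef y (walk_end (sr d) (u b : seq (arrow Q))) (drop n (c d))
     else 0) +
    (if u d == u b
     then wcoef x (sr d) [:: d : arrow Q] * wcoef y (sr d) [::] else 0))); last first.
  by move=> d _; rewrite wcoef_sandwich ?eu ?wu ?su ?drop1 /c /= ?su ?take0.
rewrite /c big_split /=; congr (_ + _).
  rewrite (reindex_inj h_inj) (bigD1 b) //= big1 ?addr0 => [|d nd].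
    rewrite -(su b) hu -cats1 take_size_cat // eqxx drop_size_cat //.
    by rewrite sh -[in RHS](eu b).
  by rewrite -(su d) hu -cats1 take_size_cat // (inj_eq u_inj) (negPf nd).
rewrite (bigD1 b) //= eqxx big1 ?addr0 // => d nd.
by rewrite (inj_eq u_inj) (negPf nd).
Qed.

Lemma tri_sandwich x y b :
  \sum_d wcoef (x * (wq [:: f b; f (f b)] * y)) (sr d) (tri f d : seq (arrow Q)) =
    wcoef x (sr (f b)) [::] * wcoef y (sr b) [:: b : arrow Q] +
    wcoef x (sr b) [:: b : arrow Q] * wcoef y (sr b) [::].
Proof.
apply: (@sandwich_cycle_sum f (fun d => [:: f d; f (f d)]) 2) => //.
- exact: f_inj hf.
- by move=> d e [/(f_inj hf)].
- by move=> d; rewrite ff.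
- by move=> d; rewrite /= !eqxx.
- by move=> d; rewrite /walk_end /= ff.
Qed.

Lemma gpath_sandwich m x y b : (0 < m)%N ->
  \sum_d wcoef (x * (wq (traject g (g b) (m * N).-1) * y)) (sr d)
           (traject g d (m * N) : seq (arrow Q)) =
    wcoef x (sr (f b)) [::] * wcoef y (sr b) [:: b : arrow Q] +
    wcoef x (sr b) [:: b : arrow Q] * wcoef y (sr b) [::].
Proof.
move=> m0; have mN : (1 < m * N)%N.
  by apply: leq_trans (leq_pmull _ m0); apply: leq_trans N6.
have ec d : traject g d (m * N) = d :: traject g (g d) (m * N).-1.
  by case: (m * N)%N mN.
have ec' d : traject g (g d) (m * N) = rcons (traject g (g d) (m * N).-1) d.
  have := iter_gM fiber2 hf m d; case: (m * N)%N mN => // n _ e.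
  by rewrite trajectSr -iterSr e.
under eq_bigr => d _ do rewrite ec.
rewrite -[sr (f b)](sr_bar fiber2).
apply: (@sandwich_cycle_sum g (fun d => traject g (g d) (m * N).-1) (m * N).-1) => //.
- exact (g_inj fiber2 hf).
- move=> d e /(congr1 (head a0)); case: (m * N)%N mN => [|[|n]] //= _.
  by move/(g_inj fiber2 hf).
- by move=> d; rewrite size_traject.
- by move=> d; rewrite sr_bar.
- by move=> d; rewrite -ec ec'.
- by move=> d; rewrite -ec; apply: is_walk_gpath fiber2 _ _ _.
- by move=> d; rewrite -ec walk_end_gpath // iter_gM.
Qed.

(** A path along [g] never continues along [f]. *)
Lemma gpath_no_turn b d n i :
  take 2 (drop i (traject g d n)) != [:: f b; f (f b)].
Proof.
have -> : drop i (traject g d n) = traject g (iter i g d) (n - i).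
  have [le_i|lt_i] := leqP i n.
    by rewrite -{1}(subnKC le_i) trajectD drop_size_cat ?size_traject.
  by rewrite (eqP (ltnW lt_i : (n - i == 0)%N)) drop_oversize ?size_traject // ltnW.
case: (n - i)%N => [|[|k]] //=; apply/eqP => -[e1] // e _.
by have := bar_neq fiber2 (f (f b)); rewrite -{2}e e1 eqxx.
Qed.

(** The form [theta] reads off [m] times the triangles and once the turns of
    length [m * N] around the puncture; the relations identify [m] such turns
    with triangles, and these two contributions cancel. *)
Definition theta m x : K :=
  \sum_d (m%:R * wcoef x (sr d) (tri f d : seq (arrow Q)) +
          wcoef x (sr d) (traject g d (m * N) : seq (arrow Q))).

Lemma thetaE m x : theta m x =
  m%:R * (\sum_d wcoef x (sr d) (tri f d : seq (arrow Q))) +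
  \sum_d wcoef x (sr d) (traject g d (m * N) : seq (arrow Q)).
Proof. by rewrite /theta big_split mulr_sumr. Qed.

Lemma thetaD m : {morph theta m : x y / x + y}.
Proof.
move=> x y; rewrite /theta -big_split; apply: eq_bigr => d _.
by rewrite !wcoefD mulrDr addrACA.
Qed.

Lemma theta_mpow m x : (0 < m)%N -> mpow (m * N).+1 x -> theta m x = 0.
Proof.
move=> m0 hx; rewrite /theta big1 // => d _.
rewrite !hx ?mulr0 ?addr0 ?size_traject //.
by rewrite ltnS; apply: leq_trans (leq_pmull N m0); apply: leq_trans N6.
Qed.

Lemma theta_deriv m x (a : D) y : (0 < m)%N ->
  theta m (x * (deriv_pot (W (K := K) sr f a0 m) (a : arrow Q) * y)) = 0.
Proof.
move=> m0; rewrite deriv_W // mulrBl mulrBr -cpa_scaleAl -cpa_scaleAr.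
have tN z : theta m (- z) = - theta m z.
  apply/eqP; rewrite -addr_eq0 -thetaD addNr; apply/eqP.
  by apply: theta_mpow => //; apply: mpow0.
have tZ c z : theta m (c *: z) = c * theta m z.
  by rewrite /theta mulr_sumr; apply: eq_bigr => d _; rewrite !wcoefZ mulrDr mulrCA.
have S1 : \sum_d wcoef (x * (wq [:: f a; f (f a)] * y)) (sr d)
    (traject g d (m * N) : seq (arrow Q)) = 0.
  by apply: big1 => d _; apply: wcoef_sandwich_eq0 => i; apply: gpath_no_turn.
have S2 : \sum_d wcoef (x * (wq (traject g (g a) (m * N).-1) * y)) (sr d)
    (tri f d : seq (arrow Q)) = 0.
  apply: big1 => d _; apply: wcoef_sandwich_eq0 => i; apply/eqP => /(congr1 size).
  rewrite size_take_min size_drop size_traject -[size (tri f d)]/3%N => e.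
  by have := leq_pmull N m0; move: N6 e; rewrite /minn; case: ifP; lia.
by rewrite thetaD tN tZ !thetaE tri_sandwich gpath_sandwich // S1 S2 mulr0 addr0 add0r subrr.
Qed.

Local Notation potW := (W (K := K) sr f a0).
Local Notation relations m := (range (deriv_pot (potW m))).

Lemma relations_mpow1 m d : relations m d -> mpow 1 d.
Proof.
move=> [a _ <-]; rewrite deriv_W //; apply: mpowB; first by apply: mpow_word.
case: m => [|m]; first by rewrite scale0r; apply: mpow0.
apply: mpowZ; apply: mpow_word; rewrite size_traject.
by have := leq_pmull N (ltn0Sn m); move: N6; lia.
Qed.

Lemma word_gpath_survives m : (0 < m)%N ->
  wq (traject g a0 (m * N)) \notin closed_ideal (relations m).
Proof.
move=> m0; apply/negP => h.
have /eqP : theta m (wq (traject g a0 (m * N))) = 0.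
  apply: (closed_ideal_form (theta := theta m) (n := (m * N).+1)) h => [|x|x d y [a _ <-]].
  - exact: thetaD.
  - exact: theta_mpow.
  - exact: theta_deriv.
rewrite thetaE.
have -> : \sum_d wcoef (wq (traject g a0 (m * N))) (sr d) (tri f d : seq (arrow Q)) = 0.
  apply: big1 => d _; rewrite wcoef_word; case: eqP => [e|_]; last by rewrite andbF.
  have := congr1 size e; rewrite size_traject -[size (tri f d)]/3%N => e3.
  by have := leq_pmull N m0; move: N6; rewrite -e3; lia.
rewrite mulr0 add0r (bigD1 a0) //= big1 => [|d nd].
  by rewrite wcoef_word eqxx andbT (is_walk_gpath fiber2) addr0 oner_eq0.
rewrite wcoef_word; case: eqP => [e|_]; last by rewrite andbF.
case/eqP: nd; have := congr1 (head a0) e.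
have : (0 < m * N)%N by rewrite muln_gt0 m0 (leq_trans _ N6).
by case: (m * N)%N.
Qed.

Lemma word_gpath_survives0 n :
  wq (traject g a0 n) \notin closed_ideal (relations 0).
Proof.
apply/negP => h.
have /eqP : wcoef (wq (traject g a0 n)) (sr a0) (traject g a0 n : seq (arrow Q)) = 0.
  apply: (closed_ideal_form (n := n.+1)
    (theta := fun x => wcoef x (sr a0) (traject g a0 n : seq (arrow Q)))) h
    => [x y|x hx|x d y [a _ <-]]; first by rewrite wcoefD.
    by apply: hx; rewrite size_traject.
  rewrite deriv_W // scale0r subr0; apply: wcoef_sandwich_eq0 => i.
  exact: gpath_no_turn.
by rewrite wcoef_word eqxx andbT (is_walk_gpath fiber2) oner_eq0.
Qed.

(** At every step a path continues along [f] or along [g]. *)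
Lemma walk_turn (s : seq D) v : is_walk v (s : seq (arrow Q)) ->
  s = traject g (head a0 s) (size s) \/
  exists s1 b s2, s = s1 ++ [:: b; f b] ++ s2.
Proof.
elim: s v => [|b [|c s] IH] v; [by left | by left | move=> /andP[_ w]].
have ec : sr c = sr (f b) by case/andP: w => /eqP.
have [e|ne] := fiber_cases fiber2 ec; first by right; exists [::], b, s; rewrite e.
have [es|[s1 [d [s2 ->]]]] := IH _ w; last by right; exists (b :: s1), d, s2.
by left; rewrite es /= size_traject; congr (_ :: _); rewrite ne.
Qed.

(** By the relation, two consecutive darts of a triangle equal a long path. *)
Lemma turn_in_ideal_mod m b : (0 < m)%N ->
  in_ideal_mod (relations m) (m * N).-1 (wq [:: b; f b]).
Proof.
move=> m0; have := deriv_W fiber2 hf a0 m (f (f b)) (K := K); rewrite ff => e.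
exists (deriv_pot (potW m) (f (f b) : arrow Q)).
  exists [:: (1, deriv_pot (potW m) (f (f b) : arrow Q), 1)].
    by move=> t; rewrite inE => /eqP -> /=; exists (f (f b) : arrow Q).
  by rewrite big_seq1 /= mul1r mulr1.
rewrite e opprB addrC subrK; apply: mpowZ; apply: mpow_word.
by rewrite size_traject.
Qed.

(** A path longer than [m] turns around the puncture either leaves the turn, and
    then its factor [b (f b)] is equal to a long path modulo the relations, or it
    is a turn closed up by its first arrow, and then [m] times it is a product of
    two such factors. *)
Lemma word_in_ideal_mod m (s : seq D) : (0 < m)%N -> m%:R != 0 :> K ->
  size s = (m * N).+1 -> in_ideal_mod (relations m) (m * N).+2 (wq s).
Proof.
move=> m0 mK ss; have mN : (5 < m * N)%N by apply: leq_trans N6 (leq_pmull _ m0).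
case: s ss => [//|a s] ss.
have [w|nw] := boolP (is_walk (sr a) (a :: s : seq (arrow Q))); last first.
  by rewrite word_nonwalk //; apply: in_ideal_mod_mpow; apply: mpow0.
have [->|[s1 [b [s2 es]]]] := walk_turn w; last first.
  rewrite es -!word_cat; move: ss; rewrite es !size_cat /= => ss.
  have h1 : in_ideal_mod (relations m) (size s1) (wq s1).
    by apply: in_ideal_mod_mpow; apply: mpow_word.
  have h2 : in_ideal_mod (relations m) (size s2) (wq s2).
    by apply: in_ideal_mod_mpow; apply: mpow_word.
  have := in_ideal_modM h1 (in_ideal_modM (turn_in_ideal_mod b m0) h2).
  by apply: in_ideal_mod_le; lia.
rewrite ss /=; have := iter_gM fiber2 hf m a => ea.
(* The relation at [a], multiplied by [a] on both sides. *)
have -> : wq (a :: traject g (g a) (m * N)) =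
    m%:R^-1 *: (wq [:: a; f a] * wq [:: f (f a); a]
                - wq [:: a] * deriv_pot (potW m) (a : arrow Q) * wq [:: a]).
  rewrite deriv_W // mulrBr mulrBl !word_cat /= opprB addrC subrK.
  rewrite -cpa_scaleAr -cpa_scaleAl scalerA mulVf // scale1r !word_cat /=.
  congr (word (_ :: _)); move: ea; case: (m * N)%N mN => // n _ e.
  by rewrite trajectSr -iterSr e cats1.
apply: in_ideal_modZ; apply: in_ideal_modD.
  have := in_ideal_modM (turn_in_ideal_mod a m0) (turn_in_ideal_mod (f (f a)) m0).
  by rewrite ff; apply: in_ideal_mod_le; move: mN; clear; move: (m * N)%N => k; lia.
rewrite -scaleN1r; apply: in_ideal_modZ; apply: in_ideal_mod_ideal.
exists [:: (wq [:: a], deriv_pot (potW m) (a : arrow Q), wq [:: a])].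
  by move=> t; rewrite inE => /eqP -> /=; exists (a : arrow Q).
by rewrite big_seq1.
Qed.

(** All paths of length [m * N + 1] can be pushed to higher order. *)
Lemma mpow_relations m x : (0 < m)%N -> m%:R != 0 :> K ->
  mpow (m * N).+1 x -> x \in closed_ideal (relations m).
Proof.
by move=> m0 mK; apply: mpow_closed_ideal => s es; apply: word_in_ideal_mod.
Qed.

Lemma word_square (a : arrow Q) : wq [:: a; a] = 0.
Proof.
apply: word_nonwalk; rewrite /= eqxx andbT /=; apply/eqP => e.
by apply: (no_loop_dart fiber2 hf (x := a)); rewrite -e.
Qed.

(** A ring embedding would send the long nonzero paths of the first algebra to
    zero. *)
Lemma no_jacobian_embedding m m' (phi : jacobian (potW m') -> jacobian (potW m)) :
  (0 < m)%N -> m%:R != 0 :> K -> (m' == 0)%N || (m < m')%N ->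
  {morph phi : x y / x * y} -> phi 1 = 1 -> phi 0 = 0 -> injective phi -> False.
Proof.
move=> m0 mK lt pM p1 p0 pI.
have kills s : ((m * N).+1 <= size s)%N -> wq s \in closed_ideal (relations m').
  apply: (embedding_kills_long_words pM p1 p0 pI word_square) => [d|x].
    exact: relations_mpow1.
  exact: mpow_relations.
case/orP: lt => [/eqP m'0|lt].
  have /negP[] := word_gpath_survives0 (m * N).+1; rewrite -m'0.
  by apply: kills; rewrite size_traject.
have /negP[] := @word_gpath_survives m' (leq_trans m0 (ltnW lt)); apply: kills.
by rewrite size_traject ltn_pmul2r // (leq_trans _ N6).
Qed.

Lemma jacobian_iso_eq m m' :
  (forall n, n \in [:: m; m'] -> (0 < n)%N -> n%:R != 0 :> K) ->
  jacobian_iso (potW m) (potW m') -> m = m'.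
Proof.
move=> hK [phi [[psi phiK psiK] _]].
have psiM : {morph psi : x y / x * y}.
  by move=> x y; apply: (can_inj phiK); rewrite psiK rmorphM /= !psiK.
have psi1 : psi 1 = 1 by apply: (can_inj phiK); rewrite psiK rmorph1.
have psi0 : psi 0 = 0 by apply: (can_inj phiK); rewrite psiK rmorph0.
have E1 := no_jacobian_embedding (phi := psi) _ _ _ psiM psi1 psi0 (can_inj psiK).
have E2 := no_jacobian_embedding (phi := phi) _ _ _ (rmorphM phi) (rmorph1 phi)
  (rmorph0 phi) (can_inj phiK).
have mK : (0 < m)%N -> m%:R != 0 :> K by apply: hK; rewrite inE eqxx.
have mK' : (0 < m')%N -> m'%:R != 0 :> K by apply: hK; rewrite !inE eqxx orbT.
case: (ltngtP m m') => // lt.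
  have p' : (0 < m')%N by apply: leq_ltn_trans lt.
  have [e|p] := posnP m; first by case: (E2 p' (mK' p')); rewrite e.
  by case: (E1 p (mK p)); rewrite lt orbT.
have p : (0 < m)%N by apply: leq_ltn_trans lt.
have [e'|p'] := posnP m'; first by case: (E1 p (mK p)); rewrite e'.
by case: (E2 p' (mK' p')); rewrite lt orbT.
Qed.

End OnePuncture.

(** * The infinite family *)

Lemma natr_neq0_pchar (K : fieldType) m : (0 < m)%N ->
  (forall p, p \in [pchar K] -> ~~ (p %| m)%N) -> m%:R != 0 :> K.
Proof.
move=> m0 hm; apply/negP => e; have [p hp] := natf0_pchar m0 e.
by have := hm p hp; rewrite (dvdn_pcharf hp) e.
Qed.

(** The exponents that are 1 modulo the characteristic. *)
Lemma coprime_pchar_progression (K : fieldType) : exists2 q : nat, (0 < q)%N &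
  forall j p, p \in [pchar K] -> ~~ (p %| q * j + 1)%N.
Proof.
have [[p hp]|none] := pselect (exists p, p \in [pchar K]); last first.
  by exists 1%N => // j p hp; case: none; exists p.
exists p => [|j p' hp']; first by rewrite prime_gt0 ?(pcharf_prime hp).
rewrite (_ : p' = p); first by rewrite dvdn_addr ?dvdn_mulr // dvdn1 neq_ltn prime_gt1 ?orbT ?(pcharf_prime hp).
by have := pcharf_eq hp p'; rewrite hp' => /esym/eqP.
Qed.

Theorem corollary9p20 (K : fieldType) (T : triangulation)
    (one_puncture : punctures T = 1%N) (a : arrow (adjacency_quiver T)) :
  let Q := adjacency_quiver T in
  let W (R : nat -> K) : potential K Q := pot_R (@tri_f T) R a in
  let S : set (potential K Q) :=
    ([set W (@R_ K 0)] `|`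
     [set W (@R_ K m) | m in [set m | (1 <= m)%N /\
        forall p, p \in [pchar K] -> ~~ (p %| m)%N]])%classic in
  (forall R : nat -> K, R 0%N = 0 -> nondegenerate_qp (QP Q (W R))) /\
  [/\ infinite_set S,
      (forall P, S P -> nondegenerate_qp (QP Q P)) &
      forall P P', S P -> S P' -> P <> P' -> ~ jacobian_iso P P'].
Proof.
move=> Q W S.
have nondeg R : R 0%N = 0 -> nondegenerate_qp (QP Q (W R)).
  by move=> R0; apply: adjacency_nondegenerate.
have SE P : S P -> exists2 m, ((0 < m)%N -> m%:R != 0 :> K) & P = W (@R_ K m).
  case=> [->|[m [m0 hm] <-]]; first by exists 0%N.
  by exists m => // _; apply: natr_neq0_pchar.
have iso_eq m m' : ((0 < m)%N -> m%:R != 0 :> K) -> ((0 < m')%N -> m'%:R != 0 :> K) ->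
    jacobian_iso (W (@R_ K m)) (W (@R_ K m')) -> m = m'.
  move=> h h'; apply: (@jacobian_iso_eq _ _ K _ (@side_of_twice T) _ (tri_f_one_puncture one_puncture) a).
  by move=> n; rewrite !inE => /orP[]/eqP ->.
split=> //; split.
- have [q q0 hq] := coprime_pchar_progression K.
  pose P j := W (@R_ K (q * j + 1)).
  have natK j : (q * j + 1)%:R != 0 :> K.
    by apply: natr_neq0_pchar; [rewrite addn1 | apply: hq].
  have P_inj : injective P.
    move=> i j e; have : (q * i + 1 = q * j + 1)%N.
      apply: iso_eq => //; rewrite -[W _]/(P i) e.
      by exists idfun; split=> //; exists idfun.
    by move/addIn/eqP; rewrite eqn_pmul2l // => /eqP.
  have PS : (range P `<=` S)%classic.
    by move=> _ [j _ <-]; right; exists (q * j + 1)%N => //; split=> [|p]; [rewrite addn1 | apply: hq].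
  move=> /(sub_finite_set PS); rewrite (eq_finite_set (inj_card_eq _)); first exact: infinite_nat.
  by move=> i j _ _; apply: P_inj.
- by move=> P /SE[m _ ->]; apply: nondeg; rewrite /R_; case: m.
move=> P P' /SE[m hm ->] /SE[m' hm' ->] ne /(iso_eq _ _ hm hm') e.
by apply: ne; rewrite e.
Qed.
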